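(* Every $n$-vertex graph of genus $g$ admits a voxel representation of size $O((g+1)^2 n\log^2 n)$. That is, there is an absolute constant $C>0$ such that for all integers $n\ge 2$ and $g\ge 0$, every graph with $n$ vertices and genus $g$ has a voxel representation of size at most $C\,(g+1)^2\, n\,(\log n)^2$.
   Context: All graphs are finite and simple. A voxel is a cell of the unit cube grid in 3-dimensional space; two distinct voxels are adjacent if they share a face. A blob is a nonempty finite set of voxels that is connected with respect to this adjacency. A voxel representation of a graph $G=(V,E)$ assigns to each vertex $v\in V$ a blob $B_v$ such that the blobs of distinct vertices are disjoint and, for all distinct $u,v\in V$, some voxel of $B_u$ is adjacent to some voxel of $B_v$ if and only if $uv\in E$. Its size is $\sum_{v\in V}|B_v|$. The genus of a graph is the minimum genus of an (orientable) surface in which it can be embedded without crossings; planar graphs are the graphs of genus $0$. *)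

(* Defs.v *)
From HB Require Import structures.
From mathcomp Require Import all_boot all_order all_algebra.
From mathcomp Require Import finmap.
From mathcomp Require Import all_classical all_reals all_analysis.

Set Implicit Arguments.
Unset Strict Implicit.
Unset Printing Implicit Defensive.

Import Order.TTheory GRing.Theory Num.Theory.
Import numFieldNormedType.Exports.

Local Open Scope classical_set_scope.
Local Open Scope ring_scope.

Record sgraph := SGraph {
  vertex :> finType;
  adj : rel vertex;
  adj_sym : symmetric adj;
  adj_irrefl : irreflexive adj }.

Definition edges (G : sgraph) : {set {set G}} :=
  [set [set uv.1; uv.2]%SET | uv in [pred uv : G * G | adj uv.1 uv.2]]%SET.

(* The triple (x, y, z) stands for the cell [x,x+1] * [y,y+1] * [z,z+1] of the
   unit cube grid; two cells share a face iff their indices are at l1-distance 1. *)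
Definition voxel : Type := (int * int * int)%type.

Definition vadj : rel voxel := fun a b =>
  (`|a.1.1 - b.1.1| + `|a.1.2 - b.1.2| + `|a.2 - b.2| == 1)%R.

Definition vconnected (B : {fset voxel}) : Prop :=
  forall a b : voxel, a \in B -> b \in B ->
  exists p : seq voxel,
    [/\ path vadj a p, last a p = b & {subset p <= B}].

Definition blob (B : {fset voxel}) : Prop := B != fset0 /\ vconnected B.

Definition touching (A B : {fset voxel}) : Prop :=
  exists a b : voxel, [/\ a \in A, b \in B & vadj a b].

Definition voxel_representation (G : sgraph) (B : G -> {fset voxel}) : Prop :=
  [/\ forall v, blob (B v),
      forall u v, u != v -> [disjoint B u & B v]%fset
    & forall u v, u != v -> (touching (B u) (B v) <-> adj u v)].

Definition rep_size (G : sgraph) (B : G -> {fset voxel}) : nat :=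
  (\sum_(v : G) #|` B v|)%N.

Section Genus.
Context (R : realType).

Definition space3 : Type := (R * R * R)%type.

(* A rectangular slab drilled through by g parallel square holes: a handlebody
   with g handles. *)
Definition handlebody (g : nat) : set space3 :=
  [set q : space3 |
    [/\ 0 <= q.1.1 <= (2 * g + 1)%N%:R, 0 <= q.1.2 <= 3, 0 <= q.2 <= 1
      & forall i : nat, (i < g)%N ->
          ~ ((2 * i + 1)%N%:R < q.1.1 < (2 * i + 2)%N%:R /\ 1 < q.1.2 < 2)]].

(* Its topological boundary: by the classification of surfaces this is, up to
   homeomorphism, the closed connected orientable surface of genus g. *)
Definition surface (g : nat) : set space3 := handlebody g `\` (handlebody g)°.

(* Vertices go to distinct points p v, and an edge e = {u, v} goes to a simple
   arc a e, parametrised by [0, 1], with end points p u and p v.  No vertex lies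
   in the interior of an arc and the interiors of distinct arcs are disjoint. *)
Definition embedding (G : sgraph) (S : set space3)
    (p : G -> space3) (a : {set G} -> R -> space3) : Prop :=
  [/\ injective p /\ (forall v, S (p v)),
      forall e, e \in edges G ->
        [/\ {within `[0, 1], continuous (a e)},
            {in `[0, 1] &, injective (a e)},
            a e @` `[0, 1] `<=` S
          & a e @` [set 0; 1] = p @` [set` e]],
      forall e v t, e \in edges G -> t \in `]0, 1[ -> a e t != p v
    & forall e f s t, e \in edges G -> f \in edges G -> e != f ->
        s \in `]0, 1[ -> t \in `]0, 1[ -> a e s != a f t].

Definition embeddable (G : sgraph) (S : set space3) : Prop :=
  exists p a, @embedding G S p a.

Definition has_genus (G : sgraph) (g : nat) : Prop :=
  embeddable G (surface g) /\
  forall h : nat, embeddable G (surface h) -> (g <= h)%N.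

End Genus.

(* Main.v *)
(* Chop the surface into the square faces of a very fine cubical mesh. The arcs of
   an embedded graph G meet pairwise disjoint connected sets of faces, so G is a
   minor of the face graph M of the mesh. As the first cohomology over F_2 of the
   surface has dimension O(g), an Euler type count gives |E| <= 3(|V| + O(g)) for
   every minor of M; in particular M has no clique minor of order h = O(sqrt(g+1)).
   Since M has maximum degree 4, G is a contraction of a graph H of maximum degree
   4 on N = O(sqrt(g+1) n) vertices which is itself a minor of M, and it suffices
   to represent H. The separators of Alon, Seymour and Thomas bisect every set of
   2^a vertices exactly, cutting only O(h^(3/2) 2^(a/2)) edges, so that H can be laid out
   recursively in a flat box. Vertices become vertical pillars, the cut edges of
   each bisection are wired in horizontal planes of their own, and parts that are
   separated horizontally share their planes. The total length of the wires and
   pillars is O(h^3 N log N) = O((g+1)^2 n log n), within the required bound. *)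

(* The arcs may be arbitrarily wild curves. Compactness replaces them at once by finite sets of mesh
   faces, and from then on the topology of the surface enters only through the edge bound for
   minors, proved by linear algebra over F_2. The mesh may be huge, but its size does not enter the
   bound, because degree reduction keeps only O(|V| + |E|) vertices. Bounded degree is needed
   because separators consist of vertices while the layout pays for edges. Exact bisection is needed
   because each half must fit into a box with 2^a positions. Let s be about sqrt(g+1). A cut at
   scale 2^a has O(s^(3/2) 2^(a/2)) edges. Each of them may climb through as many planes, since
   every cut edge gets a plane of its own. The product s^3 2^a is the cost of one cut and explains
   the cube of h in the overview; the fourth power of s comes from N = O(s n). *)
Require Import Defs.
From mathcomp Require Import all_boot all_order all_algebra.
From mathcomp Require Import finmap.
From mathcomp Require Import zify.

Set Implicit Arguments.
Unset Strict Implicit.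
Unset Printing Implicit Defensive.

(** * Connected sets and minor models *)

(* Elaborating cardinals of sets of sets leaves [reverse_coercion] in some
   places only, which hides equal atoms from [lia]. *)
Ltac slia := unfold reverse_coercion in *; lia.

Lemma leq_cardsU (T : finType) (A B : {set T}) : #|A :|: B| <= #|A| + #|B|.
Proof. by rewrite cardsU leq_subr. Qed.

Section Connected.
Variables (T : finType) (e : rel T).
Implicit Types (A B X : {set T}) (x y : T).

Definition inside A x y := [&& x \in A, y \in A & e x y].
Arguments inside A x y /.

Definition conn A := {in A &, forall x y, connect (inside A) x y}.

Lemma inside_mono A B x y :
  A \subset B -> connect (inside A) x y -> connect (inside B) x y.
Proof.
move=> sAB; apply: connect_sub => u v /= /and3P[uA vA uv].
by apply/connect1/and3P; rewrite !(subsetP sAB).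
Qed.

Lemma connect_inside A x y : connect (inside A) x y -> x \in A -> y \in A.
Proof.
case/connectP=> p; elim: p x => [|z p IH] x /=; first by move=> _ ->.
by case/andP=> /and3P[_ zA _] pz yE _; apply: IH pz yE zA.
Qed.

Lemma conn1 x : conn [set x].
Proof. by move=> a b /set1P-> /set1P->. Qed.

Lemma conn0 : conn set0.
Proof. by move=> a b; rewrite inE. Qed.

Lemma conn_closed A X :
  conn A -> X \subset A -> X != set0 ->
  (forall x y, x \in X -> y \in A -> e x y -> y \in X) -> X = A.
Proof.
move=> cA sXA /set0Pn[x xX] clX; apply/eqP; rewrite eqEsubset sXA /=.
apply/subsetP=> y yA.
have [p] := connectP (cA x y (subsetP sXA _ xX) yA).
elim: p x xX => [|z p IH] x xX /=; first by move=> _ ->.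
case/andP=> /and3P[_ zA xz] pz; apply: IH => //; exact: clX xz.
Qed.

Hypothesis e_sym : symmetric e.

Lemma inside_csym A : connect_sym (inside A).
Proof. by apply: sym_connect_sym => x y /=; rewrite e_sym andbCA. Qed.

Lemma conn_hub A x :
  (forall y, y \in A -> connect (inside A) x y) -> conn A.
Proof.
move=> h a b aA bA; apply: (connect_trans (y := x)); last exact: h.
by rewrite inside_csym; apply: h.
Qed.

(** Converse of [conn_closed]: together the two turn connectivity into a closure property, so that
    unions and contractions can be treated below without concatenating paths. *)
Lemma closed_conn A :
  (forall X, X \subset A -> X != set0 ->
    (forall x y, x \in X -> y \in A -> e x y -> y \in X) -> X = A) -> conn A.
Proof.
move=> h x y xA yA.
suff E : [set z in A | connect (inside A) x z] = A.
  by move: yA; rewrite -{1}E inE => /andP[].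
apply: h => [||u v].
- by apply/subsetP=> z; rewrite inE => /andP[].
- by apply/set0Pn; exists x; rewrite inE xA connect0.
rewrite !inE => /andP[uA xu] vA uv; rewrite vA; apply: connect_trans xu _.
by apply: connect1; rewrite /= uA vA.
Qed.

Lemma connU A B x y : conn A -> conn B -> x \in A -> y \in B ->
  (x == y) || e x y -> conn (A :|: B).
Proof.
move=> cA cB xA yB xy; apply: (@conn_hub _ x) => z /setUP[zA|zB].
  by apply: inside_mono (cA _ _ xA zA); apply: subsetUl.
apply: (connect_trans (y := y)); last first.
  by apply: inside_mono (cB _ _ yB zB); apply: subsetUr.
case/orP: xy => [/eqP->//|xy]; apply: connect1; rewrite /= xy !inE xA yB.
by rewrite orbT.
Qed.

Definition component A x := [set y in A | connect (inside A) x y].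

Lemma comp_sub A x : component A x \subset A.
Proof. by apply/subsetP=> y; rewrite inE => /andP[]. Qed.

Lemma comp_refl A x : x \in A -> x \in component A x.
Proof. by move=> xA; rewrite inE xA connect0. Qed.

Lemma comp_closed A x y z :
  y \in component A x -> z \in A -> e y z -> z \in component A x.
Proof.
rewrite !inE => /andP[yA xy] zA yz; rewrite zA; apply: connect_trans xy _.
by apply: connect1; rewrite /= yA zA.
Qed.

Lemma comp_conn A x : conn (component A x).
Proof.
have [xA|xA] := boolP (x \in A); last first.
  move=> a b; rewrite inE => /andP[aA]; rewrite inside_csym => h.
  by move: (connect_inside h aA); rewrite (negPf xA).
apply: (@conn_hub _ x) => y; rewrite inE => /andP[yA /connectP[p]].
elim/last_ind: p y yA => [|p z IH] y yA; first by move=> _ ->.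
rewrite rcons_path last_rcons => /andP[px pz] ->.
have /and3P[lA zA lz] := pz.
apply: connect_trans (IH _ lA px erefl) _; apply: connect1.
have lc : last x p \in component A x.
  by rewrite inE lA; apply/connectP; exists p.
by apply/and3P; split=> //; apply: comp_closed lc zA lz.
Qed.

Lemma conn_sub_comp A B x : conn B -> B \subset A -> x \in B -> B \subset component A x.
Proof.
move=> cB sBA xB; apply/subsetP=> y yB; rewrite inE (subsetP sBA) //=.
exact: inside_mono sBA (cB _ _ xB yB).
Qed.

(** Induction along a connected set: a property [A] that holds somewhere on [B] and spreads along
    the edges inside [B] holds on all of [B]. *)
Lemma conn_absorb A B x : conn B -> x \in B -> x \in A ->
  (forall y z, y \in A -> y \in B -> z \in B -> e y z -> z \in A) -> B \subset A.
Proof.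
move=> cB xB xA h; suff <- : A :&: B = B by apply: subsetIl.
apply: (conn_closed cB); first exact: subsetIr.
  by apply/set0Pn; exists x; rewrite inE xA.
move=> y z; rewrite !inE => /andP[yA yB] zB yz; rewrite zB andbT.
exact: h yz.
Qed.

End Connected.
Arguments inside {T} e A x y /.

Definition minor_model (G H : finType) (eG : rel G) (eH : rel H)
    (U : G -> {set H}) :=
  [/\ forall v, U v != set0, forall v, conn eH (U v),
      forall u v, u != v -> [disjoint U u & U v]
    & forall u v, eG u v -> exists x y, [/\ x \in U u, y \in U v & eH x y]].

(** Two nested absorptions give connectivity: a closed part of the union swallows every [W x] that
    it meets, and then, along the edges of the connected [U v], all the others. *)
Lemma minor_model_trans (G H M : finType) (eG : rel G) (eH : rel H)
    (eM : rel M) (symM : symmetric eM) (U : G -> {set H}) (W : H -> {set M}) :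
  minor_model eG eH U -> minor_model eH eM W ->
  minor_model eG eM (fun v => \bigcup_(x in U v) W x).
Proof.
move=> [U0 Uc Ud Ue] [W0 Wc Wd We]; split=> [v|v|u v uv|u v /Ue].
- have /set0Pn[x xU] := U0 v; have /set0Pn[z zW] := W0 x.
  by apply/set0Pn; exists z; apply/bigcupP; exists x.
- apply: closed_conn => // X sX /set0Pn[z zX] clX.
  have cW x : x \in U v -> forall a, a \in W x -> a \in X -> W x \subset X.
    move=> xU a aW aX; apply: (conn_absorb (Wc x) aW aX) => y t yX _ tW.
    by apply: clX => //; apply/bigcupP; exists x.
  have /bigcupP[x0 x0U zW] := subsetP sX _ zX.
  have sW0 := cW _ x0U _ zW zX.
  apply/eqP; rewrite eqEsubset sX /=; apply/bigcupsP.
  suff: U v \subset [set x | W x \subset X] by move=> /subsetP h x /h; rewrite inE.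
  apply: (conn_absorb (Uc v) x0U); first by rewrite inE.
  move=> y t; rewrite !inE => yX yU tU /We [a [b [aW bW ab]]].
  apply: (cW _ tU b bW); apply: clX ab; first exact: (subsetP yX).
  by apply/bigcupP; exists t.
- rewrite -setI_eq0; apply/eqP/setP=> z; rewrite !inE; apply/negP.
  case/andP=> /bigcupP[x xU zx] /bigcupP[y yU zy].
  have [exy|nxy] := eqVneq x y.
    by have /pred0P/(_ x) := Ud _ _ uv; rewrite /= xU exy yU.
  by have /pred0P/(_ z) := Wd _ _ nxy; rewrite /= zx zy.
case=> x [y [xU yU /We [a [b [ax By ab]]]]]; exists a, b.
by split=> //; apply/bigcupP; [exists x|exists y].
Qed.

(** * Small trees and small cuts by search in a layered graph *)

Section LayeredSearch.
Variables (T : finType) (e : rel T) (e_sym : symmetric e).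
Variables (B : {set T}) (k : nat) (A : 'I_k.+1 -> {set T}).

(* The state (v, j) is reached within m moves by a walk of B that ends in v and
   has met A 0, ..., A j in this order. *)
Fixpoint reach (m : nat) : {set T * 'I_k.+1} :=
  if m is m'.+1 then
    reach m' :|: [set s | [exists r in reach m',
      ((r.2 == s.2) && (s.1 \in B) && e r.1 s.1)
      || [&& r.1 == s.1, r.2.+1 == s.2 & s.1 \in A s.2]]]
  else [set s | [&& s.1 \in B, s.1 \in A s.2 & s.2 == ord0]].

Lemma reachS m : reach m \subset reach m.+1.
Proof. exact: subsetUl. Qed.

Lemma reach_le m m' : m <= m' -> reach m \subset reach m'.
Proof.
move=> /subnK <-; elim: (m' - m) => [|d IH]; first exact: subxx.
by apply: subset_trans IH _; rewrite addSn reachS.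
Qed.

Lemma reach_step m v w j :
  (v, j) \in reach m -> w \in B -> e v w -> (w, j) \in reach m.+1.
Proof.
move=> vR wB vw /=; rewrite !inE; apply/orP; right.
by apply/existsP; exists (v, j); rewrite vR /= eqxx wB vw.
Qed.

Lemma reach_next m v (j j' : 'I_k.+1) :
  (v, j) \in reach m -> v \in A j' -> j' = j.+1 :> nat ->
  (v, j') \in reach m.+1.
Proof.
move=> vR wB jj /=; rewrite !inE; apply/orP; right.
by apply/existsP; exists (v, j); rewrite vR /= wB !eqxx jj eqxx orbT.
Qed.

(** [D] is the set of vertices of the walk; a move to the next layer adds no vertex, so m moves give
    at most m + 1 of them. *)
Lemma reach_walk m v j : (v, j) \in reach m ->
  exists D : {set T}, [/\ D \subset B, conn e D, v \in D, #|D| <= m.+1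
    & forall i : 'I_k.+1, i <= j -> D :&: A i != set0].
Proof.
elim: m v j => [|m IH] v j /=.
  rewrite inE /= => /and3P[vB vA /eqP j0]; exists [set v]; split.
  - by rewrite sub1set.
  - exact: conn1.
  - by rewrite inE.
  - by rewrite cards1.
  - move=> i; rewrite j0 leqn0 => /eqP i0; apply/set0Pn; exists v.
    by rewrite !inE eqxx /= (_ : i = j) // j0; apply: val_inj.
rewrite !inE => /orP[/IH[D [DB Dc vD cD DA]]|].
  by exists D; split=> //; lia.
case/existsP=> -[w j'] /andP[/IH[D [DB Dc wD cD DA]] /= /orP[]].
  move=> /andP[/andP[/eqP<- vB] wv]; exists (v |: D); split.
  - by rewrite subUset sub1set vB.
  - apply: (connU e_sym (conn1 e (x:=v)) Dc (set11 v) wD).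
    by rewrite e_sym wv orbT.
  - by rewrite !inE eqxx.
  - by rewrite cardsU1; lia.
  - move=> i /DA /set0Pn[z]; rewrite inE => /andP[zD zA].
    by apply/set0Pn; exists z; rewrite !inE zD zA orbT.
case/and3P=> /eqP<- /eqP jE wA; exists D; split=> // [|i]; first lia.
rewrite -jE leq_eqVlt ltnS => /orP[|]; last by move/DA.
rewrite jE => /eqP ij; apply/set0Pn; exists w.
by rewrite inE wD (_ : i = j) //; apply: val_inj.
Qed.

Lemma reach_sub m : reach m \subset [set s | s.1 \in B].
Proof.
elim: m => [|m IH]; first by apply/subsetP=> s; rewrite !inE => /and3P[].
apply/subsetP=> s; rewrite /= !inE => /orP[/(subsetP IH)|]; first by rewrite inE.
case/existsP=> r /andP[/(subsetP IH)] + /orP[/andP[/andP[]]//|].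
by rewrite !inE => rB /and3P[/eqP<-].
Qed.

Lemma card_reach m : #|reach m| <= #|B| * k.+1.
Proof.
apply: leq_trans (subset_leq_card (reach_sub m)) _.
rewrite (_ : [set s | _] = setX B setT); last first.
  by apply/setP=> -[v j]; rewrite !inE andbT.
by rewrite cardsX cardsT card_ord.
Qed.

(** No move inside [D] leads out of [reach m]. As [D] is connected, a layer reached at one vertex of
    [D] is reached at all of them, in particular at one in the next set [A j]. Hence the fixed order
    of the sets is no restriction. *)
Lemma reach_trap m (D : {set T}) : D \subset B -> conn e D ->
  (forall i, D :&: A i != set0) ->
  (forall s, s \in reach m.+1 :\: reach m -> s.1 \notin D) ->
  (exists2 v, v \in D & (v, ord0) \in reach m) ->
  forall v j, v \in D -> (v, j) \in reach m.
Proof.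
move=> DB Dc DA av [v0 v0D v0R].
have spread v j : v \in D -> (v, j) \in reach m ->
    forall w, w \in D -> (w, j) \in reach m.
  move=> vD vR w wD.
  suff /subsetP/(_ _ wD) : D \subset [set w | (w, j) \in reach m] by rewrite inE.
  apply: (conn_absorb Dc vD); first by rewrite inE.
  move=> y z; rewrite !inE => yR yD zD yz.
  apply: contraT => zR; have := av (z, j); rewrite inE zR /= zD; apply.
  by apply: reach_step yz => //; apply: (subsetP DB).
move=> v [j jk] vD; elim: j jk v vD => [|j IH] jk v vD.
  by rewrite (_ : Ordinal jk = ord0); [apply: (spread v0)|apply: val_inj].
have /set0Pn[z] := DA (Ordinal jk); rewrite inE => /andP[zD zA].
apply: (spread z) => //; have zR := IH (ltnW jk) z zD.
apply: contraT => nR; have := av (z, Ordinal jk); rewrite inE nR /= zD; apply.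
exact: reach_next zR zA _.
Qed.

End LayeredSearch.

(** Breadth-first search on the pairs of a vertex of [B] and a layer, at most q * q in number. If
    the last layer is reached within q - 1 moves, the walk is the tree [D]. Otherwise one of the q
    disjoint levels has at most q states, and its projection is the cut [Z]. *)
Lemma tree_or_cut (T : finType) (e : rel T) (e_sym : symmetric e)
    (B : {set T}) (k q : nat) (A : 'I_k -> {set T}) :
  B != set0 -> 0 < q -> #|B| * k <= q * q ->
  (exists D : {set T}, [/\ D \subset B, D != set0, conn e D, #|D| <= q
     & forall i, D :&: A i != set0]) \/
  (exists Z : {set T}, [/\ Z \subset B, #|Z| <= q
     & forall D : {set T}, D \subset B :\: Z -> conn e D -> exists i, D :&: A i = set0]).
Proof.
case: k A => [|k] A B0 q0 cB.
  left; have /set0Pn[v vB] := B0; exists [set v]; split.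
  - by rewrite sub1set.
  - by apply/set0Pn; exists v; rewrite inE.
  - exact: conn1.
  - by rewrite cards1.
  - by case.
have [/existsP[v vR]|noR] := boolP [exists v, (v, ord_max) \in reach e B A q.-1].
  left; have [D [DB Dc vD cD DA]] := reach_walk e_sym vR.
  exists D; split=> //; first by apply/set0Pn; exists v.
    by rewrite (prednK q0) in cD.
  by move=> i; apply: DA; rewrite -ltnS.
right.
pose L i := if i is i'.+1 then reach e B A i'.+1 :\: reach e B A i'
            else reach e B A 0.
have [i iq cL] : exists2 i, i < q & #|L i| <= q.
  have [/existsP[i cL]|/existsPn h] := boolP [exists i : 'I_q, #|L i| <= q].
    by exists (val i); rewrite ?ltn_ord.
  have big m : m < q -> m.+1 * q.+1 <= #|reach e B A m|.
    elim: m => [|m IH] mq; first by have := h (Ordinal mq); rewrite -ltnNge mul1n.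
    have := h (Ordinal mq); rewrite -ltnNge /L => cL.
    rewrite mulSn -(setID (reach e B A m.+1) (reach e B A m)) cardsU.
    rewrite (_ : _ :&: _ :&: _ = set0); last first.
      by apply/setP=> s; rewrite !inE; case: (s \in reach e B A m); rewrite ?andbF.
    rewrite cards0 subn0 (setIidPr (reachS _ _ _ _)) addnC.
    by apply: leq_add => //; apply: IH; apply: ltnW.
  have qq : q.-1 < q by rewrite prednK.
  have := big _ qq; have := card_reach e B A q.-1; rewrite prednK //; nia.
exists ([set s.1 | s in L i] :&: B); split; first exact: subsetIr.
  by apply: leq_trans (subset_leq_card (subsetIl _ _)) (leq_trans (leq_imset_card _ _) cL).
move=> D DB Dc.
have [/existsP[j /eqP Dj]|/existsPn h] := boolP [exists j, D :&: A j == set0].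
  by exists j.
exfalso; have sDB : D \subset B by apply: subset_trans DB (subsetDl _ _).
have avL s : s \in L i -> s.1 \notin D.
  move=> sL; apply: contraL (sL) => sD.
  move: (subsetP DB _ sD); rewrite !inE (subsetP sDB _ sD) andbT andbT.
  by move=> /imsetP sN; apply/negP=> _; apply: sN; exists s.
have /set0Pn[v0] := h ord0; rewrite inE => /andP[v0D v0A].
have v0R : (v0, ord0) \in reach e B A 0 by rewrite inE /= v0A eqxx (subsetP sDB).
(* Level 0 contains a start of the search that lies in [D], so the small level is a later one, and
   the search is trapped just before it. *)
case: i iq {cL DB} avL => [|i] iq avL; first by have := avL _ v0R; rewrite v0D.
apply: (negP noR); apply/existsP; exists v0; apply: (subsetP (reach_le _ _ _ (m := i) _)); first by lia.
apply: (reach_trap sDB Dc h avL) => //.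
by exists v0 => //; apply: (subsetP (reach_le _ _ _ (leq0n i))).
Qed.

(** * Separators in graphs without a large clique minor *)

Section Separator.
Variables (T : finType) (e : rel T) (e_sym : symmetric e).
Variables (W : {set T}) (h q : nat).
Hypotheses (q_gt0 : 0 < q) (card_W : #|W| * h <= q * q).
Implicit Types (X Y Z B C D : {set T}) (CC : {set {set T}}).

Definition clique_family CC :=
  (forall C, C \in CC -> [/\ C != set0, conn e C & C \subset W]) /\
  (forall C D, C \in CC -> D \in CC -> C != D ->
     [disjoint C & D] /\ exists x y, [/\ x \in C, y \in D & e x y]).

Definition big X B :=
  [/\ B \subset W :\: X, conn e B, #|W| < 2 * #|B|
    & forall x y, x \in B -> y \in W :\: X -> e x y -> y \in B].

(** Two sets that each contain more than half of [W] meet, and a connected set avoiding [Y], hence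
    [X], cannot leave the component [B] that it meets. *)
Lemma big_mono X Y B B' : X \subset Y -> big X B -> big Y B' -> B' \subset B.
Proof.
move=> sXY [BW cB bB clB] [BW' cB' bB' _].
have [x xB xB'] : exists2 x, x \in B & x \in B'.
  have [/eqP I0|/set0Pn[x]] := boolP (B :&: B' == set0); last first.
    by rewrite inE => /andP[]; exists x.
  have : #|B :|: B'| <= #|W|.
    apply: subset_leq_card; rewrite subUset.
    by rewrite (subset_trans BW) ?(subset_trans BW') ?subsetDl.
  by rewrite cardsU I0 cards0; lia.
apply: (conn_absorb cB' xB' xB) => y z yB _ zB' yz; apply: clB yz => //.
by move: (subsetP BW' _ zB'); rewrite !inE => /andP[zY ->]; rewrite (contra (subsetP sXY z)).
Qed.

Hypothesis no_separator : forall X, X \subset W -> #|X| <= h * q ->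
  exists B, [/\ B \subset W :\: X, conn e B & #|W| < 2 * #|B|].

Lemma big_exists X : X \subset W -> #|X| <= h * q -> exists B, big X B.
Proof.
move=> XW cX; have [B [BW cB bB]] := no_separator XW cX.
have /set0Pn[x xB] : B != set0.
  by apply: contraTneq bB => ->; rewrite cards0 muln0 ltn0.
exists (component e (W :\: X) x); split.
- exact: comp_sub.
- exact: comp_conn.
- have := subset_leq_card (conn_sub_comp cB BW xB); lia.
- by move=> y z; apply: comp_closed.
Qed.

(* The invariant of Alon, Seymour and Thomas: CC consists of the branch sets found
   so far, which X barely meets, and the search goes on in the large component B
   of the complement of X. *)
Definition state X CC B :=
  [/\ clique_family CC, big X B, X \subset cover CC,
      forall C, C \in CC -> #|X :&: C| <= q
    & forall C, C \in CC -> [disjoint B & C]].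

Lemma card_state X CC B : state X CC B -> #|X| <= #|CC| * q.
Proof.
case=> _ _ XC Xq _.
have -> : X = \bigcup_(C in CC) (X :&: C).
  apply/setP=> x; apply/idP/bigcupP=> [xX|[C _]]; last by rewrite inE => /andP[].
  by have /bigcupP[C CC' xC] := subsetP XC _ xX; exists C => //; rewrite inE xX.

rewrite -sum_nat_const.
elim/big_rec2: _ => [|C n Y CC' IH]; first by rewrite cards0.
apply: leq_trans (leq_cardsU _ _) _; apply: leq_add => //; exact: Xq.
Qed.

Lemma state_subW X CC B : state X CC B -> X \subset W.
Proof.
case=> -[famC _] _ XC _ _; apply: subset_trans XC _; apply/bigcupsP=> C /famC.
by case.
Qed.

(** A branch set without neighbours in [B] does not bound [B], so its vertices can be released from
    [X] while [B] stays a component. *)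
Lemma state_drop X CC B C : state X CC B -> #|CC| <= h -> C \in CC ->
  (forall x y, x \in C -> y \in B -> ~~ e x y) -> state (X :\: C) (CC :\ C) B.
Proof.
move=> st cCC CCC nC; have := st; case=> -[f1 f2] [BW cB bB clB] XC Xq dB.
split.
- split=> [D|D E]; rewrite !inE; first by case/andP=> _ /f1.
  by move=> /andP[_ DC] /andP[_ EC]; apply: f2.
- split=> //.
    apply/subsetP=> x xB; have := subsetP BW _ xB; rewrite !inE => /andP[xX ->].
    by rewrite (negPf xX) andbF.
  move=> x y xB; rewrite !inE => /andP[nyX yW] xy.
  have [yX|yX] := boolP (y \in X); last by apply: clB xy; rewrite ?inE ?yX.
  by move: nyX; rewrite yX andbT negbK => yC; have := nC _ _ yC xB; rewrite e_sym xy.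
- apply/subsetP=> x; rewrite inE => /andP[xC /(subsetP XC)/bigcupP[D DC xD]].
  apply/bigcupP; exists D => //; rewrite !inE DC andbT.
  by apply: contraNneq xC => <-.
- move=> D; rewrite !inE => /andP[_ DC]; apply: leq_trans (Xq _ DC).
  by apply: subset_leq_card; apply: setSI; apply: subsetDl.
- by move=> D; rewrite !inE => /andP[_]; apply: dB.
Qed.

(** A tree that touches every branch set becomes a new one. It enters [X] entirely, which is
    affordable because it has at most q vertices. *)
Lemma state_add X CC B D B' : state X CC B -> D \subset B -> D != set0 ->
  conn e D -> #|D| <= q ->
  (forall C, C \in CC -> exists x y, [/\ x \in D, y \in C & e x y]) ->
  big (X :|: D) B' -> [/\ state (X :|: D) (D |: CC) B', D \notin CC,
     #|X :|: D| <= #|X| + #|D| & #|B'| + #|D| <= #|B|].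
Proof.
case=> -[f1 f2] bigB XC Xq dB DB D0 cD Dq Dt bigB'.
have dD C : C \in CC -> [disjoint D & C].
  by move=> /dB; apply: disjointWl.
have B'B : B' \subset B by apply: big_mono bigB bigB'; apply: subsetUl.
have B'D : [disjoint B' & D].
  case: bigB' => sB' _ _ _; apply/pred0P=> x /=; apply/negP=> /andP[/(subsetP sB')].
  by rewrite !inE => /andP[/norP[_ /negPf->]].
split; last by rewrite -(cardsUI B' D) disjoint_setI0 // cards0 addn0 subset_leq_card // subUset B'B.
- split=> //.
  + split=> [C|C E]; rewrite !inE.
      case/orP=> [/eqP->|/f1//]; split=> //; case: bigB => sB _ _ _.
      by apply: subset_trans DB _; apply: subset_trans sB (subsetDl _ _).
    case/orP=> [/eqP->|CC1] /orP[/eqP->|EC]; first by rewrite eqxx.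
    * by move=> _; split; [apply: dD|apply: Dt].
    * move=> _; split; first by rewrite disjoint_sym; apply: dD.
      by have [x [y [xD yC xy]]] := Dt _ CC1; exists y, x; rewrite e_sym.
    * exact: f2.
  + rewrite subUset; apply/andP; split.
      apply: subset_trans XC _; apply/bigcupsP=> C CC1.
      by apply: bigcup_sup; rewrite !inE CC1 orbT.
    by apply: bigcup_sup; rewrite !inE eqxx.
  + move=> C; rewrite !inE => /orP[/eqP->|CC1].
      rewrite setIUl setIid; apply: leq_trans Dq; apply: subset_leq_card.
      rewrite subUset subxx andbT; apply/subsetP=> x; rewrite inE => /andP[_ //].
    rewrite setIUl (disjoint_setI0 (dD _ CC1)) setU0; exact: Xq.
  + move=> C; rewrite !inE => /orP[/eqP->//|CC1].
    exact: disjointWl B'B (dB _ CC1).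
- apply: contra D0 => /dD; rewrite -setI_eq0 setIid => /eqP->; exact: eqxx.
- exact: leq_cardsU.
Qed.

(** The cut [Z] has severed [C] from the new large component [B1]. Let [C] swallow all that it
    reaches in [B] outside [B1]. Only vertices of [Z] then shield the enlarged set from [B1], so the
    old vertices of [C] may leave [X]. *)
Lemma state_swap X CC B Z B1 C : state X CC B -> #|CC| < h -> C \in CC ->
  (exists x y, [/\ x \in C, y \in B & e x y]) ->
  Z \subset B -> #|Z| <= q -> big (X :|: Z) B1 ->
  (forall x y, x \in C -> y \in B1 -> ~~ e x y) ->
  exists X' CC' B', [/\ state X' CC' B', #|CC'| = #|CC|
     & #|X'| + 3 * #|B'| < #|X| + 3 * #|B|].
Proof.
move=> st cCC CCC [x0 [y0 [x0C y0B xy0]]] ZB Zq bigB1 nC.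
have := st; case=> -[f1 f2] bigB XC Xq dB; have [C0 cC CW] := f1 _ CCC.
have [BW cB bB clB] := bigB; have [B1W cB1 bB1 clB1] := bigB1.
have B1B : B1 \subset B by apply: big_mono bigB bigB1; apply: subsetUl.
pose A := (C :|: B) :\: B1; pose C' := component e A x0.
have CA : C \subset A.
  apply/subsetP=> x xC; rewrite !inE xC andbT.
  by apply: contraTN xC => /(subsetP B1B) xB; move/pred0P/(_ x): (dB _ CCC) => /=; rewrite xB /= => ->.
have x0A := subsetP CA _ x0C.
have CC' : C \subset C' by apply: conn_sub_comp.
have stepC' x y : x \in C' -> y \in B -> e x y -> y \notin B1 -> y \in C'.
  by move=> xC' yB xy yB1; apply: comp_closed xC' _ xy; rewrite !inE yB1 yB orbT.
have C'A : C' \subset A := comp_sub _ _ _.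
have cC' : conn e C' by apply: comp_conn.
clearbody C'.
pose X' := (X :\: C) :|: (Z :&: C').
have X'W : X' \subset W.
  rewrite subUset (subset_trans (subsetDl _ _) (state_subW st)) /=.
  apply: subset_trans (subsetIl _ _) (subset_trans ZB _).
  exact: subset_trans BW (subsetDl _ _).
have cX' : #|X'| <= h * q.
  apply: (@leq_trans (#|CC|.+1 * q)); last by rewrite leq_mul2r cCC orbT.
  rewrite mulSn addnC; apply: leq_trans (leq_cardsU _ _) (leq_add _ _).
    exact: leq_trans (subset_leq_card (subsetDl _ _)) (card_state st).
  exact: leq_trans (subset_leq_card (subsetIl _ _)) Zq.
have [B' bigB'] := big_exists X'W cX'; have [B'W cB' bB' clB'] := bigB'.
have B1B' : B1 \subset B'.
  by apply: big_mono bigB' bigB1; apply: setUSS; [apply: subsetDl|apply: subsetIl].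
(* To leave [B] a vertex of [B'] would have to step into [C], because the rest of the old [X] is in
   [X']. A vertex of [B] with a neighbour in [C'] outside [Z] either lies in [B1], and then so would
   that neighbour, or has itself been swallowed by [C']. *)
have sB' : B' \subset B :\: C'.
  have /set0Pn[z zB1] : B1 != set0.
    by apply: contraTneq bB1 => ->; rewrite cards0 muln0 ltn0.
  apply: (conn_absorb cB' (subsetP B1B' _ zB1)).
    rewrite inE (subsetP B1B _ zB1) andbT; apply: contraL zB1.
    by move=> /(subsetP C'A); rewrite inE => /andP[].
  move=> x y; rewrite inE => /andP[xC' xB] _ /(subsetP B'W).
  rewrite 2!in_setD [y \in X']in_setU [y \in X :\: C]in_setD [y \in Z :&: C']in_setI.
  move=> /andP[/norP[yX yZ] yW] xy.
  have [yB|yB] := boolP (y \in B).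
    rewrite andbT; apply/negP => yC'; rewrite yC' andbT in yZ.
    have [xB1|xB1] := boolP (x \in B1); last first.
      by move/negP: xC'; apply; apply: (stepC' y) => //; rewrite e_sym.
    suff yB1 : y \in B1.
      by move: (subsetP C'A _ yC'); rewrite inE yB1.
    apply: clB1 xB1 _ xy; rewrite !inE yW andbT negb_or yZ andbT.
    by move: (subsetP BW _ yB); rewrite inE => /andP[].
  have yX1 : y \in X.
    by apply: contraNT yB => yX1; apply: clB xB _ xy; rewrite inE yX1.
  rewrite yX1 andbT negbK in yX.
  have [xB1|xB1] := boolP (x \in B1).
    by have := nC _ _ yX xB1; rewrite e_sym xy.
  move/negP: xC'; case; apply: (stepC' y) => //; last by rewrite e_sym.
  exact: (subsetP CC').
have C'D D : D \in CC -> D != C -> [disjoint C' & D].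
  move=> DC DneC; apply: disjointWl C'A _.
  apply: disjointWl (subsetDl _ _) _; rewrite -setI_eq0 setIUl setU_eq0 !setI_eq0.
  by rewrite dB // andbT; have [] := f2 _ _ CCC DC; rewrite // eq_sym.
exists X', (C' |: (CC :\ C)), B'; split; last first.
(* [X] gains at most the size of [B :&: C'], and [B] loses that much. The intersection is nonempty:
   [y0] is adjacent to [C], hence not in [B1], and so it was swallowed. *)
- have bC : #|Z :&: C'| <= #|B :&: C'| by apply/subset_leq_card/setSI.
  have b1 : 0 < #|B :&: C'|.
    apply/card_gt0P; exists y0; rewrite inE y0B (stepC' x0) //.
      exact: (subsetP CC').
    by apply: contraL xy0 => /(nC _ _ x0C).
  move: bC b1 (subset_leq_card sB') (cardsID C' B) (leq_cardsU (X :\: C) (Z :&: C')).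
  move: (subset_leq_card (subsetDl X C)); rewrite -/X'.
  move: #|X'| #|X| #|X :\: C| #|B'| #|B| #|B :&: C'| #|B :\: C'| #|Z :&: C'|.
  by clear; lia.
- rewrite cardsU1 [in RHS](cardsD1 C) CCC in_setD1; congr (nat_of_bool _ + _).
  case: eqVneq => //= CC'n; apply/negP=> /C'D/(_ CC'n)/pred0P/(_ x0)/=.
  by rewrite andbb (subsetP CC').
split=> //.
- split=> [D|D E]; rewrite !inE.
    case/orP=> [/eqP->|/andP[_ /f1//]]; split.
    + by apply/set0Pn; exists x0; apply: (subsetP CC').
    + exact: cC'.
    + apply: subset_trans C'A _; apply: subset_trans (subsetDl _ _) _.
      by rewrite subUset CW (subset_trans BW) ?subsetDl.
  have tC F : F \in CC -> F != C -> exists x y, [/\ x \in C', y \in F & e x y].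
    move=> FC FneC; have [|_ [x [y [xC yF xy]]]] := f2 _ _ CCC FC; first by rewrite eq_sym.
    by exists x, y; rewrite (subsetP CC').
  case/orP=> [/eqP->|/andP[DnC DC]] /orP[/eqP->|/andP[EnC EC]]; first by rewrite eqxx.
  + by move=> _; split; [apply: C'D|apply: tC].
  + move=> _; split; first by rewrite disjoint_sym C'D.
    by have [x [y [? ? ?]]] := tC _ DC DnC; exists y, x; rewrite e_sym.
  + exact: f2.
- rewrite subUset; apply/andP; split; last first.
    by apply: subset_trans (subsetIr _ _) _; apply: bigcup_sup; rewrite !inE eqxx.
  apply/subsetP=> x; rewrite inE => /andP[xC /(subsetP XC)/bigcupP[D DC xD]].
  apply/bigcupP; exists D => //; rewrite !inE DC andbT; apply/orP; right.
  by apply: contraNneq xC => <-.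
- move=> D; rewrite !inE => /orP[/eqP->|/andP[DnC DC]].
    apply: leq_trans Zq; apply/subset_leq_card/subsetP=> x; rewrite !inE.
    case/andP=> /orP[/andP[xC xX]|/andP[]//] xC'.
    have /bigcupP[E EC xE] := subsetP XC _ xX.
    have [EeqC|EnC] := eqVneq E C; first by rewrite -EeqC xE in xC.
    by have /pred0P/(_ x)/= := C'D _ EC EnC; rewrite xC' xE.
  apply: leq_trans (Xq _ DC); apply/subset_leq_card/subsetP=> x; rewrite !inE.
  case/andP=> /orP[/andP[_ ->]//|/andP[_ xC']] xD.
  by have /pred0P/(_ x)/= := C'D _ DC DnC; rewrite xC' xD.
- move=> D; rewrite !inE => /orP[/eqP->|/andP[DnC DC]].
    apply/pred0P=> x /=; apply/negP=> /andP[/(subsetP sB')].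
    by rewrite inE => /andP[/negPf->].
  apply: disjointWl (dB _ DC); exact: subset_trans sB' (subsetDl _ _).
Qed.

(** The potential drops at every move. Adding a nonempty tree [D] raises its first two terms by at
    most 1 + |D| and lowers the last by at least 3 |D|, which accounts for the weight 3. Dropping a
    branch set lowers the first term, and swapping is covered by [state_swap]. *)
Lemma state_grow m X CC B : state X CC B -> #|CC| <= h ->
  #|CC| + #|X| + 3 * #|B| <= m -> exists2 CC', clique_family CC' & #|CC'| = h.
Proof.
elim: m X CC B => [|m IH] X CC B st cCC pot.
  have [_ [_ _ + _] _ _ _] := st; slia.
have [fam bigB _ _ dB] := st; have [BW cB bB clB] := bigB.
have [|ltC] := leqP h #|CC|; first by exists CC => //; slia.
have [/existsP[C /andP[CCC nC]]|/existsPn hC] := boolP [exists C, (C \in CC)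
    && [forall x in C, forall y in B, ~~ e x y]].
  have nC' x y : x \in C -> y \in B -> ~~ e x y.
    by move=> xC yB; move/forall_inP/(_ _ xC)/forall_inP/(_ _ yB): nC.
  apply: IH (state_drop st cCC CCC nC') _ _.
    by apply: leq_trans (subset_leq_card (subsetDl _ _)) cCC.
  have cCD : #|CC| = #|CC :\ C|.+1 by rewrite (cardsD1 C) CCC.
  have := subset_leq_card (subsetDl X C); slia.
have nbr C : C \in CC -> exists x y, [/\ x \in C, y \in B & e x y].
  move=> CCC; have := hC C; rewrite CCC /= => /forall_inPn[x xC].
  by case/forall_inPn=> y yB; rewrite negbK => xy; exists x, y.
have cX := card_state st.
have B0 : B != set0 by apply: contraTneq bB => ->; rewrite cards0 muln0 ltn0.
pose A (i : 'I_#|CC|) := [set y in B | [exists x in enum_val i, e x y]].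
have cBk : #|B| * #|CC| <= q * q.
  have : #|B| <= #|W| by apply: subset_leq_card; apply: subset_trans BW (subsetDl _ _).
  by move=> cBW; apply: leq_trans card_W; apply: leq_mul => //; slia.
have [[D [DB D0 cD Dq DA]]|[Z [ZB Zq ZA]]] := tree_or_cut e_sym A B0 q_gt0 cBk.
  have [||B' bigB'] := @big_exists (X :|: D).
  - rewrite subUset (state_subW st); apply: subset_trans DB _.
    exact: subset_trans BW (subsetDl _ _).
  - apply: leq_trans (leq_cardsU X D) _; apply: (@leq_trans (#|CC|.+1 * q)).
      by rewrite mulSn; slia.
    by rewrite leq_mul2r ltC orbT.
  have [|st' DnC c1 c2] := state_add st DB D0 cD Dq _ bigB'.
    move=> C CCC; have := DA (enum_rank_in CCC C).
    case/set0Pn=> y; rewrite !inE => /and3P[yD yB /existsP[x /andP[xC xy]]].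
    by exists y, x; rewrite e_sym; split=> //; rewrite enum_rankK_in in xC.
  have cCD : #|D |: CC| = #|CC|.+1 by rewrite cardsU1 DnC.
  apply: IH st' _ _; first slia.
  have : 0 < #|D| by rewrite card_gt0.
  slia.
have [||B1 bigB1] := @big_exists (X :|: Z).
- rewrite subUset (state_subW st); apply: subset_trans ZB _.
  exact: subset_trans BW (subsetDl _ _).
- apply: leq_trans (leq_cardsU X Z) _; apply: (@leq_trans (#|CC|.+1 * q)).
    by rewrite mulSn; slia.
  by rewrite leq_mul2r ltC orbT.
have [B1W cB1 bB1 clB1] := bigB1.
have B1B : B1 \subset B by apply: big_mono bigB bigB1; apply: subsetUl.
have [|i Ai0] := ZA B1 _ cB1.
  apply/subsetP=> x xB1; rewrite inE (subsetP B1B) // andbT.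
  by move: (subsetP B1W _ xB1); rewrite !inE => /andP[/norP[]].
have CCC : enum_val i \in CC by apply: enum_valP.
have [|X' [CC' [B' [st' cE c']]]] := state_swap st ltC CCC (nbr _ CCC) ZB Zq bigB1.
  move=> x y xC yB1; apply/negP=> xy.
  move/setP/(_ y): Ai0; rewrite !inE yB1 (subsetP B1B _ yB1) /=.
  by move/negbT/existsPn/(_ x); rewrite xC xy.
by apply: IH st' _ _; rewrite cE; slia.
Qed.

End Separator.

(** If no set of at most h * q vertices separates [W], each of them leaves a connected set of more
    than half of [W]. This is what the search for h branch sets requires, and it starts from
    none. *)
Lemma separator (T : finType) (e : rel T) (W : {set T}) (h q : nat) :
  symmetric e -> 0 < q -> #|W| * h <= q * q ->
  (exists U : 'I_h -> {set T}, minor_model (fun i j => i != j) e U) \/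
  (exists X : {set T}, [/\ X \subset W, #|X| <= h * q
    & forall B : {set T}, B \subset W :\: X -> conn e B -> 2 * #|B| <= #|W|]).
Proof.
move=> e_sym q0 cW.
have [/existsP[X /and3P[XW cX /forallP hX]]|/existsPn noX] := boolP
   [exists X : {set T}, [&& X \subset W, #|X| <= h * q &
    [forall B : {set T}, (B \subset W :\: X) &&
      [forall x in B, forall y in B, connect (inside e B) x y] ==> (2 * #|B| <= #|W|)]]].
  right; exists X; split=> // B BW cB; apply: (implyP (hX B)); rewrite BW /=.
  by apply/forall_inP=> x xB; apply/forall_inP=> y yB; apply: cB.
left; have noX' (X : {set T}) : X \subset W -> #|X| <= h * q ->
    exists B : {set T}, [/\ B \subset W :\: X, conn e B & #|W| < 2 * #|B|].
  move=> XW cX; have := noX X; rewrite XW cX /= => /forallPn[B].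
  rewrite negb_imply -ltnNge => /andP[/andP[BW /forall_inP cB] bB].
  by exists B; split=> // x y xB yB; move/forall_inP/(_ _ yB): (cB x xB).
have [|B bigB] := big_exists e_sym q0 cW noX' (sub0set _); first by rewrite cards0.
have [||CC [f1 f2] cCC] := state_grow e_sym q0 cW noX' (m := #|set0 : {set {set T}}| + #|set0 : {set T}| + 3 * #|B|)
   (X := set0) (CC := set0) (B := B) _ _ (leqnn _).
- by split=> //; [split=> ? ; rewrite inE|apply: sub0set|move=> ?; rewrite inE|move=> ?; rewrite inE].
- by rewrite cards0.
exists (fun i => enum_val (cast_ord (esym cCC) i)); split=> [i|i|i j ij|i j ij].
- by have [] := f1 _ (enum_valP (cast_ord (esym cCC) i)).
- by have [] := f1 _ (enum_valP (cast_ord (esym cCC) i)).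
- have [|dij _] := f2 _ _ (enum_valP (cast_ord (esym cCC) i)) (enum_valP (cast_ord (esym cCC) j)) => //.
  by apply: contra ij => /eqP/enum_val_inj/cast_ord_inj->.
- have [|_ tij] := f2 _ _ (enum_valP (cast_ord (esym cCC) i)) (enum_valP (cast_ord (esym cCC) j)) => //.
  by apply: contra ij => /eqP/enum_val_inj/cast_ord_inj->.
Qed.

(** Exchanging the sides when one of them is doubled keeps the aspect ratio at most 2, so the
    semiperimeter stays within constant factors of 2^(a/2). *)
Fixpoint dims (a : nat) : nat * nat :=
  if a is a'.+1 then (2 * (dims a').2, (dims a').1) else (1, 1).

Definition semiper a := (dims a).1 + (dims a).2.

Lemma dims_spec a : ((dims a).1 = (dims a).2 \/ (dims a).1 = 2 * (dims a).2) /\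
  (dims a).1 * (dims a).2 = 2 ^ a.
Proof.
elim: a => [|a [h1 h2]] /=; first by split; [left|].
by rewrite expnS -h2; lia.
Qed.

(** The extreme case goes from sides 2, 1 to sides 2, 2. Since the powers of 3/4 sum to 4, a cost
    proportional to the semiperimeter adds up over all smaller scales to at most four times the
    largest term. This is the origin of the factor 4 in [bisect] and in the number of planes of
    [layout]. *)
Lemma semiper_grow a : 4 * semiper a <= 3 * semiper a.+1.
Proof. by rewrite /semiper /=; have [] := dims_spec a; lia. Qed.

Lemma semiper_sqr_ge a : 4 * 2 ^ a <= semiper a ^ 2.
Proof. by rewrite /semiper; have [h <-] := dims_spec a; nia. Qed.

Lemma semiper_sqr_le a : semiper a ^ 2 <= 5 * 2 ^ a.
Proof. by rewrite /semiper; have [h <-] := dims_spec a; nia. Qed.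

Lemma semiper_gt0 a : 0 < semiper a.
Proof. by have := semiper_sqr_ge a; have := expn_gt0 2 a; nia. Qed.

Lemma subset_card (T : finType) (A : {set T}) n : n <= #|A| ->
  exists2 B : {set T}, B \subset A & #|B| = n.
Proof.
move=> nA; exists [set x in take n (enum A)].
  by apply/subsetP=> x; rewrite inE => /mem_take; rewrite mem_enum.
rewrite cardsE (card_uniqP _) ?take_uniq ?enum_uniq //.
by rewrite size_takel // -cardE.
Qed.

(** * Exact bisection with few cut edges *)

Section Bisection.
Variables (T : finType) (e : rel T) (e_sym : symmetric e) (h K : nat).
Hypotheses (K_gt0 : 0 < K) (hK : h <= K * K).
Hypothesis sep : forall (W : {set T}) q, 0 < q -> #|W| * h <= q * q ->
  exists X : {set T}, [/\ X \subset W, #|X| <= h * q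
    & forall B : {set T}, B \subset W :\: X -> conn e B -> 2 * #|B| <= #|W|].
Implicit Types (W V A B X R : {set T}).

Definition apart A B := forall x y, x \in A -> y \in B -> ~~ e x y.

(** [A] is a largest union of components that fits into c1. One more component [R] overflows c1, so
    what remains after it fits into c2; [R] itself may fit on neither side. *)
Lemma pack_components V c1 c2 : #|V| <= c1 + c2 ->
  exists A R B, [/\ [/\ A \subset V, R \subset V & B \subset V],
    [/\ [disjoint A & R], [disjoint A & B], [disjoint R & B] & V = A :|: R :|: B],
    [/\ apart A R, apart A B & apart R B],
    conn e R & #|A| <= c1 /\ #|B| <= c2].
Proof.
move=> cV.
pose P A := [&& A \subset V, [forall x in A, forall y in V, e x y ==> (y \in A)]
  & #|A| <= c1].
have P0 : P set0.
  rewrite /P sub0set cards0 leq0n !andbT; apply/forall_inP=> x; by rewrite inE.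
case: (arg_maxnP (fun A => #|A|) P0) => A /and3P[AV /forall_inP clA cA] maxA.
have {}clA x y : x \in A -> y \in V -> e x y -> y \in A.
  by move=> xA yV; apply: implyP; move/forall_inP: (clA x xA); apply.
have [AeV|/subsetPn[x xV xA]] := boolP (V \subset A).
  exists A, set0, set0; split.
  - by rewrite AV !sub0set.
  - rewrite -!setI_eq0 !setI0 eqxx !setU0; split=> //.
    by apply/eqP; rewrite eqEsubset AeV AV.
  - by split=> ? ?; rewrite !inE.
  - exact: conn0.
  - by rewrite cards0.
pose R := component e V x; have RV : R \subset V := comp_sub _ _ _.
have xR : x \in R := comp_refl _ xV.
have cR : conn e R := comp_conn e_sym (x:=x).
have dAR : [disjoint A & R].
  rewrite disjoint_sym; apply/pred0P=> y /=; apply/negP=> /andP[yR yA].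
  move: xA; rewrite (subsetP (conn_absorb cR yR yA _)) // => z t zA _ tR zt.
  by apply: clA zt => //; apply: (subsetP RV).
have clR y z : y \in R -> z \in V -> e y z -> z \in R by apply: comp_closed.
have xR0 : 0 < #|R| by apply/card_gt0P; exists x.
clearbody R.
have big : c1 < #|A :|: R|.
  rewrite ltnNge; apply/negP=> small.
  have : P (A :|: R).
    rewrite /P subUset AV RV small /= andbT; apply/forall_inP=> y yAR.
    apply/forall_inP=> z zV; apply/implyP=> yz; move: yAR; rewrite !in_setU.
    by case/orP=> [yA|yR]; [rewrite (clA y)|rewrite (clR y) ?orbT].
  move/maxA; rewrite cardsU (disjoint_setI0 dAR) cards0.
  lia.
exists A, R, (V :\: (A :|: R)); split=> //.
- by rewrite AV RV subsetDl.
- split=> //.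
  + by apply/pred0P=> y /=; rewrite !inE; case: (y \in A).
  + by apply/pred0P=> y /=; rewrite !inE; case: (y \in R); rewrite ?orbT.
  + by rewrite -[LHS](setID V (A :|: R)) (setIidPr _) // subUset AV.
- split=> y z yA.
  + move=> zR; apply/negP=> yz; have zA := clA _ _ yA (subsetP RV _ zR) yz.
    by move/pred0P/(_ z): dAR => /=; rewrite zA zR.
  + rewrite !inE => /andP[nz zV]; apply/negP=> yz.
    by rewrite (clA _ _ yA zV yz) in nz.
  + rewrite !inE => /andP[nz zV]; apply/negP=> yz.
    by rewrite (clR _ _ yA zV yz) orbT in nz.
- split=> //; have := cardsD V (A :|: R).
  rewrite (setIidPr _) ?subUset ?AV //; lia.
Qed.

(** After removal of the separator only the overflowing component [R], at most half of [W], has to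
    be split, recursively and with the capacities left over. The separator vertices may go to either
    side because they are put into the cover [X], so they just fill up the first side. *)
Lemma bisect a W c1 c2 : #|W| <= 2 ^ a -> #|W| <= c1 + c2 ->
  exists A X, [/\ A \subset W, #|A| <= c1, #|W :\: A| <= c2,
    #|X| <= 4 * (h * K * semiper a)
    & forall x y, x \in A -> y \in W :\: A -> e x y -> (x \in X) || (y \in X)].
Proof.
elim: a W c1 c2 => [|a IH] W c1 c2 cW cc.
  have [c10|c10] := posnP c1.
    exists set0, set0; rewrite sub0set !cards0 setD0; split=> //; first lia.
    by move=> x y; rewrite inE.
  exists W, set0; rewrite subxx setDv !cards0; split=> //; first lia.
  by move=> x y _; rewrite inE.
(* This q satisfies the separator condition since [K * K] dominates h and the squared semiperimeter
   dominates 2^(a+1). *)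
have [||X0 [X0W cX0 hX0]] := sep (W := W) (q := K * semiper a.+1).
- by rewrite muln_gt0 K_gt0 semiper_gt0.
- have := semiper_sqr_ge a.+1; move: cW hK; set u := semiper _; set p := 2 ^ _ => cW1 hK1 hu.
  apply: (@leq_trans (p * (K * K))); first by apply: leq_mul.
  have : p * (K * K) <= u ^ 2 * (K * K) by apply: leq_mul => //; lia.
  by rewrite -mulnn; lia.
have cV : #|W :\: X0| <= c1 + c2 by have := subset_leq_card (subsetDl W X0); lia.
have [A0 [R [B0 [[AV RV BV] [dAR dAB dRB Ve] [nAR nAB nRB] cR [cA0 cB0]]]]] := pack_components cV.
have cR2 := hX0 R RV cR.
have cVe : #|W| = #|A0| + #|R| + #|B0| + #|X0|.
  rewrite -(cardsID X0 W) (setIidPr X0W) Ve !cardsU.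
  rewrite setIUl (disjoint_setI0 dAR) (disjoint_setI0 dAB) (disjoint_setI0 dRB).
  rewrite setU0 !cards0; lia.
have [||A1 [X1 [A1R cA1 cB1 cX1 hX1]]] := IH R (c1 - #|A0|) (c2 - #|B0|).
- by move: cW; rewrite expnS; lia.
- lia.
have cA0A1 : #|A0 :|: A1| = #|A0| + #|A1|.
  by rewrite cardsU (disjoint_setI0 (disjointWr A1R dAR)) cards0 subn0.
have [X2 X2X0 cX2] := subset_card (geq_minl #|X0| (c1 - #|A0 :|: A1|)).
have A01V : A0 :|: A1 \subset W :\: X0.
  by rewrite subUset AV (subset_trans A1R).
have A01W : A0 :|: A1 \subset W by apply: subset_trans A01V (subsetDl _ _).
have X2W := subset_trans X2X0 X0W.
have cA : #|A0 :|: A1 :|: X2| = #|A0| + #|A1| + #|X2|.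
  rewrite cardsU cA0A1 (_ : _ :&: X2 = set0) ?cards0 ?subn0 //.
  apply/setP=> x; rewrite in_setI in_set0; apply/negP=> /andP[/(subsetP A01V)].
  by rewrite inE => /andP[/negP nx _] /(subsetP X2X0).
exists (A0 :|: A1 :|: X2), (X0 :|: X1).
have cAW : A0 :|: A1 :|: X2 \subset W by rewrite subUset A01W.
have cB1' := cardsD R A1; rewrite (setIidPr A1R) in cB1'.
have cA1R := subset_leq_card A1R.
split=> //.
- by rewrite cA cX2 cA0A1; move: cA0 cA1; clear; lia.
- rewrite cardsD (setIidPr cAW) cA cX2 cA0A1 cVe.
  by move: cA0 cB0 cA1 cB1 cB1' cA1R cc; rewrite cVe; clear; lia.
- apply: leq_trans (leq_cardsU _ _) _.
  have := leq_mul (leqnn (h * K)) (semiper_grow a); move: cX0 cX1; clear; set u := semiper _; set v := semiper _; lia.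
move=> x y xA yB xy; rewrite !in_setU.
have [yX0|yX0] := boolP (y \in X0); first by rewrite orbT.
have [xX0|xX0] //= := boolP (x \in X0).
have [yW yA] : y \in W /\ y \notin A0 :|: A1 :|: X2.
  by move: yB; rewrite inE => /andP[].
have {yA} [yA0 yA1] : y \notin A0 /\ y \notin A1.
  by move: yA; rewrite !inE => /norP[/norP[]].
have : y \in A0 :|: R :|: B0 by rewrite -Ve inE yX0.
rewrite !in_setU (negPf yA0) /=.
have : x \in A0 :|: A1.
  by move: xA; rewrite in_setU => /orP[//|/(subsetP X2X0)]; rewrite (negPf xX0).
rewrite in_setU => /orP[xA0|xA1] /orP[yR|yB0].
- by have := nAR _ _ xA0 yR; rewrite xy.
- by have := nAB _ _ xA0 yB0; rewrite xy.
- by apply: hX1 xy => //; rewrite inE yA1.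
- by have := nRB _ _ (subsetP A1R _ xA1) yB0; rewrite xy.
Qed.

End Bisection.

(** * Recursive layout of the cut edges *)

Definition dist1 (a b : nat) := (a - b) + (b - a).

Definition dist2 (p q : nat * nat) := dist1 p.1 q.1 + dist1 p.2 q.2.

Definition sep1 (a b c d : nat) :=
  (maxn a b < minn c d) || (maxn c d < minn a b).

(* The segments [p, q] and [p', q'] are replaced by their bounding boxes. *)
Definition boxes_apart (p q p' q' : nat * nat) :=
  sep1 p.1 q.1 p'.1 q'.1 || sep1 p.2 q.2 p'.2 q'.2.

Lemma leq_sumU (I : finType) (A B : {set I}) (F : I -> nat) :
  \sum_(i in A :|: B) F i <= \sum_(i in A) F i + \sum_(i in B) F i.
Proof.
rewrite big_mkcond [in X in _ <= X + _]big_mkcond [in X in _ <= _ + X]big_mkcond.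
rewrite -big_split /=; apply: leq_sum => i _; rewrite inE.
by case: (i \in A); case: (i \in B); rewrite //= ?addn0 ?leq_addr.
Qed.

Lemma leq_sum_set (I : finType) (A B : {set I}) (F : I -> nat) :
  A \subset B -> \sum_(i in A) F i <= \sum_(i in B) F i.
Proof.
move=> sAB; rewrite big_mkcond [in X in _ <= X]big_mkcond /=; apply: leq_sum => i _.
by have := subsetP sAB i; case: (i \in A) => // ->.
Qed.

(** With [v] the semiperimeter at scale a + 1, each orientation of the cut has at most k v darts, of
    cost at most (4 k + 1) v each. Two orientations and the factor 5 in the bound on v^2 make the
    constant 10. *)
Lemma layout_arith k v a : v ^ 2 <= 5 * 2 ^ a.+1 ->
  10 * (k * (4 * k + 1)) * (a * 2 ^ a) + 10 * (k * (4 * k + 1)) * (a * 2 ^ a) +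
    (k * v * ((4 * k + 1) * v) + k * v * ((4 * k + 1) * v))
  <= 10 * (k * (4 * k + 1)) * (a.+1 * 2 ^ a.+1).
Proof.
move=> /(leq_mul (leqnn (2 * (k * (4 * k + 1))))).
rewrite -mulnn expnS [k * v * _]mulnACA; move: (2 ^ a) (v * v) (k * (4 * k + 1)).
by clear; lia.
Qed.

Section Layout.
Variables (T : finType) (e : rel T) (e_sym : symmetric e) (e_irr : irreflexive e).
Variables (h K d : nat).
Hypotheses (K_gt0 : 0 < K) (hK : h <= K * K).
Hypothesis deg : forall x, #|[set y | e x y]| <= d.
Hypothesis sep : forall (W : {set T}) q, 0 < q -> #|W| * h <= q * q ->
  exists X : {set T}, [/\ X \subset W, #|X| <= h * q
    & forall B : {set T}, B \subset W :\: X -> conn e B -> 2 * #|B| <= #|W|].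
Implicit Types (W A B X : {set T}).

(** Each vertex of the cover found by [bisect] accounts for at most 2 d cut edges, so 2 d times the
    constant 4 h K of [bisect] bounds the edges of a cut per unit of semiperimeter. *)
Definition kappa := 8 * (d * (h * K)).

Definition darts W := [set p : T * T | [&& p.1 \in W, p.2 \in W & e p.1 p.2]].

Definition cut A B := [set p : T * T | [&& p.1 \in A, p.2 \in B & e p.1 p.2]].

Lemma card_cut A B X :
  (forall x y, x \in A -> y \in B -> e x y -> (x \in X) || (y \in X)) ->
  #|cut A B| <= 2 * (d * #|X|).
Proof.
move=> cov; pose S1 := [set p : T * T | (p.1 \in X) && e p.1 p.2].
have cS1 : #|S1| <= d * #|X|.
  rewrite -sum1_card (partition_big fst (mem X)) /=; last first.
    by move=> p; rewrite inE => /andP[].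
  rewrite mulnC -sum_nat_const; apply: leq_sum => x xX; rewrite sum1dep_card.
  apply: leq_trans (deg x); rewrite -(card_imset (mem [set y | e x y]) (f := pair x)); last by move=> ? ? [].
  apply: subset_leq_card; apply/subsetP=> -[u v]; rewrite !inE /=.
  case/andP=> /andP[_ uv] /eqP ux; subst u; by apply: imset_f; rewrite inE.
pose sw (p : T * T) := (p.2, p.1).
have cS2 : #|sw @: S1| <= d * #|X| by apply: leq_trans (leq_imset_card _ _) cS1.
apply: (@leq_trans (#|S1| + #|sw @: S1|)); last by lia.
apply: leq_trans (leq_cardsU _ _); apply: subset_leq_card; apply/subsetP=> -[x y].
rewrite !inE /= => /and3P[xA yB xy]; have /orP[xX|yX] := cov x y xA yB xy.
  by rewrite xX xy.
by apply/orP; right; apply/imsetP; exists (y, x); rewrite // inE /= yX e_sym.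
Qed.

(* The edges that share a plane have separated bounding boxes. *)
Definition layout a W (pos : T -> nat * nat) (pl : T -> T -> nat) :=
  [/\ forall x, x \in W -> (pos x).1 < (dims a).1 /\ (pos x).2 < (dims a).2,
      {in W &, injective pos} /\ (forall x y, pl x y = pl y x),
      forall x y x' y', (x, y) \in darts W -> (x', y') \in darts W ->
        pl x y = pl x' y' -> [set x; y] = [set x'; y'] \/
        boxes_apart (pos x) (pos y) (pos x') (pos y'),
      forall x y, (x, y) \in darts W -> pl x y < 4 * (kappa * semiper a)
    & \sum_(p in darts W) (pl p.1 p.2 + dist2 (pos p.1) (pos p.2))
        <= 10 * (kappa * (4 * kappa + 1)) * (a * 2 ^ a)].

Lemma layout_exists a W : #|W| <= 2 ^ a -> exists pos pl, layout a W pos pl.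
Proof.
elim: a W => [|a IH] W cW.
  have W1 x y : x \in W -> y \in W -> x = y.
    by move=> xW yW; apply: (card_le1_eqP (A := W)).
  have W0 x y : (x, y) \in darts W -> False.
    rewrite inE /= => /and3P[xW yW]; by rewrite (W1 x y xW yW) e_irr.
  exists (fun _ => (0, 0)), (fun _ _ => 0); split=> //.
  - by split=> // x y xW yW _; apply: W1.
  - by move=> x y x' y' /W0.
  - by move=> x y /W0.
  - by rewrite big1 // => -[x y] /W0.
have [||A [X [AW cA cB cX covX]]] := bisect e_sym K_gt0 hK sep (a := a.+1) (W := W) (c1 := 2 ^ a) (c2 := 2 ^ a).
- by [].
- by move: cW; rewrite expnS; lia.
set B := W :\: A in cB covX.
have [posA [plA [inA [injA symA] sepA ltA costA]]] := IH A cA.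
have [posB [plB [inB [injB symB] sepB ltB costB]]] := IH B cB.
pose P := cut A B; pose u := semiper a; pose u' := semiper a.+1.
have cP : #|P| <= kappa * u'.
  apply: leq_trans (card_cut covX) _; rewrite /kappa.
  have := leq_mul (leqnn d) cX; rewrite -/u'; lia.
have grow : 4 * u <= 3 * u' by apply: semiper_grow.
pose base := 4 * (kappa * u).
(* The planes below [base] are shared by both halves, which are disjoint in the first coordinate.
   Each cut edge gets a plane of its own above, and [semiper_grow] leaves room for all of these. *)
pose pl x y := if x \in A then
    if y \in A then plA x y else base + index (x, y) (enum P)
  else if y \in A then base + index (y, x) (enum P) else plB x y.
pose H := (dims a).2.
(* The coordinates are exchanged as in [dims], and the box of [B] is put beside that of [A]. *)
pose pos x := if x \in A then ((posA x).2, (posA x).1)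
  else ((posB x).2 + H, (posB x).1).
have WAB x : x \in W -> x \notin A -> x \in B by move=> xW xA; rewrite inE xA.
have base_cut : base + kappa * u' <= 4 * (kappa * u').
  have := leq_mul (leqnn kappa) grow; rewrite /base; lia.
have posA_lt x : x \in A -> (pos x).1 < H.
  by move=> xA; rewrite /pos xA /=; have [] := inA x xA.
have posB_ge x : x \notin A -> H <= (pos x).1.
  by move=> xA; rewrite /pos (negPf xA) /= leq_addl.
have pos_in x : x \in W -> (pos x).1 < (dims a.+1).1 /\ (pos x).2 < (dims a.+1).2.
  move=> xW; rewrite /pos /= -/H; case: ifP => [/inA|/negbT/(WAB _ xW)/inB] /=; lia.
have pl_sym x y : pl x y = pl y x.
  by rewrite /pl; case: (x \in A); case: (y \in A); rewrite // (symA, symB).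
have dartP x y : (x, y) \in darts W -> [\/ [/\ x \in A, y \in A & (x, y) \in darts A],
    [/\ x \notin A, y \notin A & (x, y) \in darts B],
    [/\ x \in A, y \notin A & (x, y) \in P] |
    [/\ x \notin A, y \in A & (y, x) \in P]].
  rewrite !inE /= => /and3P[xW yW xy]; rewrite (e_sym y) xy xW yW.
  by case: (x \in A); case: (y \in A);
    [constructor 1|constructor 3|constructor 4|constructor 2].
have cutE x y x' y' : (x, y) \in P -> (x', y') \in P ->
    index (x, y) (enum P) = index (x', y') (enum P) -> x = x' /\ y = y'.
  move=> xP xP' /(congr1 (nth (x, y) (enum P))).
  by rewrite !nth_index ?mem_enum // => -[].
have cut_lt x y : (x, y) \in P -> index (x, y) (enum P) < kappa * u'.
  by move=> xP; apply: leq_trans cP; rewrite cardE index_mem mem_enum.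
have ltPl x y : (x, y) \in darts W -> pl x y < 4 * (kappa * u').
  move=> /dartP[] [xA yA xy]; rewrite /pl ?xA ?yA ?(negPf xA) ?(negPf yA).
  + by have := ltA _ _ xy; rewrite -/u -/base; move: base_cut; clear; lia.
  + by have := ltB _ _ xy; rewrite -/u -/base; move: base_cut; clear; lia.
  + by have := cut_lt _ _ xy; move: base_cut; clear; lia.
  + by have := cut_lt _ _ xy; move: base_cut; clear; lia.
exists pos, pl; split=> //.
- split=> // x y xW yW; rewrite /pos.
  case: ifP => [xA|/negbT xA]; case: ifP => [yA|/negbT yA].
  + by case=> h1 h2; apply: injA => //; apply/eqP; rewrite -pair_eqE /= h1 h2 !eqxx.
  + by have := inA _ xA; case=> _ ? [? _]; lia.
  + by have := inA _ yA; case=> _ ? [? _]; lia.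
  case=> /addIn h1 h2; apply: injB; rewrite ?WAB //.
  by apply/eqP; rewrite -pair_eqE /= h1 h2 !eqxx.
- have Alt x y : (x, y) \in darts A -> plA x y < base by apply: ltA.
  have Blt x y : (x, y) \in darts B -> plB x y < base by apply: ltB.
  move=> x y x' y' /dartP[] [xA yA xy] /dartP[] [xA' yA' xy'];
    rewrite /pl ?xA ?yA ?xA' ?yA' ?(negPf xA) ?(negPf yA) ?(negPf xA') ?(negPf yA').
  all: try (by move=> E; have := Alt _ _ xy; rewrite E ltnNge leq_addr).
  all: try (by move=> E; have := Alt _ _ xy'; rewrite -E ltnNge leq_addr).
  all: try (by move=> E; have := Blt _ _ xy; rewrite E ltnNge leq_addr).
  all: try (by move=> E; have := Blt _ _ xy'; rewrite -E ltnNge leq_addr).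
  all: try (by move=> /addnI/cutE[]// -> ->; left; rewrite // setUC).
  + move=> /(sepA _ _ _ _ xy xy')[]; [by left|right].
    rewrite /boxes_apart /pos xA yA xA' yA' /=; by rewrite orbC.
  + move=> _; right; rewrite /boxes_apart /sep1.
    apply/orP; left; apply/orP; left.
    move: (posA_lt _ xA) (posA_lt _ yA) (posB_ge _ xA') (posB_ge _ yA'); clear; lia.
  + move=> _; right; rewrite /boxes_apart /sep1.
    apply/orP; left; apply/orP; right.
    move: (posB_ge _ xA) (posB_ge _ yA) (posA_lt _ xA') (posA_lt _ yA'); clear; lia.
  + move=> /(sepB _ _ _ _ xy xy')[]; [by left|right]; move: b.
    rewrite /boxes_apart /pos (negPf xA) (negPf yA) (negPf xA') (negPf yA') /= /sep1; clear; lia.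
pose F (p : T * T) := pl p.1 p.2 + dist2 (pos p.1) (pos p.2).
pose P' := [set p : T * T | (p.2, p.1) \in P].
rewrite -[X in X <= _]/(\sum_(p in darts W) F p).
have cP' : #|P'| <= kappa * u'.
  apply: leq_trans cP; rewrite -(card_imset (mem P') (f := fun p => (p.2, p.1))).
    by apply: subset_leq_card; apply/subsetP=> _ /imsetP[p + ->]; rewrite inE.
  by move=> [x y] [x' y'] [-> ->].
have darts_sub : darts W \subset darts A :|: darts B :|: (P :|: P').
  apply/subsetP=> -[x y] /dartP[] [_ _ xy]; rewrite !in_setU ?xy ?orbT //.
  by rewrite [(x, y) \in P']inE xy !orbT.
have FA : \sum_(p in darts A) F p <= 10 * (kappa * (4 * kappa + 1)) * (a * 2 ^ a).
  apply: leq_trans costA; apply: leq_sum => -[x y]; rewrite inE /= => /and3P[xA yA _].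
  by rewrite /F /pl /pos /= xA yA /dist2 /= leq_add2l addnC.
have FB : \sum_(p in darts B) F p <= 10 * (kappa * (4 * kappa + 1)) * (a * 2 ^ a).
  apply: leq_trans costB; apply: leq_sum => -[x y]; rewrite inE /=.
  rewrite !inE => /and3P[/andP[xA _] /andP[yA _] _].
  rewrite /F /pl /pos /= (negPf xA) (negPf yA) /dist2 /dist1 /= leq_add2l.
  by clear; lia.
have FM x y : (x, y) \in darts W -> F (x, y) <= (4 * kappa + 1) * u'.
  move=> xy; have := ltPl _ _ xy; move: xy; rewrite inE => /and3P[/pos_in + /pos_in + _].
  rewrite /F /dist2 /dist1 /u' /semiper /=.
  by move: (pos x) (pos y) (pl x y) (dims a).1 (dims a).2 kappa; clear; lia.
have sumM (S : {set T * T}) : S \subset darts W -> #|S| <= kappa * u' ->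
    \sum_(p in S) F p <= kappa * u' * ((4 * kappa + 1) * u').
  move=> SW cS; apply: (@leq_trans (\sum_(p in S) ((4 * kappa + 1) * u'))).
    by apply: leq_sum => -[x y] /(subsetP SW); apply: FM.
  by rewrite sum_nat_const leq_mul2r cS orbT.
apply: leq_trans (leq_sum_set _ darts_sub) _; apply: leq_trans (leq_sumU _ _ _) _.
have PW : P \subset darts W.
  apply/subsetP=> -[x y]; rewrite !inE /= => /and3P[xA /andP[_ yW] ->].
  by rewrite (subsetP AW _ xA) yW.
have PW' : P' \subset darts W.
  apply/subsetP=> -[x y]; rewrite !inE /= e_sym => /and3P[xA /andP[_ yW] ->].
  by rewrite (subsetP AW _ xA) yW.
have := leq_add (leq_sumU (darts A) (darts B) F) (leq_sumU P P' F).
move=> /leq_trans; apply; rewrite -/u'.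
have := semiper_sqr_le a.+1; rewrite -/u' => hu'.
have := leq_add (leq_add FA FB) (leq_add (sumM _ PW cP) (sumM _ PW' cP')).
move=> /leq_trans; apply.
exact: layout_arith hu'.
Qed.

End Layout.

(** * Routing the edges through the voxel grid *)

Notation cell3 := (nat * nat * nat)%type.

Definition dist3 (p q : cell3) := dist1 p.1.1 q.1.1 + dist1 p.1.2 q.1.2 + dist1 p.2 q.2.

Definition nadj (p q : cell3) := dist3 p q == 1.

Definition vox (p : cell3) : voxel := (Posz p.1.1, Posz p.1.2, Posz p.2).

Lemma vadj_vox p q : vadj (vox p) (vox q) = nadj p q.
Proof.
case: p q => [[x y] z] [[x' y'] z']; rewrite /vadj /nadj /vox /dist3 /dist1 /=.
by apply/idP/idP; lia.
Qed.

Lemma vox_inj : injective vox.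
Proof. by move=> [[x y] z] [[x' y'] z'] [-> -> ->]. Qed.

Lemma nadj_sym : symmetric nadj.
Proof. by move=> p q; rewrite /nadj /dist3 /dist1; lia. Qed.

Definition joined (s : seq cell3) a b :=
  exists p, [/\ path nadj a p, last a p = b & {subset p <= s}].

Lemma joined_refl s a : joined s a a.
Proof. by exists [::]. Qed.

Lemma joined_trans s a b c : joined s a b -> joined s b c -> joined s a c.
Proof.
move=> [p [pp <- ps]] [q [qq <- qs]]; exists (p ++ q); split.
- by rewrite cat_path pp.
- by rewrite last_cat.
- by move=> x; rewrite mem_cat => /orP[/ps|/qs].
Qed.

Lemma joined_step s a b : nadj a b -> b \in s -> joined s a b.
Proof.
by move=> ab bs; exists [:: b]; split=> //=; [rewrite ab|move=> x; rewrite inE => /eqP->].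
Qed.

Lemma joined_sym s a b : a \in s -> joined s a b -> joined s b a.
Proof.
move=> aS [p [pp <- ps]]; elim: p a aS pp ps => [|c p IH] a aS /=.
  by move=> _ _; apply: joined_refl.
case/andP=> ac pp ps; have cs : c \in s by apply: ps; rewrite inE eqxx.
apply: (joined_trans (b := c)).
  by apply: IH => // x xp; apply: ps; rewrite inE xp orbT.
by apply: joined_step => //; rewrite nadj_sym.
Qed.

Lemma joined_line s (f : nat -> cell3) a b :
  (forall t, nadj (f t) (f t.+1)) ->
  (forall t, minn a b <= t <= maxn a b -> f t \in s) -> joined s (f a) (f b).
Proof.
move=> fS.
have up m n : (forall t, m <= t <= m + n -> f t \in s) -> joined s (f m) (f (m + n)).
  elim: n => [|n IH] h; first by rewrite addn0; apply: joined_refl.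
  apply: joined_trans (IH _) _; first by move=> t ht; apply: h; lia.
  by rewrite addnS; apply: joined_step => //; apply: h; lia.
have [ab|ba] := leqP a b => h.
  by rewrite -(subnKC ab); apply: up => t ht; apply: h; lia.
rewrite -(subnKC (ltnW ba)); apply: joined_sym; first by apply: h; lia.
by apply: up => t ht; apply: h; lia.
Qed.

Definition line (f : nat -> cell3) a b :=
  [seq f t | t <- iota (minn a b) (maxn a b - minn a b).+1].

Arguments line : simpl never.

Lemma lineP f a b p :
  reflect (exists2 t, minn a b <= t <= maxn a b & p = f t) (p \in line f a b).
Proof.
apply: (iffP mapP) => -[t]; rewrite ?mem_iota => ht ->; exists t => //.
  lia.
by rewrite mem_iota; lia.
Qed.

Section Routing.
Variables (G : sgraph) (pos : G -> nat * nat) (pl : G -> G -> nat).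
Hypothesis pos_inj : injective pos.
Hypothesis pl_sym : forall x y, pl x y = pl y x.
Hypothesis pl_apart : forall x y x' y', adj x y -> adj x' y' ->
  pl x y = pl x' y' -> [set x; y] = [set x'; y'] \/
  boxes_apart (pos x) (pos y) (pos x') (pos y').

(** The sum, which dominates the maximum, makes every wire reachable and turns the total pillar
    length into a sum over darts, as bounded by [layout]. *)
Definition height (u : G) := \sum_(v | adj u v) 2 * pl u v.

Definition pillar u := line (fun z => (4 * (pos u).1, 4 * (pos u).2, z)) 0 (height u).

(* The wire of the edge {u, v} runs in the plane z = 2 * pl u v, along lines at
   distance 2 from all pillars, and ends next to the pillar of v. *)
Definition wire u v :=
  let z := 2 * pl u v in
  (4 * (pos u).1, 4 * (pos u).2 + 1, z)
  :: line (fun t => (t, 4 * (pos u).2 + 2, z)) (4 * (pos u).1) (4 * (pos v).1 + 2)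
  ++ line (fun t => (4 * (pos v).1 + 2, t, z)) (4 * (pos u).2 + 2) (4 * (pos v).2)
  ++ [:: (4 * (pos v).1 + 1, 4 * (pos v).2, z)].

Arguments wire : simpl never.

Definition owns (u v : G) := adj u v && (enum_rank u < enum_rank v).

Definition cells u := pillar u ++ flatten [seq wire u v | v <- enum G & owns u v].

Lemma cellsP u p : reflect (p \in pillar u \/ exists2 v, owns u v & p \in wire u v)
  (p \in cells u).
Proof.
rewrite mem_cat; apply: (iffP orP) => -[|]; try by left.
  move=> /flattenP[s /mapP[v]]; rewrite mem_filter => /andP[uv _] -> pv.
  by right; exists v.
case=> v uv pv; right; apply/flattenP; exists (wire u v) => //.
by apply/mapP; exists v => //; rewrite mem_filter uv mem_enum.
Qed.

Lemma wireP u v p : p \in wire u v -> p.2 = 2 * pl u v /\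
  [\/ p.1 = (4 * (pos u).1, 4 * (pos u).2 + 1),
      p.1.2 = 4 * (pos u).2 + 2 /\
        minn (4 * (pos u).1) (4 * (pos v).1 + 2) <= p.1.1
          <= maxn (4 * (pos u).1) (4 * (pos v).1 + 2),
      p.1.1 = 4 * (pos v).1 + 2 /\
        minn (4 * (pos u).2 + 2) (4 * (pos v).2) <= p.1.2
          <= maxn (4 * (pos u).2 + 2) (4 * (pos v).2) |
      p.1 = (4 * (pos v).1 + 1, 4 * (pos v).2)].
Proof.
rewrite in_cons !mem_cat mem_seq1; case/or4P.
- by move/eqP->; split=> //; constructor 1.
- by case/lineP=> t ht -> /=; split=> //; constructor 2.
- by case/lineP=> t ht -> /=; split=> //; constructor 3.
- by move/eqP->; split=> //; constructor 4.
Qed.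

Lemma pillarP u p : p \in pillar u -> p.1 = (4 * (pos u).1, 4 * (pos u).2).
Proof. by case/lineP=> t _ ->. Qed.

Lemma pos_neq u v : u != v -> (pos u).1 <> (pos v).1 \/ (pos u).2 <> (pos v).2.
Proof.
move=> uv; have [|n1] := eqVneq (pos u).1 (pos v).1; last by left; apply/eqP.
move=> h1; right=> h2; move/eqP: uv; apply; apply: pos_inj.
by rewrite (surjective_pairing (pos u)) h1 h2 -surjective_pairing.
Qed.

(** Pillars stand at multiples of 4 and wires run at offset 2, so only the two end cells of a wire,
    at offset 1, are next to a pillar: the first to that of [v], the last to that of [w]. *)
Lemma pillar_wire_near u v w p q : p \in pillar u -> q \in wire v w -> u != v ->
  dist3 p q <= 1 -> u = w /\ dist3 p q <> 0.
Proof.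
move=> /pillarP pE /wireP[_ qE] /pos_neq uv; have [->|/pos_neq uw] := eqVneq u w.
  split=> //; move: H qE pE; rewrite /dist3 /dist1.
  move: p.1 q.1 p.2 q.2 => [a b] [a' b'] c c' /= H [[-> ->]|[-> _]|[-> _]|[-> ->]] [-> ->]; lia.
move: qE pE; rewrite /dist3 /dist1.
move: p.1 q.1 p.2 q.2 (pos u) (pos v) (pos w) uv uw => [a b] [a' b'] c c' [x y] [xv yv] [xw yw] /=.
clear; move=> uv uw [[-> ->]|[-> hq]|[-> hq]|[-> ->]] [-> ->]; lia.
Qed.

Lemma wire_box u v p : p \in wire u v ->
  (4 * minn (pos u).1 (pos v).1 <= p.1.1 <= 4 * maxn (pos u).1 (pos v).1 + 2) /\
  (4 * minn (pos u).2 (pos v).2 <= p.1.2 <= 4 * maxn (pos u).2 (pos v).2 + 2).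
Proof.
move=> /wireP[_]; move: p.1 (pos u) (pos v) => [a b] [x y] [x' y'] /=.
by clear; case=> [[-> ->]|[-> h]|[-> h]|[-> ->]]; split; lia.
Qed.

(** Wires in different planes differ in height by at least 2, and separated boxes in one plane stay
    at distance 2 after scaling by 4 and padding by 2. Only the end of smaller rank owns an edge, so
    one edge never yields two wires of different blobs. *)
Lemma cells_near u v p q : u != v -> p \in cells u -> q \in cells v ->
  dist3 p q <= 1 -> adj u v /\ dist3 p q <> 0.
Proof.
move=> uv /cellsP[pu|[w uw pw]] /cellsP[qv|[w' vw qw]] pq.
- exfalso; move: (pillarP pu) (pillarP qv) (pos_neq uv) pq; rewrite /dist3 /dist1.
  move: p.1 q.1 p.2 q.2 (pos u) (pos v) => [a b] [a' b'] c c' [x y] [x' y'] /=.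
  by clear; move=> [-> ->] [-> ->]; lia.
- have [uw' d0] := pillar_wire_near pu qw uv pq; subst w'; split=> //.
  by rewrite (adj_sym u v); case/andP: vw.
- have dC : dist3 p q = dist3 q p by rewrite /dist3 /dist1; clear; lia.
  rewrite dC in pq *; have vu : v != u by rewrite eq_sym.
  by have [vw d0] := pillar_wire_near qv pw vu pq; subst w; case/andP: uw.
exfalso; have [/andP[auw ruw] /andP[avw rvw]] := (uw, vw).
have [p2 _] := wireP pw; have [q2 _] := wireP qw.
have plE : pl u w = pl v w'.
  by move: pq; rewrite /dist3 /dist1 p2 q2; clear; lia.
have [/setP sE|bA] := pl_apart auw avw plE.
  have := sE u; have := sE v; rewrite !inE !eqxx /= (negPf uv) (eq_sym v u) (negPf uv) /=.
  move=> /eqP vw1 /esym/eqP uw1; move: rvw ruw; rewrite -uw1 -vw1; lia.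
move: (wire_box pw) (wire_box qw) bA pq; rewrite /dist3 /dist1 /boxes_apart /sep1.
move: p.1 q.1 p.2 q.2 (pos u) (pos v) (pos w) (pos w').
move=> [a b] [a' b'] c c' [x y] [x' y'] [x1 y1] [x1' y1'] /=.
clear=> -[ha hb] [ha' hb'] /orP[/orP[]|/orP[]] hs; lia.
Qed.

Lemma height_ge u v : adj u v -> 2 * pl u v <= height u.
Proof. by move=> uv; rewrite /height (bigD1 v) //= leq_addr. Qed.

Lemma pillar_mem u z : z <= height u -> (4 * (pos u).1, 4 * (pos u).2, z) \in pillar u.
Proof. by move=> zh; apply/lineP; exists z => //; lia. Qed.

Lemma cells_joined u p : p \in cells u -> joined (cells u) (4 * (pos u).1, 4 * (pos u).2, 0) p.
Proof.
have pil z : z <= height u ->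
    joined (cells u) (4 * (pos u).1, 4 * (pos u).2, 0) (4 * (pos u).1, 4 * (pos u).2, z).
  move=> zh; apply: (joined_line (f := fun z => (4 * (pos u).1, 4 * (pos u).2, z))).
    by move=> t; rewrite /nadj /dist3 /dist1 /=; clear; lia.
  by move=> t ht; apply/cellsP; left; apply: pillar_mem; lia.
case/cellsP=> [/lineP[z hz ->]|[v uv pv]]; first by apply: pil; lia.
have wc q : q \in wire u v -> q \in cells u by move=> qv; apply/cellsP; right; exists v.
have auv : adj u v by case/andP: uv.
set z := 2 * pl u v.
pose c1 := (4 * (pos u).1, 4 * (pos u).2 + 1, z).
have w1 : c1 \in wire u v by rewrite inE eqxx.
pose f2 (t : nat) : cell3 := (t, 4 * (pos u).2 + 2, z).
have w2 t : minn (4 * (pos u).1) (4 * (pos v).1 + 2) <= t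
    <= maxn (4 * (pos u).1) (4 * (pos v).1 + 2) -> f2 t \in wire u v.
  move=> ht; rewrite inE; apply/orP; right; rewrite mem_cat; apply/orP; left.
  by apply/lineP; exists t.
pose f3 (t : nat) : cell3 := (4 * (pos v).1 + 2, t, z).
have w3 t : minn (4 * (pos u).2 + 2) (4 * (pos v).2) <= t
    <= maxn (4 * (pos u).2 + 2) (4 * (pos v).2) -> f3 t \in wire u v.
  move=> ht; rewrite inE; apply/orP; right; rewrite !mem_cat; apply/orP; right.
  by apply/orP; left; apply/lineP; exists t.
have j1 : joined (cells u) (4 * (pos u).1, 4 * (pos u).2, 0) c1.
  apply: joined_trans (pil z (height_ge auv)) (joined_step _ (wc _ w1)).
  by rewrite /nadj /dist3 /dist1 /=; clear; lia.
have j2 t : minn (4 * (pos u).1) (4 * (pos v).1 + 2) <= t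
    <= maxn (4 * (pos u).1) (4 * (pos v).1 + 2) ->
    joined (cells u) (4 * (pos u).1, 4 * (pos u).2, 0) (f2 t).
  move=> ht; apply: joined_trans j1 _; apply: (joined_trans (b := f2 (4 * (pos u).1))).
    apply: joined_step; first by rewrite /nadj /dist3 /dist1 /=; clear; lia.
    by apply/wc/w2; clear; lia.
  apply: (joined_line (f := f2)) => t'.
    by rewrite /nadj /dist3 /dist1 /=; clear; lia.
  by move=> ht'; apply/wc/w2; move: ht ht'; clear; lia.
have j3 t : minn (4 * (pos u).2 + 2) (4 * (pos v).2) <= t
    <= maxn (4 * (pos u).2 + 2) (4 * (pos v).2) ->
    joined (cells u) (4 * (pos u).1, 4 * (pos u).2, 0) (f3 t).
  move=> ht; apply: (joined_trans (b := f3 (4 * (pos u).2 + 2))).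
    by apply: (j2 (4 * (pos v).1 + 2)); clear; lia.
  apply: (joined_line (f := f3)) => t'.
    by rewrite /nadj /dist3 /dist1 /=; clear; lia.
  by move=> ht'; apply/wc/w3; move: ht ht'; clear; lia.
have := pv; rewrite in_cons !mem_cat mem_seq1; case/or4P.
- by move/eqP->.
- by case/lineP=> t ht ->; apply: j2.
- by case/lineP=> t ht ->; apply: j3.
move=> /eqP pE; apply: joined_trans (j3 (4 * (pos v).2) _) (joined_step _ (wc _ pv)).
  by clear; lia.
by rewrite pE /nadj /dist3 /dist1 /=; clear; lia.
Qed.

Definition routed u : {fset voxel} := [fset x in [seq vox p | p <- cells u]]%fset.

Lemma routedP u x : reflect (exists2 p, p \in cells u & x = vox p) (x \in routed u).
Proof. by rewrite !inE; apply: mapP. Qed.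

Lemma routed_rep : voxel_representation routed.
Proof.
split=> [u|u v uv|u v uv].
- have h0 : (4 * (pos u).1, 4 * (pos u).2, 0) \in cells u.
    by apply/cellsP; left; apply: pillar_mem.
  split; first by apply/fset0Pn; exists (vox (4 * (pos u).1, 4 * (pos u).2, 0)); apply/routedP; exists (4 * (pos u).1, 4 * (pos u).2, 0).
  move=> _ _ /routedP[a au ->] /routedP[b bu ->].
  have [p [pp pl' ps]] := joined_trans (joined_sym h0 (cells_joined au)) (cells_joined bu).
  exists (map vox p); split.
  + by rewrite path_map (eq_path (e' := nadj)) // => x y /=; rewrite vadj_vox.
  + by rewrite last_map pl'.
  + by move=> _ /mapP[x /ps xu ->]; apply/routedP; exists x.
- apply/fdisjointP=> _ /routedP[p pu ->]; apply/negP=> /routedP[q qv /vox_inj pq].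
  subst q; have d0 : dist3 p p = 0 by rewrite /dist3 /dist1; clear; lia.
  by have [|_] := cells_near uv pu qv; rewrite d0.
split=> [[_ [_ [/routedP[p pu ->] /routedP[q qv ->]]]]|].
  rewrite vadj_vox => /eqP pq; have [|//] := cells_near uv pu qv; by rewrite pq.
have main x y : owns x y -> touching (routed x) (routed y).
  move=> xy; have axy : adj x y by case/andP: xy.
  exists (vox (4 * (pos y).1 + 1, 4 * (pos y).2, 2 * pl x y)).
  exists (vox (4 * (pos y).1, 4 * (pos y).2, 2 * pl x y)); split.
  + apply/routedP; eexists; last by [].
    apply/cellsP; right; exists y => //.
    by rewrite in_cons !mem_cat mem_seq1 eqxx !orbT.
  + apply/routedP; eexists; last by [].
    apply/cellsP; left; apply: pillar_mem; rewrite pl_sym; apply: height_ge.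
    by rewrite adj_sym.
  + by rewrite vadj_vox /nadj /dist3 /dist1 /=; clear; lia.
move=> auv; case: (ltngtP (enum_rank u) (enum_rank v)) => h.
- by apply: main; rewrite /owns auv.
- have [|a [b [ha hb ab]]] := main v u; first by rewrite /owns adj_sym auv.
  exists b, a; split=> //; move: ab.
  case/routedP: ha => p _ ->; case/routedP: hb => q _ ->.
  by rewrite !vadj_vox nadj_sym.
- by move/eqP: uv; case; apply: enum_rank_inj; apply: val_inj.
Qed.

Lemma size_line f a b : size (line f a b) = (maxn a b - minn a b).+1.
Proof. by rewrite size_map size_iota. Qed.

Lemma size_wire u v : size (wire u v) <= 8 + 4 * dist2 (pos u) (pos v).
Proof.
rewrite /wire -cat1s !size_cat !size_line /dist2 /dist1.
by move: (pos u) (pos v) => [x y] [x' y'] /=; clear; lia.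
Qed.

Lemma rep_size_routed : rep_size routed <=
  #|G| + \sum_(u : G) \sum_(v | adj u v) (8 + 4 * (pl u v + dist2 (pos u) (pos v))).
Proof.
rewrite /rep_size -sum1_card -big_split /=; apply: leq_sum => u _.
rewrite card_fseq; apply: leq_trans (size_undup _) _; rewrite size_map size_cat size_line.
have -> : maxn 0 (height u) - minn 0 (height u) = height u by clear; lia.
rewrite add1n addSn ltnS /height.
have : size (flatten [seq wire u v | v <- enum G & owns u v]) <=
    \sum_(v | adj u v) (8 + 4 * dist2 (pos u) (pos v)).
  rewrite size_flatten /shape -map_comp sumnE big_map big_filter big_enum_cond /=.
  rewrite big_mkcond [X in _ <= X]big_mkcond; apply: leq_sum => v _.
  rewrite /owns; case: (adj u v) => //=; case: ifP => // _.
  exact: size_wire.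
move=> h; apply: leq_trans (leq_add (leqnn _) h) _; rewrite -big_split /=.
by apply: leq_sum => v _; clear; lia.
Qed.

End Routing.

Lemma minorfree_rep (G : sgraph) (h K d a : nat) :
  0 < K -> h <= K * K -> #|G| <= 2 ^ a ->
  (forall x : G, #|[set y | adj x y]| <= d) ->
  (forall U : 'I_h -> {set G}, ~ minor_model (fun i j => i != j) (@adj G) U) ->
  exists B : G -> {fset voxel}, voxel_representation B /\
    rep_size B <= #|G| + 8 * (#|G| * d)
      + 40 * (kappa h K d * (4 * kappa h K d + 1)) * (a * 2 ^ a).
Proof.
move=> K0 hK cG deg noK.
have sep (W : {set G}) q : 0 < q -> #|W| * h <= q * q ->
  exists X : {set G}, [/\ X \subset W, #|X| <= h * q
    & forall B : {set G}, B \subset W :\: X -> conn (@adj G) B -> 2 * #|B| <= #|W|].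
  by move=> q0 cW; have [[U /noK]|] := separator (@adj_sym G) q0 cW.
have [|pos [pl [_ [inj sym] apart _ cost]]] := layout_exists (@adj_sym G) (@adj_irrefl G) K0 hK deg sep (W := [set: G]) (a := a).
  by rewrite cardsT.
have pos_inj : injective pos by move=> x y; apply: inj; rewrite inE.
have apart' (x y x' y' : G) : adj x y -> adj x' y' -> pl x y = pl x' y' ->
    [set x; y] = [set x'; y'] \/ boxes_apart (pos x) (pos y) (pos x') (pos y').
  by move=> xy xy'; apply: apart; rewrite !inE.
exists (routed pos pl); split; first exact: routed_rep.
apply: leq_trans (rep_size_routed pos pl) _; rewrite -addnA leq_add2l.
have -> : \sum_(u : G) \sum_(v | adj u v) (8 + 4 * (pl u v + dist2 (pos u) (pos v))) =
    \sum_(u : G) \sum_(v | adj u v) 8 +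
    4 * \sum_(p in darts (@adj G) setT) (pl p.1 p.2 + dist2 (pos p.1) (pos p.2)).
  rewrite big_distrr /= (eq_bigl (fun p : G * G => true && adj p.1 p.2)); last first.
    by move=> p; rewrite !inE.
  rewrite -(pair_big_dep xpredT (fun u v => adj u v)
    (fun u v => 4 * (pl u v + dist2 (pos u) (pos v)))) -big_split /=.
  by apply: eq_bigr => u _; rewrite -big_split.
apply: leq_add; last by move: cost; clear; lia.
apply: (@leq_trans (\sum_(u : G) 8 * d)); last by rewrite sum_nat_const mulnCA.
apply: leq_sum => u _; rewrite sum_nat_const mulnC leq_mul2l.
by apply: leq_trans (deg u); rewrite cardsE.
Qed.

(** * Representations pass to contractions *)

Definition vlinked (B : {fset voxel}) (a b : voxel) :=
  exists p, [/\ path vadj a p, last a p = b & {subset p <= B}].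

Lemma vlinked_trans B a b c : vlinked B a b -> vlinked B b c -> vlinked B a c.
Proof.
move=> [p [pp <- ps]] [q [qq <- qs]]; exists (p ++ q); split.
- by rewrite cat_path pp.
- by rewrite last_cat.
- by move=> x; rewrite mem_cat => /orP[/ps|/qs].
Qed.

Lemma vlinked_mono (B B' : {fset voxel}) a b : {subset B <= B'} -> vlinked B a b -> vlinked B' a b.
Proof. by move=> s [p [pp pl ps]]; exists p; split=> // x /ps/s. Qed.

(** The blobs of a fibre are united. A path inside the fibre gives a chain of blobs in which
    consecutive ones are equal or touch, hence a connected union. *)
Lemma quotient_rep (G H : sgraph) (f : H -> G) (B : H -> {fset voxel}) :
  voxel_representation B ->
  (forall v, exists x, f x = v) ->
  (forall v, conn (@adj H) [set x | f x == v]) ->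
  (forall u v, u != v -> adj u v <-> exists x y, [/\ f x = u, f y = v & adj x y]) ->
  exists B' : G -> {fset voxel}, voxel_representation B' /\ rep_size B' <= rep_size B.
Proof.
move=> [blobB disB touB] f_surj f_conn f_adj.
pose B' v : {fset voxel} := \big[fsetU/fset0]_(x : H | f x == v) B x.
have B'P v a : reflect (exists2 x, f x = v & a \in B x) (a \in B' v).
  apply: (iffP (bigfcupP _ _ _ _)) => [[x /andP[_ /eqP fx] ax]|[x fx ax]]; exists x => //.
  by rewrite mem_index_enum fx eqxx.
exists B'; split; last first.
  rewrite /rep_size (partition_big f xpredT) //=; apply: leq_sum => v _.
  rewrite /B'; elim/big_rec2: _ => [|x n A _ IH]; first by rewrite cardfs0.
  by rewrite cardfsU; apply: leq_trans (leq_subr _ _) _; rewrite leq_add2l.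
split=> [v|u v uv|u v uv].
- have [x0 fx0] := f_surj v; have [B0 _] := blobB x0; have /fset0Pn[a0 a0B] := B0.
  split; first by apply/fset0Pn; exists a0; apply/B'P; exists x0.
  move=> a b /B'P[x fx ax] /B'P[y fy yb].
  have := f_conn v x y; rewrite !inE fx fy => /(_ (eqxx _) (eqxx _))/connectP[p].
  have sB z : f z = v -> {subset B z <= B' v} by move=> fz c cz; apply/B'P; exists z.
  elim: p x fx a ax => [|z p IH] x fx a ax /=.
    move=> _ yx; subst y; have [_ /(_ a b ax yb)] := blobB x.
    exact: vlinked_mono (sB x fx).
  case/andP=> /and3P[_ + xz] pz yE; rewrite inE => /eqP fz.
  have xnz : x != z by apply: contraTneq xz => ->; rewrite adj_irrefl.
  have [c [c' [cx c'z cc']]] : touching (B x) (B z) by apply/(touB _ _ xnz).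
  have [_ /(_ a c ax cx) ac] := blobB x.
  apply: (vlinked_trans (vlinked_mono (sB x fx) ac)).
  apply: (@vlinked_trans _ _ c'); last exact: IH z fz c' c'z pz yE.
  by exists [:: c']; split=> //=; [rewrite cc'|move=> t; rewrite inE => /eqP->; apply: (sB z)].
- apply/fdisjointP=> a /B'P[x fx ax]; apply/negP=> /B'P[y fy ay].
  have xy : x != y by apply: contraNneq uv => xy; rewrite -fx -fy xy.
  by have /fdisjointP/(_ _ ax) := disB _ _ xy; rewrite ay.
rewrite (f_adj _ _ uv); split=> [[a [b [/B'P[x fx ax] /B'P[y fy yb] ab]]]|].
  have xy : x != y by apply: contraNneq uv => xy; rewrite -fx -fy xy.
  by exists x, y; split=> //; apply/(touB _ _ xy); exists a, b.
move=> [x [y [fx fy xy]]]; have nxy : x != y by apply: contraNneq uv => e; rewrite -fx -fy e.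
have [a [b [ax yb ab]]] : touching (B x) (B y) by apply/(touB _ _ nxy).
by exists a, b; split=> //; apply/B'P; [exists x|exists y].
Qed.

(** * Degree reduction *)

(** The tree is given by parent pointers that lower a rank. This makes every vertex other than the
    root account for one tree edge, and following the pointers must end at the root. *)
Lemma spanning_tree (T : finType) (e : rel T) (A : {set T}) (r : T) :
  symmetric e -> conn e A -> r \in A ->
  exists (p : T -> T) (rk : T -> nat), forall x, x \in A -> x != r ->
    [/\ p x \in A, e x (p x) & rk (p x) < rk x].
Proof.
move=> e_sym cA rA.
suff grow k : exists (B : {set T}) (p : T -> T) (rk : T -> nat), [/\ B \subset A, r \in B,
    (k <= #|B|) || (A \subset B) & forall x, x \in B -> x != r ->
    [/\ p x \in B, e x (p x) & rk (p x) < rk x]].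
  have [B [p [rk [BA rB big hp]]]] := grow #|A|; exists p, rk.
  suff <- : B = A by [].
  by apply/eqP; rewrite eqEcard BA; case/orP: big => // /subset_leq_card.
elim: k => [|k [B [p [rk [BA rB big hp]]]]].
  exists [set r], id, (fun _ => 0); split=> //; rewrite ?sub1set ?set11 //.
  by move=> x /set1P->; rewrite eqxx.
have [AB|nAB] := boolP (A \subset B); first by exists B, p, rk; rewrite AB orbT.
rewrite (negPf nAB) orbF in big.
have [/existsP[y /andP[yB /existsP[z /and3P[zA zB yz]]]]|noE] :=
    boolP [exists y, (y \in B) && [exists z, [&& z \in A, z \notin B & e y z]]]; last first.
  case/negP: nAB; suff -> : B = A by [].
  apply: (conn_closed cA BA); first by apply/set0Pn; exists r.
  move=> y z yB zA yz; apply: contraNT noE => zB.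
  by apply/existsP; exists y; rewrite yB; apply/existsP; exists z; rewrite zA zB.
exists (z |: B), (fun x => if x == z then y else p x),
  (fun x => if x == z then (rk y).+1 else rk x); split.
- by rewrite subUset sub1set zA.
- by rewrite inE rB orbT.
- by rewrite cardsU1 zB add1n ltnS big.
have yz' : (y == z) = false by apply: contraNF zB => /eqP<-.
move=> x; rewrite !inE => /orP[/eqP-> _|xB xr]; first by rewrite eqxx yz' yB orbT e_sym yz.
have xz : (x == z) = false by apply: contraNF zB => /eqP<-.
have [pB xp rkp] := hp x xB xr; rewrite xz pB orbT.
by have -> : (p x == z) = false by apply: contraNF zB => /eqP<-.
Qed.

Section Reduction.
Variables (M : finType) (eM : rel M) (d : nat).
Hypotheses (symM : symmetric eM) (irrM : irreflexive eM).
Variables (G : finType) (eG : rel G).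
Hypotheses (symG : symmetric eG) (irrG : irreflexive eG).

Definition oedges := [set p : G * G | eG p.1 p.2 && (enum_rank p.1 < enum_rank p.2)].

(** The map [f] exhibits [G] as the contraction of [H] along its fibres; the last clause lets [H]
    inherit the excluded clique minors of [M]. *)
Definition unfolding (H : finType) (eH : rel H) (f : H -> G) :=
  [/\ [/\ symmetric eH, irreflexive eH & forall x, #|[set y | eH x y]| <= d],
      forall v, exists x, f x = v,
      forall v, conn eH [set x | f x == v],
      forall u v, u != v -> eG u v <-> exists x y, [/\ f x = u, f y = v & eH x y]
    & exists W, minor_model eH eM W].

Lemma unfolding_init (U : G -> {set M}) : (forall x, #|[set y | eM x y]| <= d) ->
  minor_model eG eM U -> exists (H : finType) (eH : rel H) f, unfolding eH f.
Proof.
move=> degM [U0 Uc Ud Ue].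
pose inU := [pred x : M | [exists v, x \in U v]].
pose H : finType := {x : M | inU x}.
have /fin_all_exists[f fP] : forall x : H, exists v, val x \in U v.
  move=> x.
  by apply/existsP; case: x.
have fE (x : H) v : val x \in U v -> f x = v.
  move=> xv; apply/eqP; apply: contraT => /Ud/pred0P/(_ (val x)) /=.
  by rewrite fP xv.
have lift v x : x \in U v -> exists2 y : H, val y = x & f y = v.
  move=> xv; have xU : inU x by apply/existsP; exists v.
  by exists (exist _ x xU) => //; apply: fE.
(* Branch sets of nonadjacent vertices may touch in [M]. Such edges are left out, because the
   contraction has to give exactly [G]. *)
pose eH (x y : H) := eM (val x) (val y) && ((f x == f y) || eG (f x) (f y)).
exists H, eH, f; split.
- split=> [x y|x|x].
  + by rewrite /eH symM eq_sym symG.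
  + by rewrite /eH irrM.
  + apply: leq_trans (degM (val x)).
    rewrite -(card_imset (mem [set y | eH x y]) val_inj).
    by apply/subset_leq_card/subsetP=> _ /imsetP[y + ->]; rewrite !inE => /andP[].
- move=> v; have /set0Pn[x xv] := U0 v; have [y _ <-] := lift _ _ xv.
  by exists y.
- move=> v; apply: closed_conn => X XA X0 clX.
  apply/eqP; rewrite eqEsubset XA /=; apply/subsetP=> y; rewrite inE => /eqP fy.
  have /set0Pn[x xX] := X0.
  have fx : f x = v by move: (subsetP XA _ xX); rewrite inE => /eqP.
  suff /subsetP/(_ (val y)) : U v \subset [set val z | z in X].
    by rewrite -fy => /(_ (fP y)) /imsetP[z zX /val_inj->].
  apply: (conn_absorb (Uc v) (x := val x)); first by rewrite -fx.
    by apply/imsetP; exists x.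
  move=> _ b /imsetP[z zX ->] zU bU zb; have [w wb fw] := lift _ _ bU.
  apply/imsetP; exists w => //; apply: (clX z) => //; first by rewrite inE fw.
  by rewrite /eH wb zb fw (fE _ _ zU) eqxx.
- move=> u v uv; split=> [euv|[x [y [fx fy /andP[_]]]]].
    have [x [y [xu yv xy]]] := Ue _ _ euv.
    have [x' x'x fx] := lift _ _ xu; have [y' y'y fy] := lift _ _ yv.
    by exists x', y'; split=> //; rewrite /eH x'x y'y xy fx fy euv orbT.
  by rewrite fx fy (negPf uv).
exists (fun x => [set val x]); split=> [x|x|x y xy|x y /andP[xy _]].
- by apply/set0Pn; exists (val x); rewrite inE.
- exact: conn1.
- by rewrite -setI_eq0; apply/eqP/setP=> z; rewrite !inE; apply/negP=> /andP[/eqP-> /eqP/val_inj]; apply/eqP.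
- by exists (val x), (val y); rewrite !inE !eqxx.
Qed.

(* Keep only a spanning tree of every fibre and one edge of H for every edge of G.
   If H is large, some vertex of degree at most 2 in this subgraph has a neighbour
   in its own fibre; merging the two does not increase the maximum degree. *)
Lemma unfolding_step (H : finType) (eH : rel H) (f : H -> G) :
  unfolding eH f -> #|G| + 2 * #|oedges| < #|H| ->
  exists (H' : finType) (eH' : rel H') (f' : H' -> G), unfolding eH' f' /\ #|H'| < #|H|.
Proof.
move=> [[symH irrH degH] f_surj f_conn f_adj [W W_model]] bigH.
have /fin_all_exists[root rootE] := f_surj.
have /fin_all_exists[PR PRP] : forall v, exists q : (H -> H) * (H -> nat),
    forall x, x \in [set x | f x == v] -> x != root v ->
    [/\ q.1 x \in [set x | f x == v], eH x (q.1 x) & q.2 (q.1 x) < q.2 x].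
  move=> v.
  have [|p [rk h]] := @spanning_tree H eH [set x | f x == v] (root v) symH (f_conn v).
    by rewrite inE rootE.
  by exists (p, rk).
have /fin_all_exists[c cP] : forall q : G * G, exists r : H * H, eG q.1 q.2 ->
    [/\ f r.1 = q.1, f r.2 = q.2 & eH r.1 r.2].
  move=> [u v] /=.
  have [uv|uv] := boolP (eG u v); last by exists (root u, root v).
  have nuv : u != v by apply: contraTneq uv => ->; rewrite irrG.
  by have [x [y [fx fy xy]]] := (f_adj u v nuv).1 uv; exists (x, y).
pose p x := (PR (f x)).1 x.
pose tr x y := (x != root (f x)) && (p x == y).
pose ch x y := ((f x, f y) \in oedges) && (c (f x, f y) == (x, y)).
pose th x y := [|| tr x y, tr y x, ch x y | ch y x].
have trP x y : tr x y -> [/\ f y = f x, eH x y & (PR (f x)).2 y < (PR (f x)).2 x].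
  case/andP=> xr /eqP<-; have [] := PRP (f x) x _ xr; first by rewrite inE.
  by rewrite inE => /eqP.
have chP x y : ch x y -> eH x y.
  case/andP; rewrite inE => /andP[xy _] /eqP cE; have [_ _] := cP _ xy.
  by rewrite cE.
have thH x y : th x y -> eH x y.
  by case/or4P=> [/trP[]|/trP[]|/chP|/chP]//; rewrite symH.
have th_sym : symmetric th by move=> x y; rewrite /th [ch x y || _]orbC orbCA.
have th_conn v : conn th [set x | f x == v].
  have rv : root v \in [set x | f x == v] by rewrite inE rootE.
  apply: (conn_hub th_sym (x := root v)) => x.
  have [n] := ubnP ((PR v).2 x); elim: n x => // n IH x; rewrite ltnS => rk xv.
  have fx : f x = v by move: xv; rewrite inE => /eqP.
  have [->|xr] := eqVneq x (root v); first exact: connect0.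
  have trx : tr x (p x) by rewrite /tr fx xr eqxx.
  have [fpx _ rkp] := trP _ _ trx; rewrite fx in fpx rkp.
  have pv : p x \in [set x | f x == v] by rewrite inE fpx.
  apply: connect_trans (IH (p x) _ pv) _; first exact: leq_trans rkp rk.
  by apply: connect1; rewrite /= xv pv /th trx orbT.
have th_adj u v : u != v -> eG u v <-> exists x y, [/\ f x = u, f y = v & th x y].
  move=> uv; split=> [euv|[x [y [fx fy /thH xy]]]]; last by apply/(f_adj _ _ uv); exists x, y.
  have [lt|lt|/ord_inj/enum_rank_inj/eqP] := ltngtP (enum_rank u) (enum_rank v); last by rewrite (negPf uv).
    have [f1 f2 _] := cP (u, v) euv; exists (c (u, v)).1, (c (u, v)).2; split=> //.
    have chc : ch (c (u, v)).1 (c (u, v)).2.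
      by rewrite /ch f1 f2 inE /= euv lt -surjective_pairing eqxx.
    by rewrite /th chc !orbT.
  have evu : eG v u by rewrite symG.
  have [f1 f2 _] := cP (v, u) evu; exists (c (v, u)).2, (c (v, u)).1; split=> //.
  have chc : ch (c (v, u)).1 (c (v, u)).2.
    by rewrite /ch f1 f2 inE /= evu lt -surjective_pairing eqxx.
  by rewrite /th chc !orbT.
pose N x := [set y | th x y].
have cN x : #|N x| <= d.
  by apply: leq_trans (degH x); apply/subset_leq_card/subsetP=> y; rewrite !inE => /thH.
have [x [y [fxy xy cx]]] : exists x y, [/\ f y = f x, th x y & #|N x| <= 2].
  (* [S1] collects the one-point fibres, at most |G| in number. If all other vertices had degree at
     least 3, counting the tree edges and the chosen edges would give 3 (|H| - |G|) <= 2 (|H| - |G|)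
     + 2 |E|, against the size of [H]. *)
  pose S1 := [set x | [forall y, (f y == f x) ==> (y == x)]].
  have cS1 : #|S1| <= #|G|.
    rewrite -(card_in_imset (f := f) (D := mem S1)) ?max_card // => a b aS _ fab.
    by move: aS; rewrite inE => /forallP/(_ b); rewrite fab eqxx => /eqP.
  pose sw (q : H * H) := (q.2, q.1).
  pose T1 := [set q : H * H | tr q.1 q.2]; pose C1 := [set q : H * H | ch q.1 q.2].
  have cT1 : #|T1| <= #|H| - #|G|.
    have root_inj : injective root by apply: can_inj rootE.
    have cr : #|root @: [set: G]| = #|G| by rewrite card_imset // cardsT.
    have cf : #|fst @: T1| = #|T1|.
      apply: card_in_imset => -[a b] [a' b']; rewrite !inE /=.
      by move=> /andP[_ /eqP<-] /andP[_ /eqP<-] ->.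
    have sub : fst @: T1 \subset ~: (root @: [set: G]).
      apply/subsetP=> _ /imsetP[[a b] + ->]; rewrite !inE /= => /andP[ar _].
      by apply: contra ar => /imsetP[v _ ->]; rewrite rootE.
    move: (cardsC (root @: [set: G])) (subset_leq_card sub); rewrite cr cf.
    by clear; lia.
  have cC1 : #|C1| <= #|oedges|.
    rewrite -(card_in_imset (f := fun q => (f q.1, f q.2)) (D := mem C1)); last first.
      move=> [a b] [a' b']; rewrite !inE /= => /andP[_ /eqP h] /andP[_ /eqP h'] [fa fb].
      by rewrite -h -h' fa fb.
    by apply/subset_leq_card/subsetP=> _ /imsetP[[a b] + ->]; rewrite inE => /andP[].
  have sumN : \sum_x #|N x| <= 2 * (#|H| - #|G|) + 2 * #|oedges|.
    have -> : \sum_x #|N x| = #|[set q : H * H | th q.1 q.2]|.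
      rewrite -sum1dep_card -(pair_big_dep xpredT (fun x y => th x y) (fun _ _ => 1)) /=.
      by apply: eq_bigr => x _; rewrite sum1dep_card.
    have sub : [set q : H * H | th q.1 q.2] \subset (T1 :|: sw @: T1) :|: (C1 :|: sw @: C1).
      apply/subsetP=> -[a b]; rewrite !inE /= => /or4P[->|h|->|h]; rewrite ?orbT //.
        by rewrite (_ : (a, b) \in sw @: T1) ?orbT //; apply/imsetP; exists (b, a); rewrite ?inE.
      by rewrite (_ : (a, b) \in sw @: C1) ?orbT //; apply/imsetP; exists (b, a); rewrite ?inE.
    apply: leq_trans (subset_leq_card sub) _; apply: leq_trans (leq_cardsU _ _) _.
    have := leq_cardsU T1 (sw @: T1); have := leq_cardsU C1 (sw @: C1).
    have := leq_imset_card sw T1; have := leq_imset_card sw C1.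
    by move: cT1 cC1; clear; lia.
  have [/existsP[x /andP[xS1 cx]]|/existsPn noX] := boolP [exists x, (x \notin S1) && (#|N x| <= 2)].
    exists x; have [/existsP[y /andP[/eqP fy xy]]|/existsPn noY] := boolP [exists y, (f y == f x) && th x y].
      by exists y.
    case/negP: xS1; rewrite inE; apply/forallP=> y; apply/implyP=> fy.
    suff E : [set x] = [set z | f z == f x] by rewrite -in_set1 E inE.
    apply: (conn_closed (th_conn (f x))).
    - by rewrite sub1set inE.
    - by apply/set0Pn; exists x; rewrite inE.
    - by move=> a b /set1P->; rewrite !inE => fb xb; have := noY b; rewrite fb xb.
  exfalso; have : 3 * #|~: S1| <= \sum_x #|N x|.
    rewrite mulnC -sum_nat_const big_mkcond /=; apply: leq_sum => x _.
    by have := noX x; rewrite in_setC; case: (x \in S1) => //=; rewrite -ltnNge.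
  have := cardsC S1; move: sumN cS1 bigH; clear; lia.
have ynx : y != x by apply: contraTneq xy => ->; apply/negP=> /thH; rewrite irrH.
pose H' : finType := {z : H | z != x}.
pose y' : H' := exist _ y ynx.
pose phi (h : H) : H' := insubd y' h.
have phiK (z : H') : phi (val z) = z by rewrite /phi valKd.
have phiy : phi y = y' := phiK y'.
have phix : phi x = y' by rewrite /phi /insubd insubF ?eqxx.
have phiV h : h != x -> val (phi h) = h by move=> hx; rewrite /phi insubdK.
pose eH' (z w : H') := (z != w) && [|| th (val z) (val w), (z == y') && th x (val w)
  | (w == y') && th (val z) x].
have fphi h : f (val (phi h)) = f h.
  by have [->|/phiV->//] := eqVneq h x; rewrite phix.
have th_phi h k : th h k -> phi h != phi k -> eH' (phi h) (phi k).
  move=> hk hk'; rewrite /eH' hk' /=.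
  have [hx|hx] := eqVneq h x; have [kx|kx] := eqVneq k x.
  - by rewrite hx kx eqxx in hk'.
  - by move: hk; rewrite hx phix eqxx (phiV k) // => ->; rewrite orbT.
  - by move: hk; rewrite kx phix eqxx (phiV h) // => ->; rewrite !orbT.
  - by rewrite !phiV // hk.
have eH'_phi z w : eH' z w -> exists h k, [/\ phi h = z, phi k = w & th h k].
  case/andP=> zw /or3P[h|/andP[/eqP-> h]|/andP[/eqP-> h]].
  - by exists (val z), (val w); rewrite !phiK.
  - by exists x, (val w); rewrite phiK.
  - by exists (val z), x; rewrite phiK.
exists H', eH', (fun z => f (val z)); split; last first.
  rewrite card_sig; have := cardC1 x; have : 0 < #|H| by apply/card_gt0P; exists x.
  by rewrite /predC1 /=; move=> + ->; lia.
split.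
- split=> [z w|z|z].
  + rewrite /eH' eq_sym (th_sym (val z) (val w)) (th_sym x (val w)) (th_sym (val z) x).
    by rewrite [X in _ && (_ || X)]orbC.
  + by rewrite /eH' eqxx.
  + rewrite -(card_imset (mem [set w | eH' z w]) val_inj).
    have thy : x \in N y by rewrite inE th_sym.
    have yNx : y \in N x by rewrite inE.
    have [zy|zy] := eqVneq z y'.
      (* The contracted edge disappears at both ends, so the merged vertex has at most (d - 1) + (2
         - 1) neighbours. *)
      subst z; apply: (@leq_trans #|(N y :\ x) :|: (N x :\ y)|); last first.
        apply: leq_trans (leq_cardsU _ _) _.
        have := cardsD1 x (N y); have := cardsD1 y (N x); rewrite thy yNx.
        have := cN y; move: cx; clear; lia.
      apply/subset_leq_card/subsetP=> _ /imsetP[w + ->]; rewrite inE /eH' eqxx /=.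
      case/andP=> yw /or3P[h|h|/andP[/eqP wE]]; last by rewrite wE eqxx in yw.
        by rewrite !inE h (valP w).
      rewrite !inE h andbT; apply/orP; right; apply: contraNneq yw => wy.
      by apply/eqP/val_inj/esym.
    have zx := valP z; have [xNz|xNz] := boolP (x \in N (val z)).
      apply: leq_trans (cN (val z)).
      apply: (@leq_trans #|(y |: N (val z)) :\ x|); last first.
        have := cardsD1 x (y |: N (val z)); rewrite in_setU xNz orbT cardsU1.
        by case: (_ \notin _) => /=; clear; lia.
      apply/subset_leq_card/subsetP=> _ /imsetP[w + ->]; rewrite !inE /eH' (negPf zy) /=.
      rewrite (valP w) /= => /andP[_ /orP[->|/andP[/eqP-> _]]]; first by rewrite orbT.
      by rewrite eqxx.
    apply: leq_trans (cN (val z)).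
    apply/subset_leq_card/subsetP=> _ /imsetP[w + ->]; rewrite !inE /eH' (negPf zy) /=.
    by move: xNz; rewrite inE => /negPf->; rewrite andbF orbF => /andP[].
- by move=> v; exists (phi (root v)); rewrite fphi rootE.
- move=> v; apply: closed_conn => X XA /set0Pn[z0 z0X] clX.
  apply/eqP; rewrite eqEsubset XA /=; apply/subsetP=> z; rewrite inE => fz.
  have /subsetP/(_ (val z)) : [set h | f h == v] \subset [set h | phi h \in X].
    apply: (conn_absorb (th_conn v) (x := val z0)); first by have := subsetP XA _ z0X; rewrite !inE.
      by rewrite inE phiK.
    move=> h k; rewrite !inE => hX hv kv hk.
    have [<-//|hk'] := eqVneq (phi h) (phi k).
    by apply: clX (th_phi _ _ hk hk') => //; rewrite inE fphi.
  by rewrite !inE phiK; apply.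
- move=> u v uv; rewrite (th_adj _ _ uv); split=> [[a [b [fa fb ab]]]|[z [w [fz fw]]]].
    exists (phi a), (phi b); rewrite !fphi; split=> //; apply: th_phi => //.
    by apply: contraNneq uv => e; rewrite -fa -fb -fphi e fphi.
  by case/eH'_phi=> h [k [hz kw hk]]; exists h, k; rewrite -fz -fw -hz -kw !fphi.
have W_th : minor_model th eM W by case: W_model => ? ? ? h; split=> // u v /thH/h.
eexists; apply: (@minor_model_trans H' H M eH' th eM symM (fun z => [set h | phi h == z]) W) => //.
split=> [z|z|z w zw|z w /eH'_phi[h [k [hz kw hk]]]].
- by apply/set0Pn; exists (val z); rewrite inE phiK.
- apply: (conn_hub th_sym (x := val z)) => h; rewrite inE => /eqP hz.
  have [hx|hx] := eqVneq h x; last by rewrite -hz phiV // connect0.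
  rewrite hx phix in hz; rewrite -hz hx; apply: connect1.
  by rewrite /= !inE phix eqxx th_sym xy !andbT phiy.
- by rewrite -setI_eq0; apply/eqP/setP=> h; rewrite !inE; apply/negP=> /andP[/eqP-> ]; apply/negP.
- by exists h, k; rewrite !inE hz kw !eqxx.
Qed.

Lemma degree_reduction (U : G -> {set M}) : (forall x, #|[set y | eM x y]| <= d) ->
  minor_model eG eM U -> exists (H : finType) (eH : rel H) (f : H -> G),
    unfolding eH f /\ #|H| <= #|G| + 2 * #|oedges|.
Proof.
move=> degM /(unfolding_init degM)[H [eH [f]]].
have [n] := ubnP #|H|; elim: n H eH f => // n IH H eH f; rewrite ltnS => cH unf.
have [small|big] := leqP #|H| (#|G| + 2 * #|oedges|); first by exists H, eH, f.
have [H' [eH' [f' [unf' lt]]]] := unfolding_step unf big.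
exact: IH (leq_trans lt cH) unf'.
Qed.

End Reduction.

(** * Minors of the dual graph of a cell complex *)

Import GRing.Theory.

Section LinearAlgebra.
Local Open Scope ring_scope.

Lemma addF2 (x : 'F_2) : x + x = 0.
Proof. by case: x => [[|[|]]] //= i; apply: val_inj. Qed.

Lemma F2_neq0 (x : 'F_2) : x != 0 -> x = 1.
Proof. by case: x => [[|[|]]] //= i _; apply: val_inj. Qed.

Lemma addF2_eq (x y : 'F_2) : x + y = 0 -> x = y.
Proof. by move=> /eqP; rewrite addr_eq0 => /eqP->; apply/eqP; rewrite eq_sym -addr_eq0 addF2. Qed.

Lemma rank_le_nonzero_rows (F : fieldType) m n (A : 'M[F]_(m, n)) :
  (\rank A <= #|[set i | (row i A != 0)%R]|)%N.
Proof.
set S := [set i | _].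
apply: leq_trans (rank_leq_row (rowsub (enum_val : 'I_#|S| -> 'I_m) A)).
apply/mxrankS/row_subP => i.
have [->|nz] := eqVneq (row i A) 0; first exact: sub0mx.
have iS : i \in S by rewrite inE.
have -> : row i A = row (enum_rank_in iS i) (rowsub (enum_val : 'I_#|S| -> 'I_m) A).
  by rewrite row_rowsub enum_rankK_in.
exact: row_sub.
Qed.

End LinearAlgebra.

Section CellComplex.
Local Open Scope ring_scope.
Variables (M E P : finType) (bd : M -> seq E) (src tgt : E -> P).
Variables (k : nat) (Lam : 'I_k -> E -> 'F_2).

(* M, E and P are the cells, the edges and the points of a square complex, in
   which an edge lies on at most two cells. A cochain on the edges is closed if
   it sums to zero around each cell. The last hypothesis bounds the first
   cohomology group over F_2 by k. *)
Hypothesis bd_uniq : forall x, uniq (bd x).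
Hypothesis bd_two : forall e x y z, e \in bd x -> e \in bd y -> e \in bd z ->
  x != y -> z = x \/ z = y.
Hypothesis bd_closed : forall (phi : P -> 'F_2) x,
  \sum_(e <- bd x) (phi (src e) + phi (tgt e)) = 0.
Hypothesis closed_exact : forall c : E -> 'F_2,
  (forall x, \sum_(e <- bd x) c e = 0) -> (forall i, \sum_e Lam i e * c e = 0) ->
  exists phi : P -> 'F_2, forall x e, e \in bd x -> c e = phi (src e) + phi (tgt e).

Definition cell_adj (x y : M) := (x != y) && has [in bd y] (bd x).

Lemma cell_adj_sym : symmetric cell_adj.
Proof.
move=> x y; rewrite /cell_adj eq_sym; congr (_ && _).
by apply/hasP/hasP=> -[e e1 e2]; exists e.
Qed.

Lemma cell_adj_irr : irreflexive cell_adj.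
Proof. by move=> x; rewrite /cell_adj eqxx. Qed.

Definition inner (A : {set M}) e := [exists x in A, exists y in A,
  [&& x != y, e \in bd x & e \in bd y]].

Lemma innerP (A : {set M}) e : reflect (exists x y, [/\ x \in A, y \in A, x != y, e \in bd x & e \in bd y])
  (inner A e).
Proof.
apply: (iffP existsP) => [[x /andP[xA /existsP[y /and4P[yA xy ex ey]]]]|[x [y [xA yA xy ex ey]]]].
  by exists x, y.
by exists x; rewrite xA; apply/existsP; exists y; rewrite yA xy ex.
Qed.

(** In the dual graph this is the boundary map: an edge between two cells has these cells as its
    boundary, and a path of cells becomes a chain bounded by its two ends. *)
Definition ebnd (c : {ffun E -> 'F_2}) x := \sum_(e <- bd x) c e.

Definition edelta e0 : {ffun E -> 'F_2} := [ffun e => (e == e0)%:R].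

Lemma ebndD c c' x : ebnd (c + c') x = ebnd c x + ebnd c' x.
Proof. by rewrite /ebnd -big_split; apply: eq_bigr => e _; rewrite ffunE. Qed.

Lemma ebnd_delta e0 x : ebnd (edelta e0) x = (e0 \in bd x)%:R.
Proof.
rewrite /ebnd; have [ein|eout] := boolP (e0 \in bd x); last first.
  rewrite big_seq big1 // => e ex; rewrite ffunE; case: eqP => // eE.
  by rewrite -eE ex in eout.
rewrite (bigD1_seq e0) //= ffunE eqxx big1 ?addr0 // => e /negPf ne.
by rewrite ffunE ne.
Qed.

Lemma ebnd_delta2 e x y z : x != y -> e \in bd x -> e \in bd y ->
  ebnd (edelta e) z = (z == x)%:R + (z == y)%:R.
Proof.
move=> xy ex ey; rewrite ebnd_delta.
have [ez|ez] := boolP (e \in bd z).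
  have [->|->] := bd_two ex ey ez xy; first by rewrite eqxx (negPf xy) addr0.
  by rewrite eqxx eq_sym (negPf xy) add0r.
have -> : (z == x) = false by apply: contraNF ez => /eqP->.
have -> : (z == y) = false by apply: contraNF ez => /eqP->.
by rewrite addr0.
Qed.

Lemma path_chain (A : {set M}) x y : conn cell_adj A -> x \in A -> y \in A ->
  exists c : {ffun E -> 'F_2}, (forall z, ebnd c z = (z == x)%:R + (z == y)%:R) /\
    forall e, c e != 0 -> inner A e.
Proof.
move=> cA xA yA; have [p] := connectP (cA x y xA yA).
elim: p x xA => [|w p IH] x xA /=.
  move=> _ ->; exists 0; split=> [z|e]; last by rewrite ffunE eqxx.
  by rewrite addF2 /ebnd big1 // => e _; rewrite ffunE.
case/andP=> /and3P[_ wA /andP[xw /hasP[e ex ew]]] pw yE.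
have [c [bc cin]] := IH w wA pw yE; exists (edelta e + c); split=> [z|e'].
  rewrite ebndD bc (ebnd_delta2 _ xw ex ew) -addrA; congr (_ + _).
  by rewrite addrA addF2 add0r.
rewrite !ffunE; have [->|_] := eqVneq e' e; last by rewrite add0r; apply: cin.
by move=> _; apply/innerP; exists x, w.
Qed.

Section Minor.
Variables (G : finType) (eG : rel G) (U : G -> {set M}).
Hypothesis irrG : irreflexive eG.
Hypothesis U_model : minor_model eG cell_adj U.

Let U_disj u v x : x \in U u -> x \in U v -> u = v.
Proof.
have [_ _ h _] := U_model => xu xv; apply/eqP; apply: contraT => /h/pred0P/(_ x) /=.
by rewrite xu xv.
Qed.

(** The chain follows a path in [U u], crosses once into [U v], and follows a path there. The
    crossed edge [q.1] is inner to no branch set, so it marks this edge of [G] in all later sums. *)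
Lemma edge_lift (root : G -> M) (rootU : forall v, root v \in U v) u v : eG u v ->
  exists q : E * {ffun E -> 'F_2}, [/\ exists x y, [/\ x \in U u, y \in U v, x != y, q.1 \in bd x & q.1 \in bd y],
    forall z, ebnd q.2 z = (z == root u)%:R + (z == root v)%:R,
    forall e', e' != q.1 -> q.2 e' != 0 -> exists w, inner (U w) e',
    q.2 q.1 = 1 & forall w, ~~ inner (U w) q.1].
Proof.
have [_ Uc _ Ue] := U_model => uv; have [x [y [xu yv /andP[xy /hasP[e ex ey]]]]] := Ue _ _ uv.
have [c [bc cin]] := path_chain (Uc u) xu (rootU u).
have [c' [bc' cin']] := path_chain (Uc v) yv (rootU v).
have nin w : ~~ inner (U w) e.
  apply/innerP=> -[a [b [aw bw ab ea eb]]].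
  have Ew z : e \in bd z -> z \in U w.
    by move=> ez; have [->|->] := bd_two ea eb ez ab.
  have := U_disj xu (Ew _ ex); have := U_disj yv (Ew _ ey) => vw uw.
  by move: uv; rewrite vw uw irrG.
exists (e, edelta e + c + c'); split=> //=.
- by exists x, y.
- move=> z; rewrite !ebndD bc bc' (ebnd_delta2 _ xy ex ey).
  by case: (z == x); case: (z == y); case: (z == root u); case: (z == root v); apply/eqP.
- move=> e' /negPf ne; rewrite !ffunE ne add0r.
  have [->|c0] := eqVneq (c e') 0; first by rewrite add0r => /cin'; exists v.
  by move=> _; exists u; apply: cin.
rewrite !ffunE eqxx.
have -> : c e = 0 by apply/eqP; apply: contraNT (nin u) => /cin.
have -> : c' e = 0 by apply/eqP; apply: contraNT (nin v) => /cin'.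
by rewrite !addr0.
Qed.

(* Euler's formula over F_2. A set of edges of G that has even degree everywhere
   and is orthogonal to the k functionals lifts to a closed cochain on the mesh,
   hence to the coboundary of a function that is constant on the faces of the
   drawing of G. So |E| - (|V| + k) is at most the number of faces with a nonempty
   boundary; each has at least three edges, and an edge lies on two faces. *)
Lemma minor_edge_bound : (#|oedges eG| <= 3 * (#|G| + k))%N.
Proof.
have [U0 Uc Ud Ue] := U_model.
have /fin_all_exists[root rootU] : forall v, exists x, x \in U v.
  by move=> v; have /set0Pn[x] := U0 v; exists x.
have root_inj u v : root u = root v -> u = v.
  by move=> uv; apply: U_disj (rootU u) _; rewrite uv.
set m := #|oedges eG|.
pose ends (g : 'I_m) : G * G := enum_val g.
have endsP g : eG (ends g).1 (ends g).2 /\ (enum_rank (ends g).1 < enum_rank (ends g).2)%N.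
  by have := enum_valP g; rewrite inE => /andP[].
have /fin_all_exists[lift liftP] : forall g, exists q : E * {ffun E -> 'F_2},
   [/\ exists x y, [/\ x \in U (ends g).1, y \in U (ends g).2, x != y,
         q.1 \in bd x & q.1 \in bd y],
    forall z, ebnd q.2 z = (z == root (ends g).1)%:R + (z == root (ends g).2)%:R,
    forall e', e' != q.1 -> q.2 e' != 0 -> exists w, inner (U w) e',
    q.2 q.1 = 1 & forall w, ~~ inner (U w) q.1].
  by move=> g; apply: edge_lift => //; have [] := endsP g.
pose eps g := (lift g).1; pose C g := (lift g).2.
have ends_eq g g' : (forall w, (w == (ends g).1) || (w == (ends g).2) ->
    (w == (ends g').1) || (w == (ends g').2)) -> g = g'.
  move=> h; apply: enum_val_inj; rewrite -/(ends g) -/(ends g').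
  have := h (ends g).1; have := h (ends g).2; rewrite !eqxx orbT /=.
  have [e1 lt1] := endsP g; have [e2 lt2] := endsP g'.
  move: e1 lt1 e2 lt2; case: (ends g) (ends g') => [u v] [u' v'] /= uv lt1 uv' lt2.
  move=> /(_ isT)/orP[]/eqP hv /(_ isT)/orP[]/eqP hu; subst.
  - by rewrite irrG in uv.
  - by move: (ltn_trans lt1 lt2); rewrite ltnn.
  - by [].
  - by rewrite irrG in uv.
have eps_cell g x : eps g \in bd x -> x \in U (ends g).1 \/ x \in U (ends g).2.
  have [[a [b [au bv ab ea eb]]] _ _ _ _] := liftP g.
  by move=> ex; have [->|->] := bd_two ea eb ex ab; [left|right].
have eps_inj : injective eps.
  move=> g g' gg; apply: ends_eq => w /orP[]/eqP->.
    have [[a [b [au bv ab ea eb]]] _ _ _ _] := liftP g.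
    rewrite -/(eps g) gg in ea; have [h|h] := eps_cell _ _ ea.
      by rewrite (U_disj au h) eqxx.
    by rewrite (U_disj au h) eqxx orbT.
  have [[a [b [au bv ab ea eb]]] _ _ _ _] := liftP g.
  rewrite -/(eps g) gg in eb; have [h|h] := eps_cell _ _ eb.
    by rewrite (U_disj bv h) eqxx.
  by rewrite (U_disj bv h) eqxx orbT.
have C_eps g g' : C g (eps g') = (g == g')%:R.
  have [->|gg] := eqVneq g g'; first by have [_ _ _ ->] := liftP g'.
  have [_ _ h _ _] := liftP g; have [_ _ _ _ nin] := liftP g'.
  apply/eqP; apply: contraT => nz.
  have [|w wi] := h (eps g') _ nz; first by apply: contra gg => /eqP/eps_inj->.
  by move: (nin w); rewrite -/(eps g') wi.
have C_support g e : C g e != 0 -> e = eps g \/ exists w, inner (U w) e.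
  move=> nz; have [->|ne] := eqVneq e (eps g); first by left.
  by have [_ _ h _ _] := liftP g; right; apply: h nz.
(* [A1] is the incidence matrix of [G] and [A2] holds the values of the functionals on the lifts.
   The left kernel of both together has dimension at least |E| - |V| - k. *)
pose A1 : 'M['F_2]_(m, #|G|) := \matrix_(g, w)
  ((enum_val w == (ends g).1)%:R + (enum_val w == (ends g).2)%:R).
pose A2 : 'M['F_2]_(m, k) := \matrix_(g, i) \sum_e Lam i e * C g e.
pose surf e := [exists x, e \in bd x].
(* [E0] contains the support of every lift. Points joined by surface edges outside [E0] lie in one
   face of the drawing, so the classes of [pr] play the part of the faces, and a row of [D] is the
   boundary of a face as a set of edges of [G]. *)
pose E0 e := [exists g, eps g == e] || [exists w, inner (U w) e].
pose pr a b := [exists e, [&& surf e, ~~ E0 e & ((src e == a) && (tgt e == b))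
  || ((src e == b) && (tgt e == a))]].
have pr_sym : symmetric pr.
  by move=> a b; apply: eq_existsb => e; rewrite [_ && _ || _]orbC.
pose cls := fingraph.root pr.
have cls_eq a b : pr a b -> cls a = cls b.
  by move=> ab; apply/eqP; rewrite (root_connect (sym_connect_sym pr_sym)) connect1.
pose D : 'M['F_2]_(#|P|, m) := \matrix_(p, g)
  ((cls (src (eps g)) == enum_val p)%:R + (cls (tgt (eps g)) == enum_val p)%:R).
have ker_le : (kermx (row_mx A1 A2) <= D)%MS.
  apply/row_subP => i; set S := row i _.
  have : S *m row_mx A1 A2 = 0 by rewrite -row_mul mulmx_ker row0.
  rewrite mul_mx_row => /eqP; rewrite -row_mx0 => /eqP/eq_row_mx[S1 S2].
  pose c e := \sum_g S 0 g * C g e.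
  have cE e : c e = \sum_g S 0 g * C g e by [].
  have c_eps g : c (eps g) = S 0 g.
    rewrite cE (bigD1 g) //= C_eps eqxx mulr1 big1 ?addr0 // => g' /negPf ne.
    by rewrite C_eps ne mulr0.
  have [||phi phiP] := @closed_exact c.
  - move=> x.
    have -> : \sum_(e <- bd x) c e = \sum_g S 0 g * ebnd (C g) x.
      under eq_bigr do rewrite cE; rewrite exchange_big; apply: eq_bigr => g _.
      by rewrite big_distrr.
    have [/existsP[w /eqP xw]|nox] := boolP [exists w, x == root w].
      have /rowP/(_ (enum_rank w)) := S1; rewrite !mxE => S1w; rewrite -[RHS]S1w.
      apply: eq_bigr => g _; rewrite [A1 _ _]mxE enum_rankK; have [_ -> _ _ _] := liftP g.
      by rewrite xw !(inj_eq (root_inj)).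
    rewrite big1 // => g _; have [_ -> _ _ _] := liftP g.
    have nw w : (x == root w) = false by apply: contraNF nox => xw; apply/existsP; exists w.
    by rewrite !nw addr0 mulr0.
  - move=> i'; have /rowP/(_ i') := S2; rewrite !mxE => S2w; rewrite -[RHS]S2w.
    under eq_bigr do rewrite cE big_distrr; rewrite exchange_big /=.
    apply: eq_bigr => g _; rewrite [A2 _ _]mxE big_distrr; apply: eq_bigr => e _.
    by rewrite mulrCA.
  have phi_pr a b : pr a b -> phi a = phi b.
    case/existsP=> e /and3P[/existsP[x ex] /norP[/existsPn e1 /existsPn e2] ab].
    have : c e = 0.
      rewrite cE big1 // => g _; have [->|/C_support[eg|[w wi]]] := eqVneq (C g e) 0.
      - by rewrite mulr0.
      - by move: (e1 g); rewrite eg eqxx.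
      - by move: (e2 w); rewrite wi.
    rewrite (phiP _ _ ex) => /addF2_eq; by case/orP: ab => /andP[/eqP-> /eqP->].
  have phi_cls a : phi a = phi (cls a).
    have along p b : path pr b p -> phi b = phi (last b p).
      by elim: p b => [|b' p IH] b //= /andP[/phi_pr-> /IH].
    have /connectP[p /along h lastE] : connect pr a (cls a) by apply: connect_root.
    by rewrite lastE.
  have -> : S = (\row_(p < #|P|) phi (enum_val p)) *m D.
    apply/rowP=> g; rewrite -c_eps [RHS]mxE.
    have [[a [_ [_ _ _ ea _]]] _ _ _ _] := liftP g.
    rewrite (phiP _ _ ea) (phi_cls (src _)) (phi_cls (tgt _)).
    have pick q : phi q = \sum_(p < #|P|) phi (enum_val p) * (q == enum_val p)%:R :> 'F_2.
      rewrite (bigD1 (enum_rank q)) //= enum_rankK eqxx mulr1 big1 ?addr0 // => p np.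
      by case: eqP => [qp|_]; [move: np; rewrite qp enum_valK eqxx|rewrite mulr0].
    rewrite (pick (cls (src _))) (pick (cls (tgt _))) -big_split.
    by apply: eq_bigr => p _; rewrite !mxE mulrDr.
  exact: submxMl.
(* The coboundary [F] of the indicator of a class sums to zero around every cell. Over the cells of
   [U v], an edge inner to any branch set is counted zero or two times, and [F] vanishes on surface
   edges outside [E0]. What survives are the crossings of the edges of [G] at [v]. *)
have D_even : D *m A1 = 0.
  apply/matrixP=> p w; rewrite [RHS]mxE.
  pose psi q : 'F_2 := (cls q == enum_val p)%:R.
  pose F e := psi (src e) + psi (tgt e).
  pose v := enum_val w.
  have F0 e : surf e -> ~~ E0 e -> F e = 0.
    move=> es e0; rewrite /F /psi (cls_eq (src e) (tgt e)) ?addF2 //.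
    by apply/existsP; exists e; rewrite es e0 !eqxx.
  have tot : \sum_(x in U v) \sum_(e <- bd x) F e = 0.
    by rewrite big1 // => x _; apply: bd_closed.
  have swap : \sum_(x in U v) \sum_(e <- bd x) F e =
      \sum_e F e * \sum_(x in U v) (e \in bd x)%:R.
    transitivity (\sum_(x in U v) \sum_e F e * (e \in bd x)%:R).
      apply: eq_bigr => x _; rewrite big_uniq //= big_mkcond.
      by apply: eq_bigr => e _; case: (e \in bd x); rewrite ?mulr1 ?mulr0.
    by rewrite exchange_big; apply: eq_bigr => e _; rewrite big_distrr.
  have mult x y e : x != y -> e \in bd x -> e \in bd y ->
      \sum_(z in U v) (e \in bd z)%:R = (x \in U v)%:R + (y \in U v)%:R :> 'F_2.
    move=> xy ex ey; rewrite big_mkcond (bigD1 x) //= (bigD1 y) 1?eq_sym //=.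
    rewrite ex ey big1 ?addr0 => [|z /andP[zx zy]].
      by case: (x \in U v); case: (y \in U v).
    case: ifP => // _; case: (boolP (e \in bd z)) => // ez.
    by have [zE|zE] := bd_two ex ey ez xy; rewrite zE eqxx in zx zy.
  have inU u x : x \in U u -> (x \in U v) = (v == u).
    move=> xu; apply/idP/eqP => [xv|->//]; exact: U_disj xv xu.
  rewrite swap (bigID (mem (eps @: setT))) /= [X in _ + X]big1 ?addr0 in tot; last first.
    move=> e /negP ne; have [/existsP[x ex]|nsurf] := boolP (surf e); last first.
      rewrite [X in _ * X]big1 ?mulr0 // => x _.
      by have -> : (e \in bd x) = false by apply: contraNF nsurf => ex; apply/existsP; exists x.
    have [|nE0] := boolP (E0 e); last by rewrite F0 ?mul0r //; apply/existsP; exists x.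
    case/orP=> [/existsP[g /eqP eg]|/existsP[u /innerP[a [b [au bu ab ea eb]]]]].
      by case: ne; rewrite -eg imset_f.
    by rewrite (mult _ _ _ ab ea eb) (inU _ _ au) (inU _ _ bu) addF2 mulr0.
  rewrite big_imset /= in tot; last by move=> ? ? _ _; apply: eps_inj.
  rewrite -[RHS]tot mxE; apply: eq_big => [g|g _]; first by rewrite inE.
  rewrite !mxE; have [[a [b [au bv ab ea eb]]] _ _ _ _] := liftP g.
  by rewrite (mult _ _ _ ab ea eb) (inU _ _ au) (inU _ _ bv).
pose nz := [set p | row p D != 0].
(* By even degree, an edge of the boundary is continued at both of its ends, and the two
   continuations differ since [G] has no parallel edges. *)
have three p : p \in nz -> (3 <= #|[set g | D p g != 0%R]|)%N.
  rewrite inE => /eqP/rowP nz0.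
  have [/existsP[g0 g0P]|/existsPn all0] := boolP [exists g, D p g != 0]; last first.
    by case: nz0 => g; move: (all0 g); rewrite negbK !mxE => /eqP.
  have partner w : (w == (ends g0).1) || (w == (ends g0).2) ->
      exists g, [/\ g != g0, D p g != 0 & (w == (ends g).1) || (w == (ends g).2)].
    move=> w0; have /matrixP/(_ p (enum_rank w)) := D_even; rewrite !mxE (bigD1 g0) //=.
    rewrite [A1 _ _]mxE enum_rankK (F2_neq0 g0P) mul1r.
    have neq0 : (ends g0).1 != (ends g0).2.
      by apply: contraTneq (endsP g0).1 => ->; rewrite irrG.
    have -> : (w == (ends g0).1)%:R + (w == (ends g0).2)%:R = 1 :> 'F_2.
      case/orP: w0 => /eqP->; rewrite eqxx; first by rewrite (negPf neq0) addr0.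
      by rewrite eq_sym (negPf neq0) add0r.
    move=> s0; have [/existsP[g /and3P[gg0 Dg wg]]|/existsPn none] := boolP [exists g,
      [&& g != g0, D p g != 0 & (w == (ends g).1) || (w == (ends g).2)]]; first by exists g.
    suff z0 : \sum_(i < m | i != g0) D p i * A1 i (enum_rank w) = 0 by rewrite z0 addr0 in s0.
    apply: big1 => g gg0; have := none g; rewrite gg0 /= negb_and negbK.
    case/orP=> [/eqP->|/norP[/negPf w1 /negPf w2]]; first by rewrite mul0r.
    by rewrite [A1 _ _]mxE enum_rankK w1 w2 addr0 mulr0.
  have [|g1 [n1 D1 w1]] := partner (ends g0).1; first by rewrite eqxx.
  have [|g2 [n2 D2 w2]] := partner (ends g0).2; first by rewrite eqxx orbT.
  have n12 : g1 != g2.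
    apply: contraNneq n1 => g12; rewrite -g12 in w2; apply/eqP/esym/ends_eq.
    by move=> w /orP[]/eqP->.
  apply: (@leq_trans #|[set g0; g1; g2]|).
    by rewrite -setUA cardsU1 cards2 !inE negb_or ![g0 == _]eq_sym n1 n2 n12.
  by apply/subset_leq_card/subsetP=> g; rewrite !inE => /orP[/orP[]|] /eqP->.
have count : (3 * #|nz| <= 2 * m)%N.
  apply: (@leq_trans (\sum_(p in nz) #|[set g | D p g != 0%R]|)).
    by rewrite mulnC -sum_nat_const; apply: leq_sum.
  apply: (@leq_trans (\sum_p #|[set g | D p g != 0%R]|)).
    by rewrite [in X in (_ <= X)%N](bigID (mem nz)) leq_addr.
  have -> : (\sum_p #|[set g | D p g != 0%R]| = \sum_g #|[set p | D p g != 0%R]|)%N.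
    under eq_bigr do rewrite -sum1dep_card big_mkcond.
    rewrite exchange_big; apply: eq_bigr => g _.
    by rewrite -sum1dep_card [in RHS]big_mkcond.
  rewrite mulnC -[X in (_ <= X * _)%N]card_ord -sum_nat_const; apply: leq_sum => g _.
  apply: (@leq_trans #|[set enum_rank (cls (src (eps g))); enum_rank (cls (tgt (eps g)))]|).
    apply/subset_leq_card/subsetP=> p; rewrite !inE mxE; apply: contraR.
    case/norP=> n1 n2.
    have -> : (cls (src (eps g)) == enum_val p) = false.
      by apply: contraNF n1 => /eqP->; rewrite enum_valK.
    have -> : (cls (tgt (eps g)) == enum_val p) = false.
      by apply: contraNF n2 => /eqP->; rewrite enum_valK.
    by rewrite addr0.
  by rewrite cards2; case: (_ != _).
have := mxrankS ker_le; rewrite mxrank_ker.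
have := rank_le_nonzero_rows D; rewrite -/nz.
have := rank_leq_col (row_mx A1 A2).
by move: count; clear; lia.
Qed.

End Minor.
End CellComplex.

(** * The meshed surface *)

Notation dir := (option bool).
Notation dX := None.
Notation dY := (Some true).
Notation dZ := (Some false).

(** * Potentials of closed cochains on one coarse square *)

Section GridPotential.
Local Open Scope ring_scope.
Variables (L : nat) (u v Phi : nat -> nat -> 'F_2).
Hypothesis L_gt0 : (0 < L)%N.
Hypothesis closed : forall i j, (i < L)%N -> (j < L)%N ->
  u i j.+1 + u i j + v i.+1 j + v i j = 0.
Hypotheses (u0 : \sum_(0 <= i < L) u i 0 = 0) (v0 : \sum_(0 <= j < L) v 0 j = 0)
  (vL : \sum_(0 <= j < L) v L j = 0).
Hypothesis PhiE : forall i j, (i <= L)%N -> (j <= L)%N ->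
  Phi i j = \sum_(0 <= t < i %% L) u t (j %/ L * L) + \sum_(0 <= s < j %% L) v i s.

(** Closedness telescopes over the column of unit squares between heights 0 and j. *)
Lemma strip i j : (i < L)%N -> (j <= L)%N ->
  u i j = u i 0%N + \sum_(0 <= s < j) (v i s + v i.+1 s).
Proof.
move=> iL; elim: j => [|j IH] jL; first by rewrite big_geq ?addr0.
rewrite big_nat_recr //= addrA -IH 1?ltnW //.
have := closed iL jL; set a := u i j.+1; set b := u i j; set c := v i.+1 j; set e := v i j.
rewrite -!addrA => /addF2_eq->; by rewrite [c + e]addrC.
Qed.

(** The remainders in [PhiE] restart the summation on the far sides i = L and j = L. The restart is
    harmless because the sums along the sides vanish; for j = L, [strip] moves the top side to the
    bottom one. *)
Lemma Phi_formula i j : (i <= L)%N -> (j <= L)%N ->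
  Phi i j = \sum_(0 <= t < i) u t 0%N + \sum_(0 <= s < j) v i s.
Proof.
move=> iL jL; rewrite PhiE //.
have sumu w : \sum_(0 <= t < L) u t w = 0 ->
    \sum_(0 <= t < i %% L) u t w = \sum_(0 <= t < i) u t w.
  move=> h; move: iL; rewrite leq_eqVlt => /orP[/eqP->|iL]; last by rewrite modn_small.
  by rewrite modnn h big_geq.
move: jL; rewrite leq_eqVlt => /orP[/eqP->|jL]; last first.
  by rewrite (divn_small jL) (modn_small jL) mul0n sumu.
rewrite modnn divnn L_gt0 mul1n (big_geq (leqnn 0)) addr0.
have uL a : (a <= L)%N -> \sum_(0 <= t < a) u t L =
    \sum_(0 <= t < a) u t 0%N + \sum_(0 <= s < L) v a s.
  elim: a => [|a IH] aL; first by rewrite !(big_geq (leqnn 0)) v0 addr0.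
  rewrite !big_nat_recr //= IH 1?ltnW // (strip aL (leqnn L)) big_split /=.
  set p := \sum_(0 <= t < a) u t 0%N; set q := \sum_(0 <= s < L) v a s.
  set r := \sum_(0 <= s < L) v a.+1 s.
  by rewrite -!addrA; congr (p + _); rewrite addrCA; congr (_ + _); rewrite addrA addF2 add0r.
move: iL; rewrite leq_eqVlt => /orP[/eqP->|iL]; last by rewrite (modn_small iL) uL // ltnW.
by rewrite modnn big_geq // u0 vL addr0.
Qed.

Lemma Phi_v i j : (i <= L)%N -> (j < L)%N -> v i j = Phi i j + Phi i j.+1.
Proof.
move=> iL jL; rewrite (Phi_formula iL (ltnW jL)) (Phi_formula iL jL) (big_nat_recr j) //=.
move: (\sum_(0 <= t < i) _) (\sum_(0 <= s < j) _) (v i j) => a b c.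
by rewrite [(a + (b + c))%R]addrA addrA addF2 add0r.
Qed.

Lemma Phi_u i j : (i < L)%N -> (j <= L)%N -> u i j = Phi i j + Phi i.+1 j.
Proof.
move=> iL jL; rewrite (Phi_formula (ltnW iL) jL) (Phi_formula iL jL) (big_nat_recr i) //= (strip iL jL) big_split /=.
move: (\sum_(0 <= t < i) _) (\sum_(0 <= s < j) _) (\sum_(0 <= s < j) _) (u i 0) => a b c d.
by rewrite -[(a + d + b)%R]addrA addrACA addF2 add0r addrCA.
Qed.

End GridPotential.

(** * Combinatorics of the cubical mesh *)

Section Mesh.
Variables (g L : nat).
Hypothesis L_gt0 : 0 < L.

(* The fine cube (x, y, z) is [x-1, x] * [y-1, y] * [z-1, z] at scale 1/L. It
   lies in the coarse cube (cb x, cb y, cb z), for cb n the ceiling of n/L. *)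
Definition cb n := (n + L.-1) %/ L.

(** The square hole of index i is the coarse cell X = 2 i + 2, Y = 2. Counting cells from 1 leaves
    index 0 as an empty layer outside the slab. *)
Definition plan (X Y : nat) := [&& 0 < X <= (2 * g).+1, 0 < Y <= 3 & odd X || (Y != 2)].

Definition solid (p : cell3) := plan (cb p.1.1) (cb p.1.2) && (cb p.2 == 1).

Definition succ3 (d : dir) (p : cell3) : cell3 := match d with
  | dX => (p.1.1.+1, p.1.2, p.2)
  | dY => (p.1.1, p.1.2.+1, p.2)
  | dZ => (p.1.1, p.1.2, p.2.+1) end.

(* The face (d, p) separates the cubes p and p + e_d. *)
Definition bface (f : dir * cell3) := solid f.2 != solid (succ3 f.1 f.2).

(* The edge (d, p) is in direction d; p is the least of its four cubes. *)
Definition face_edges (f : dir * cell3) : seq (dir * cell3) :=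
  let: (x, y, z) := f.2 in match f.1 with
  | dX => [:: (dY, (x, y, z)); (dY, (x, y, z.-1)); (dZ, (x, y, z)); (dZ, (x, y.-1, z))]
  | dY => [:: (dX, (x, y, z)); (dX, (x, y, z.-1)); (dZ, (x, y, z)); (dZ, (x.-1, y, z))]
  | dZ => [:: (dX, (x, y, z)); (dX, (x, y.-1, z)); (dY, (x, y, z)); (dY, (x.-1, y, z))]
  end.

Definition edge_faces (e : dir * cell3) : seq (dir * cell3) :=
  let: (x, y, z) := e.2 in match e.1 with
  | dX => [:: (dY, (x, y, z)); (dY, (x, y, z.+1)); (dZ, (x, y, z)); (dZ, (x, y.+1, z))]
  | dY => [:: (dX, (x, y, z)); (dX, (x, y, z.+1)); (dZ, (x, y, z)); (dZ, (x.+1, y, z))]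
  | dZ => [:: (dX, (x, y, z)); (dX, (x, y.+1, z)); (dY, (x, y, z)); (dY, (x.+1, y, z))]
  end.

Lemma cb0 : cb 0 = 0.
Proof. by rewrite /cb divn_small // prednK. Qed.

Lemma cb_block X i : 0 < i <= L -> cb (X * L + i) = X.+1.
Proof.
move=> /andP[i0 iL]; rewrite /cb -addnA divnMDl // -addn1; congr (_ + _).
apply/eqP; rewrite eqn_leq -ltnS ltn_divLR // leq_divRL //; lia.
Qed.

Lemma cb_blockE n : 0 < n -> exists X i, [/\ i < L, n = X * L + i.+1 & cb n = X.+1].
Proof.
move=> n0; exists (n.-1 %/ L), (n.-1 %% L); have iL := ltn_pmod n.-1 L_gt0.
have nE : n = n.-1 %/ L * L + (n.-1 %% L).+1 by rewrite addnS -divn_eq prednK.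
by split=> //; rewrite {1}nE cb_block.
Qed.

Lemma cbS n : cb n.+1 = if L %| n then (cb n).+1 else cb n.
Proof.
case: n => [|n]; first by rewrite dvdn0 cb0; have := @cb_block 0 1; rewrite mul0n; apply.
have [X [i [iL -> ->]]] := cb_blockE (ltn0Sn n).
rewrite dvdn_addr ?dvdn_mull // -addnS; case: ifP => h.
  have -> : X * L + i.+2 = X.+1 * L + 1.
    have := dvdn_leq (ltn0Sn _) h; rewrite mulSn; lia.
  by rewrite cb_block.
have iL' : i.+1 < L by rewrite ltn_neqAle iL andbT; apply: contraFneq h => ->.
by rewrite cb_block.
Qed.

Lemma solid_pos p : solid p -> [/\ 0 < p.1.1, 0 < p.1.2 & 0 < p.2].
Proof.
case: p => [[x y] z]; rewrite /solid /plan /= => h.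
by case: x y z h => [|x] [|y] [|z]; rewrite ?cb0 ?andbF //=.
Qed.

(** Two solid columns never meet along a vertical edge alone, since the holes are isolated cells
    away from the rim. This makes the boundary a surface along vertical edges. *)
Lemma plan_no_diagonal x y : let P a b := plan (cb a) (cb b) in
  ~~ [&& P x y, P x.+1 y.+1, ~~ P x.+1 y & ~~ P x y.+1] /\
  ~~ [&& P x.+1 y, P x y.+1, ~~ P x y & ~~ P x.+1 y.+1].
Proof. by rewrite /= !cbS /plan; case: ifP => _; case: ifP => _; lia. Qed.

End Mesh.

(** * Local structure and first cohomology of the mesh *)

Section MeshTopology.
Variables (g L : nat).
Hypothesis L_gt0 : 0 < L.
Notation cb := (cb L).
Notation solid := (solid g L).
Notation bface := (bface g L).

Lemma bface_solid f : bface f -> solid f.2 \/ solid (succ3 f.1 f.2).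
Proof. by rewrite /bface; case: solid; [left|case: solid; [right|]]. Qed.

Lemma solid_cb p : solid p -> [/\ 0 < cb p.1.1 <= (2 * g).+1, 0 < cb p.1.2 <= 3 & cb p.2 = 1].
Proof. by move=> /andP[/and3P[-> -> _] /eqP->]. Qed.

Lemma cb_le n K : cb n <= K -> n <= K * L.
Proof.
case: n => [|n] //; have [X [i [iL -> ->]]] := cb_blockE L_gt0 (ltn0Sn n).
by move=> XK; have := leq_mul XK (leqnn L); rewrite mulSn; lia.
Qed.

Lemma cb_mul X : cb (X * L) = X.
Proof.
case: X => [|X]; first by rewrite mul0n cb0.
by rewrite mulSn addnC cb_block // L_gt0 leqnn.
Qed.

Lemma solid_le p : solid p -> [/\ p.1.1 <= (2 * g).+1 * L, p.1.2 <= 3 * L & p.2 <= L].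
Proof.
move=> /solid_cb[/andP[_ h1] /andP[_ h2] h3]; split; [exact: cb_le|exact: cb_le|].
by rewrite -[L]mul1n; apply: cb_le; rewrite h3.
Qed.

Lemma bface_le f : bface f ->
  [/\ f.2.1.1 <= (2 * g).+1 * L, f.2.1.2 <= 3 * L & f.2.2 <= L].
Proof.
case: f => [[[|]|] [[x y] z]] /bface_solid[h|h]; have [/= h1 h2 h3] := solid_le h; split=> //.
all: exact: ltnW.
Qed.

Lemma bface_pos f : bface f -> forall d, d != f.1 ->
  match d with dX => 0 < f.2.1.1 | dY => 0 < f.2.1.2 | dZ => 0 < f.2.2 end.
Proof.
case: f => [[[|]|] [[x y] z]] /bface_solid[h|h]; have [/= h1 h2 h3] := solid_pos L_gt0 h;
  by case=> [[|]|].
Qed.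

Lemma edge_facesP f e : bface f -> e \in face_edges f -> f \in edge_faces e.
Proof.
case: f => [d [[x y] z]] bf; have := bface_pos bf.
case: d bf => [[|]|] bf pos.
- have := pos dX isT; have := pos dZ isT => /= z0 x0.
  rewrite !inE => /or4P[] /eqP-> /=; rewrite !inE ?prednK // eqxx ?orbT //.
- have := pos dX isT; have := pos dY isT => /= z0 x0.
  rewrite !inE => /or4P[] /eqP-> /=; rewrite !inE ?prednK // eqxx ?orbT //.
- have := pos dY isT; have := pos dZ isT => /= z0 x0.
  rewrite !inE => /or4P[] /eqP-> /=; rewrite !inE ?prednK // eqxx ?orbT //.
Qed.

(** Around a horizontal edge the solid cubes are a product of a pattern in the plan and one in
    height, so solidity changes at most twice in a turn. Around a vertical edge the diagonal
    patterns are excluded by [plan_no_diagonal]. *)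
Lemma size_edge_faces e : size (filter bface (edge_faces e)) <= 2.
Proof.
case: e => [d [[x y] z]]; rewrite size_filter.
have [/= n1 n2] := plan_no_diagonal g L_gt0 x y; rewrite /bface /solid.
case: d => [[|]|].
- by rewrite /=; case: plan; case: plan; case: (cb z == 1); case: (cb z.+1 == 1).
- rewrite /=; case: plan n1 n2; case: plan; case: plan; case: plan; by case: (cb z == 1).
- by rewrite /=; case: plan; case: plan; case: (cb z == 1); case: (cb z.+1 == 1).
Qed.

Lemma face_edges_uniq f : bface f -> uniq (face_edges f).
Proof.
case: f => [d [[x y] z]] bf; have := bface_pos bf.
have ne n : 0 < n -> (n == n.-1) = false by case: n => // n _; rewrite /= eqn_leq ltnn.
case: d bf => [[|]|] bf pos /=; rewrite !inE !xpair_eqE /= ?andbT ?andbF ?orbF;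
  rewrite ?ne ?andbF //.
all: first [exact: (pos dX isT)|exact: (pos dY isT)|exact: (pos dZ isT)].
Qed.

Definition lower3 (d : dir) (p : cell3) : cell3 := match d with
  | dX => (p.1.1.-1, p.1.2, p.2)
  | dY => (p.1.1, p.1.2.-1, p.2)
  | dZ => (p.1.1, p.1.2, p.2.-1) end.

(** Fine edge number t of the coarse edge that leaves the lattice point (X, Y, Z) in direction d. A
    fine edge is indexed by its upper end, hence the successor. *)
Definition coarse_edge (d : dir) X Y Z t : dir * cell3 := match d with
  | dX => (dX, ((X * L + t).+1, Y * L, Z * L))
  | dY => (dY, (X * L, (Y * L + t).+1, Z * L))
  | dZ => (dZ, (X * L, Y * L, (Z * L + t).+1)) end.

Section Exactness.
Local Open Scope ring_scope.
Variable c : dir * cell3 -> 'F_2.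
Hypothesis c_closed : forall f, bface f -> \sum_(e <- face_edges f) c e = 0.
Hypothesis c_coarse : forall d X Y Z, (X < 2 * g + 3)%N -> (Y < 4)%N -> (Z < 2)%N ->
  \sum_(0 <= t < L) c (coarse_edge d X Y Z t) = 0.

Definition run (F : nat -> 'F_2) n := \sum_(0 <= t < n %% L) F (n %/ L * L + t)%N.

(** The sum of [c] along a path from the coarse lattice point obtained by rounding down: first in x,
    then in y, then in z, with the later coordinates still rounded. On a coarse square one of the
    three runs is empty. *)
Definition potential (p : cell3) : 'F_2 := let: (x, y, z) := p in
  run (fun t => c (dX, (t.+1, (y %/ L * L)%N, (z %/ L * L)%N))) x +
  run (fun t => c (dY, (x, t.+1, (z %/ L * L)%N))) y +
  run (fun t => c (dZ, (x, y, t.+1))) z.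

Lemma run_block F X i : (i <= L)%N ->
  run F (X * L + i)%N = \sum_(0 <= t < i %% L) F (X * L + t)%N.
Proof.
move=> iL; rewrite /run modnMDl; move: iL; rewrite leq_eqVlt => /orP[/eqP->|iL].
  by rewrite modnn !big_geq.
by rewrite divnMDl // divn_small // addn0.
Qed.

Lemma run_mul F X : run F (X * L)%N = 0.
Proof. by rewrite /run modnMl big_geq. Qed.

Lemma floor_block X j : ((X * L + j) %/ L * L)%N = (X * L + j %/ L * L)%N.
Proof. by rewrite divnMDl // mulnDl. Qed.

Lemma square_potential (u v Phi : nat -> nat -> 'F_2) i j :
  (i < L)%N -> (j < L)%N ->
  (forall i j, (i < L)%N -> (j < L)%N -> u i j.+1 + u i j + v i.+1 j + v i j = 0) ->
  \sum_(0 <= t < L) u t 0%N = 0 -> \sum_(0 <= t < L) v 0%N t = 0 ->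
  \sum_(0 <= t < L) v L t = 0 ->
  (forall i j, (i <= L)%N -> (j <= L)%N ->
    Phi i j = \sum_(0 <= t < i %% L) u t (j %/ L * L)%N + \sum_(0 <= s < j %% L) v i s) ->
  [/\ u i j.+1 = Phi i j.+1 + Phi i.+1 j.+1, u i j = Phi i j + Phi i.+1 j,
      v i.+1 j = Phi i.+1 j + Phi i.+1 j.+1 & v i j = Phi i j + Phi i j.+1].
Proof.
move=> iL jL cl u0 v0 vL PhiE; split.
- exact: (Phi_u L_gt0 cl u0 v0 vL PhiE).
- by apply: (Phi_u L_gt0 cl u0 v0 vL PhiE) => //; apply: ltnW.
- exact: (Phi_v L_gt0 cl u0 v0 vL PhiE).
- by apply: (Phi_v L_gt0 cl u0 v0 vL PhiE) => //; apply: ltnW.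
Qed.

Lemma jump n : cb n != cb n.+1 -> exists X, n = (X * L)%N.
Proof.
rewrite cbS //; case: ifP => [/dvdnP[X ->] _|]; first by exists X.
by rewrite eqxx.
Qed.

(** Solidity changes only across coarse planes, so a boundary face lies in a coarse square, and all
    fine faces of that square are boundary faces. The sums along its sides vanish by [c_coarse], and
    [square_potential] applies in each of the three directions. *)
Lemma potential_edges f e : bface f -> e \in face_edges f ->
  c e = potential (lower3 e.1 e.2) + potential e.2.
Proof.
case: f => [d [[x y] z]] bf; have pos := bface_pos bf.
have cl4 f : bface f -> forall a b c1 d1, face_edges f = [:: a; b; c1; d1] ->
    c a + c b + c c1 + c d1 = 0.
  move=> /c_closed + a b c1 d1 fE; by rewrite fE !big_cons big_nil addr0 -!addrA.
have cbB W a : (a < L)%N -> cb (W * L + a).+1 = W.+1.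
  by move=> aL; rewrite -addnS cb_block.
have LL W : (W * L + L = W.+1 * L)%N by rewrite mulSn addnC.
case: d bf pos => [[|]|] bf pos.
- have [X [i [iL /= xE _]]] := cb_blockE L_gt0 (pos dX isT).
  have [Z [k [kL /= zE _]]] := cb_blockE L_gt0 (pos dZ isT).
  rewrite addnS in xE; rewrite addnS in zE; subst x z.
  have [Y yE] : exists Y, y = (Y * L)%N.
    by apply: jump; apply: contraTneq bf; rewrite /bface /solid /= => ->; rewrite eqxx.
  subst y.
  have [xr yr zr] : [/\ (X <= 2 * g)%N, (Y <= 3)%N & Z = 0%N].
    case/bface_solid: bf => /solid_cb /=; rewrite !cbB // ?cb_mul ?cbS // ?dvdn_mull // ?cb_mul;
      by case=> h1 h2 h3; split; lia.
  have bf' a b : (a < L)%N -> (b < L)%N -> bface (dY, ((X * L + a).+1, (Y * L)%N, (Z * L + b).+1)).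
    by move=> aL bL; move: bf; rewrite /bface /solid /= !cbB.
  pose u t s := c (dX, ((X * L + t).+1, (Y * L)%N, (Z * L + s)%N)).
  pose v t s := c (dZ, ((X * L + t)%N, (Y * L)%N, (Z * L + s).+1)).
  pose Phi t s := potential ((X * L + t)%N, (Y * L)%N, (Z * L + s)%N).
  have [|||||h1 h2 h3 h4] := @square_potential u v Phi i k iL kL.
  + move=> a b aL bL; rewrite /u /v !addnS; apply: (cl4 _ (bf' a b aL bL)).
    by rewrite /face_edges /= .
  + by rewrite /u addn0; apply: (c_coarse dX); lia.
  + by rewrite /v addn0; apply: (c_coarse dZ); lia.
  + by rewrite /v LL; apply: (c_coarse dZ); lia.
  + move=> a b aL bL; rewrite /Phi /potential run_mul addr0 !run_block // mulnK //.
    congr (_ + _); first by apply: eq_bigr => t _; rewrite floor_block.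
  rewrite /u /v /Phi !addnS in h1 h2 h3 h4.
  by rewrite !inE => /or4P[] /eqP-> /=.
- have [X [i [iL /= xE _]]] := cb_blockE L_gt0 (pos dX isT).
  have [Y [k [kL /= yE _]]] := cb_blockE L_gt0 (pos dY isT).
  rewrite addnS in xE; rewrite addnS in yE; subst x y.
  have [Z zE] : exists Z, z = (Z * L)%N.
    by apply: jump; apply: contraTneq bf; rewrite /bface /solid /= => ->; rewrite eqxx.
  subst z.
  have [xr yr zr] : [/\ (X <= 2 * g)%N, (Y <= 2)%N & (Z <= 1)%N].
    case/bface_solid: bf => /solid_cb /=; rewrite !cbB // ?cb_mul ?cbS // ?dvdn_mull // ?cb_mul;
      by case=> h1 h2 h3; split; lia.
  have bf' a b : (a < L)%N -> (b < L)%N -> bface (dZ, ((X * L + a).+1, (Y * L + b).+1, (Z * L)%N)).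
    by move=> aL bL; move: bf; rewrite /bface /solid /= !cbB.
  pose u t s := c (dX, ((X * L + t).+1, (Y * L + s)%N, (Z * L)%N)).
  pose v t s := c (dY, ((X * L + t)%N, (Y * L + s).+1, (Z * L)%N)).
  pose Phi t s := potential ((X * L + t)%N, (Y * L + s)%N, (Z * L)%N).
  have [|||||h1 h2 h3 h4] := @square_potential u v Phi i k iL kL.
  + move=> a b aL bL; rewrite /u /v !addnS; apply: (cl4 _ (bf' a b aL bL)).
    by rewrite /face_edges /= .
  + by rewrite /u addn0; apply: (c_coarse dX); lia.
  + by rewrite /v addn0; apply: (c_coarse dY); lia.
  + by rewrite /v LL; apply: (c_coarse dY); lia.
  + move=> a b aL bL; rewrite /Phi /potential run_mul addr0 !run_block // mulnK //.
    congr (_ + _); first by apply: eq_bigr => t _; rewrite floor_block.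
  rewrite /u /v /Phi !addnS in h1 h2 h3 h4.
  by rewrite !inE => /or4P[] /eqP-> /=.
have [Y [i [iL /= yE _]]] := cb_blockE L_gt0 (pos dY isT).
have [Z [k [kL /= zE _]]] := cb_blockE L_gt0 (pos dZ isT).
rewrite addnS in yE; rewrite addnS in zE; subst y z.
have [X xE] : exists X, x = (X * L)%N.
  by apply: jump; apply: contraTneq bf; rewrite /bface /solid /= => ->; rewrite eqxx.
subst x.
have [xr yr zr] : [/\ (X <= 2 * g + 1)%N, (Y <= 2)%N & Z = 0%N].
  case/bface_solid: bf => /solid_cb /=; rewrite !cbB // ?cb_mul ?cbS // ?dvdn_mull // ?cb_mul;
    by case=> h1 h2 h3; split; lia.
have bf' a b : (a < L)%N -> (b < L)%N -> bface (dX, ((X * L)%N, (Y * L + a).+1, (Z * L + b).+1)).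
  by move=> aL bL; move: bf; rewrite /bface /solid /= !cbB.
pose u t s := c (dY, ((X * L)%N, (Y * L + t).+1, (Z * L + s)%N)).
pose v t s := c (dZ, ((X * L)%N, (Y * L + t)%N, (Z * L + s).+1)).
pose Phi t s := potential ((X * L)%N, (Y * L + t)%N, (Z * L + s)%N).
have [|||||h1 h2 h3 h4] := @square_potential u v Phi i k iL kL.
+ move=> a b aL bL; rewrite /u /v !addnS; apply: (cl4 _ (bf' a b aL bL)).
  by rewrite /face_edges /= .
+ by rewrite /u addn0; apply: (c_coarse dY); lia.
+ by rewrite /v addn0; apply: (c_coarse dZ); lia.
+ by rewrite /v LL; apply: (c_coarse dZ); lia.
+ move=> a b aL bL; rewrite /Phi /potential run_mul add0r !run_block //.
  congr (_ + _); first by apply: eq_bigr => t _; rewrite floor_block.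
rewrite /u /v /Phi !addnS in h1 h2 h3 h4.
by rewrite !inE => /or4P[] /eqP-> /=.
Qed.

End Exactness.

End MeshTopology.

(** An edge lies on at most two cells, so the shared edge determines the neighbour. *)
Lemma cell_degree (M E : finType) (bd : M -> seq E) :
  (forall e x y z, e \in bd x -> e \in bd y -> e \in bd z -> x != y -> z = x \/ z = y) ->
  forall x, #|[set y | cell_adj bd x y]| <= size (bd x).
Proof.
move=> two x.
have /fin_all_exists[f fP] : forall y, exists o, cell_adj bd x y ->
    exists e, [/\ o = Some e, e \in bd x & e \in bd y].
  move=> y.
  have [/andP[_ /hasP[e ex ey]]|n] := boolP (cell_adj bd x y); last by exists None.
  by exists (Some e) => _; exists e.
rewrite -(card_in_imset (f := f) (D := mem [set y | cell_adj bd x y])).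
  rewrite -(size_map Some); apply: leq_trans (card_size _).
  apply/subset_leq_card/subsetP=> _ /imsetP[y + ->]; rewrite inE => /fP[e [-> ex _]].
  by apply/mapP; exists e.
move=> y z; rewrite !inE => xy xz fyz.
have [e [fy ex ey]] := fP y xy; have [e' [fz _ ez]] := fP z xz.
move: fyz; rewrite fy fz => -[ee]; subst e'.
have xny : x != y by case/andP: xy.
by have [zx|//] := two _ _ _ _ ex ey ez xny; move: xz; rewrite zx /cell_adj eqxx.
Qed.

(** * The mesh as a finite cell complex *)

Section FiniteMesh.
Variables (g L side : nat).
Hypotheses (L_gt0 : 0 < L) (side_ge : (2 * g + 3) * L <= side).
Notation bface := (bface g L).

Notation crd := 'I_side.+1.
Notation cell := (dir * (crd * crd * crd))%type.

Definition nat3 (p : crd * crd * crd) : cell3 := (val p.1.1, val p.1.2, val p.2).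

Definition ord3 (p : cell3) : crd * crd * crd := (inord p.1.1, inord p.1.2, inord p.2).

Definition natc (x : cell) : dir * cell3 := (x.1, nat3 x.2).

Definition ordc (f : dir * cell3) : cell := (f.1, ord3 f.2).

Definition low (p : cell3) := [&& p.1.1 <= side, p.1.2 <= side & p.2 <= side].

Lemma ord3K p : low p -> nat3 (ord3 p) = p.
Proof. by case: p => [[x y] z] /and3P[h1 h2 h3]; congr (_, _, _); apply: inordK. Qed.

Lemma nat3K p : ord3 (nat3 p) = p.
Proof. by case: p => [[x y] z]; congr (_, _, _); apply: inord_val. Qed.

Lemma low_nat3 p : low (nat3 p).
Proof. by case: p => [[x y] z]; apply/and3P; split; rewrite -ltnS; apply: ltn_ord. Qed.

Lemma ordcK f : low f.2 -> natc (ordc f) = f.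
Proof. by case: f => d p lp; congr (_, _); apply: ord3K. Qed.

Lemma natcK x : ordc (natc x) = x.
Proof. by case: x => d p; congr (_, _); apply: nat3K. Qed.

Lemma natc_inj : injective natc.
Proof. exact: can_inj natcK. Qed.

Lemma bface_low f : bface f -> low f.2.
Proof.
move=> /(bface_le L_gt0)[h1 h2 h3]; rewrite /low.
by apply/and3P; split; [apply: leq_trans h1 _|apply: leq_trans h2 _|apply: leq_trans h3 _];
  move: side_ge L_gt0; clear; lia.
Qed.

Lemma low_le p q : low p -> q.1.1 <= p.1.1 -> q.1.2 <= p.1.2 -> q.2 <= p.2 -> low q.
Proof. by rewrite /low; clear; lia. Qed.

Lemma face_edges_low f e : low f.2 -> e \in face_edges f -> low e.2.
Proof.
case: f => [[[|]|] [[x y] z]] /= lf; rewrite !inE => /or4P[] /eqP-> /=;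
  by apply: (low_le lf) => //=; apply: leq_pred.
Qed.

Lemma lower3_low d p : low p -> low (lower3 d p).
Proof.
by case: p => [[x y] z] lp; apply: (low_le lp); case: d => [[|]|] //=; apply: leq_pred.
Qed.

(** Every index in range counts as a cell; one that is not a boundary face has no edges and is
    isolated in the dual graph. *)
Definition mesh_bd (x : cell) : seq cell :=
  if bface (natc x) then [seq ordc e | e <- face_edges (natc x)] else [::].

Definition mesh_src (e : cell) := ord3 (lower3 e.1 (nat3 e.2)).

Definition mesh_tgt (e : cell) := e.2.

Lemma mesh_bdP x e : e \in mesh_bd x -> bface (natc x) /\ natc e \in face_edges (natc x).
Proof.
rewrite /mesh_bd; case: ifP => // bx /mapP[e' ex ->]; split=> //.
by rewrite ordcK //; apply: face_edges_low ex; apply: (low_nat3 x.2).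
Qed.

Lemma mem_mesh_bd x e : bface (natc x) -> natc e \in face_edges (natc x) -> e \in mesh_bd x.
Proof. by move=> bx ex; rewrite /mesh_bd bx -[e]natcK map_f. Qed.

Lemma mesh_uniq x : uniq (mesh_bd x).
Proof.
rewrite /mesh_bd; case: ifP => // bx; rewrite map_inj_in_uniq; first exact: face_edges_uniq bx.
move=> e e' ex ex' ee; have lx : low (natc x).2 := low_nat3 x.2.
by rewrite -(ordcK (face_edges_low lx ex)) ee ordcK // (face_edges_low lx ex').
Qed.

Lemma mesh_two e x y z : e \in mesh_bd x -> e \in mesh_bd y -> e \in mesh_bd z ->
  x != y -> z = x \/ z = y.
Proof.
have h w : e \in mesh_bd w -> natc w \in filter bface (edge_faces (natc e)).
  by move=> /mesh_bdP[bw ew]; rewrite mem_filter bw (edge_facesP L_gt0 bw).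
move=> /h hx /h hy /h hz xy; have := size_edge_faces g L_gt0 (natc e).
move: hx hy hz; case: filter => [|a [|b [|]]] //; rewrite !inE.
  by move=> /eqP ax /eqP ay; move/eqP: xy; case; apply: natc_inj; rewrite ax.
move=> /orP[]/eqP ax /orP[]/eqP ay /orP[]/eqP az _.
all: first [by left; apply: natc_inj; rewrite az ax|by right; apply: natc_inj; rewrite az ay|
  by move/eqP: xy; case; apply: natc_inj; rewrite ax ay].
Qed.

Lemma mesh_degree x : #|[set y | cell_adj mesh_bd x y]| <= 4.
Proof.
apply: leq_trans (cell_degree mesh_two x) _; rewrite /mesh_bd; case: ifP => // _.
by rewrite size_map; case: (natc x) => [[[|]|] [[a b] c]].
Qed.

Lemma square_sum (a b c d : 'F_2) : ((a + b) + ((c + d) + ((d + b) + ((c + a) + 0))) = 0)%R.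
Proof.
by move: a b c d; do 4![case=> [[|[|]]] //= ?]; apply/eqP.
Qed.

Local Open Scope ring_scope.

Lemma mesh_closed (phi : crd * crd * crd -> 'F_2) x :
  \sum_(e <- mesh_bd x) (phi (mesh_src e) + phi (mesh_tgt e)) = 0.
Proof.
rewrite /mesh_bd; case: ifP => [bx|_]; last by rewrite big_nil.
rewrite big_map.
have lx : low (natc x).2 := low_nat3 x.2.
transitivity (\sum_(e <- face_edges (natc x)) (phi (ord3 (lower3 e.1 e.2)) + phi (ord3 e.2))).
  rewrite big_seq [RHS]big_seq; apply: eq_bigr => e ex; congr (phi _ + phi _).
  by rewrite /mesh_src /= ord3K // (face_edges_low lx ex).
case: (natc x) => [[[|]|] [[a b] c]]; rewrite /face_edges /= !big_cons big_nil /=;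
  exact: square_sum.
Qed.

Definition coarse_index := (dir * ('I_(2 * g + 3) * 'I_4 * 'I_2))%type.

Definition coarse_sum (i : coarse_index) (e : cell) : 'F_2 :=
  \sum_(0 <= t < L) (e == ordc (coarse_edge L i.1 i.2.1.1 i.2.1.2 i.2.2 t))%:R.

Lemma mesh_exact (c : cell -> 'F_2) :
  (forall x, \sum_(e <- mesh_bd x) c e = 0) ->
  (forall i : 'I_#|{: coarse_index}|, \sum_e coarse_sum (enum_val i) e * c e = 0) ->
  exists phi : crd * crd * crd -> 'F_2,
    forall x e, e \in mesh_bd x -> c e = phi (mesh_src e) + phi (mesh_tgt e).
Proof.
move=> c_closed c_coarse; pose c' f := c (ordc f).
have closed' f : bface f -> \sum_(e <- face_edges f) c' e = 0.
  move=> bf; have := c_closed (ordc f); rewrite /mesh_bd ordcK ?bface_low // bf.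
  by rewrite big_map.
have coarse' d X Y Z : (X < 2 * g + 3)%N -> (Y < 4)%N -> (Z < 2)%N ->
    \sum_(0 <= t < L) c' (coarse_edge L d X Y Z t) = 0.
  move=> hX hY hZ; pose i : coarse_index := (d, (Ordinal hX, Ordinal hY, Ordinal hZ)).
  transitivity (\sum_e coarse_sum i e * c e); last first.
    by have := c_coarse (enum_rank i); rewrite enum_rankK.
  transitivity (\sum_e \sum_(0 <= t < L) (e == ordc (coarse_edge L d X Y Z t))%:R * c e);
    last by apply: eq_bigr => e _; rewrite big_distrl.
  rewrite exchange_big; apply: eq_bigr => t _.
  rewrite (bigD1 (ordc (coarse_edge L d X Y Z t))) //= eqxx mul1r.
  by rewrite big1 ?addr0 // => e /negPf ne; rewrite ne mul0r.
exists (fun p => potential L c' (nat3 p)) => x e /mesh_bdP[bx ex].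
have := potential_edges L_gt0 closed' coarse' bx ex.
rewrite {1}/c' natcK => ->; rewrite /mesh_src ord3K //.
by apply: lower3_low; apply: low_nat3.
Qed.

Lemma mesh_minor_bound (G : finType) (eG : rel G) (U : G -> {set cell}) :
  irreflexive eG -> minor_model eG (cell_adj mesh_bd) U ->
  (#|oedges eG| <= 3 * (#|G| + 72 * g.+1))%N.
Proof.
move=> irrG modelU.
apply: leq_trans (minor_edge_bound mesh_uniq mesh_two mesh_closed mesh_exact irrG modelU) _.
(* The number of coarse edges in range is 3 * (2 g + 3) * 4 * 2 = 48 g + 72. *)
rewrite leq_mul2l leq_add2l /= !card_prod !card_ord card_option card_bool.
by lia.
Qed.

End FiniteMesh.

(* The faces at the centre of a 2 * 2 * 2 block of cubes: (d, (b, c)) separates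
   two cubes in direction d, and b, c locate it in the two other directions. *)
Notation aface := (dir * (bool * bool))%type.

Definition afaces : seq aface :=
  [seq (d, bc) | d <- [:: dX; dY; dZ], bc <-
    [:: (false, false); (false, true); (true, false); (true, true)]].

Arguments afaces : simpl never.

Lemma mem_afaces f : f \in afaces.
Proof. by case: f => [[[|]|] [[|] [|]]]. Qed.

Definition aflag (s : bool -> bool -> bool -> bool) (f : aface) :=
  let: (b, c) := f.2 in match f.1 with
  | dX => s false b c != s true b c
  | dY => s b false c != s b true c
  | dZ => s b c false != s b c true end.

Lemma aflag_ext s s' f : (forall a b c, s a b c = s' a b c) -> aflag s f = aflag s' f.
Proof. by move=> E; case: f => [[[|]|] [b c]]; rewrite /aflag /= !E. Qed.

(* The two half edges at the centre of the block on which a face lies. *)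
Definition halves (f : aface) : seq (dir * bool) :=
  let: (b, c) := f.2 in match f.1 with
  | dX => [:: (dZ, c); (dY, b)]
  | dY => [:: (dZ, c); (dX, b)]
  | dZ => [:: (dY, c); (dX, b)] end.

Definition ashare f f' := has [in halves f'] (halves f).

Fixpoint aclosure (fl : pred aface) n (S : seq aface) :=
  if n is n'.+1 then
    aclosure fl n' [seq f <- afaces | fl f && has (fun f' => (f == f') || ashare f f') S]
  else S.

Definition tab (s00 s01 s10 s11 a b : bool) :=
  if a then if b then s11 else s10 else if b then s01 else s00.

Definition link_connected (fl : pred aface) := all (fun f => all (fun f' => [in aclosure fl 6 [:: f]] f')
  (filter fl afaces)) (filter fl afaces).

(** Around a lattice point the solid cubes are the product of a 2 * 2 pattern in the plan and a
    vertical pattern. All 64 cases are computed; six rounds of [aclosure] suffice in each of those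
    allowed. *)
Lemma link_check s00 s01 s10 s11 z0 z1 :
  ~~ [&& s00, s11, ~~ s10 & ~~ s01] -> ~~ [&& s10, s01, ~~ s00 & ~~ s11] ->
  link_connected (aflag (fun a b c => tab s00 s01 s10 s11 a b && (if c then z1 else z0))).
Proof. by case: s00; case: s01; case: s10; case: s11; case: z0; case: z1. Qed.

Lemma aclosure_ind (fl : pred aface) (Q : aface -> Prop) n (S : seq aface) :
  (forall f f', fl f -> fl f' -> ashare f f' -> Q f' -> Q f) ->
  (forall f, f \in S -> fl f /\ Q f) -> forall f, f \in aclosure fl n S -> fl f /\ Q f.
Proof.
move=> step; elim: n S => [|n IH] S hS f; first exact: hS.
apply: (IH [seq f <- afaces | fl f && has (fun f' => (f == f') || ashare f f') S]) => {}f.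
rewrite mem_filter => /andP[/andP[ff /hasP[f' /hS[ff' Qf'] /orP[/eqP->//|sh]]] _].
by split=> //; apply: step Qf'.
Qed.

(** * The boundary faces around a point form a connected set *)

Section Link.
Variables (g L side : nat).
Hypotheses (L_gt0 : 0 < L) (side_ge : (2 * g + 3) * L <= side).
Variables (X Y Z : bool -> nat).
Hypotheses (hX : X true = X false \/ X true = (X false).+1)
           (hY : Y true = Y false \/ Y true = (Y false).+1)
           (hZ : Z true = Z false \/ Z true = (Z false).+1).

(** The two values of [W] are the slabs that contain a given coordinate. They coincide when the
    coordinate is off the lattice, so points inside faces, on edges and at vertices of the mesh are
    all treated alike. *)
Definition blk (W : bool -> nat) n := (n == W false) || (n == W true).

Definition in_block (p : cell3) := [&& blk X p.1.1, blk Y p.1.2 & blk Z p.2].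

Definition block_faces := [set m : dir * ('I_side.+1 * 'I_side.+1 * 'I_side.+1) |
  [&& bface g L (natc m), in_block (natc m).2 & in_block (succ3 (natc m).1 (natc m).2)]].

Let s a b c := solid g L (X a, Y b, Z c).

Definition real_face (f : aface) : dir * cell3 :=
  let: (b, c) := f.2 in match f.1 with
  | dX => (dX, (X false, Y b, Z c))
  | dY => (dY, (X b, Y false, Z c))
  | dZ => (dZ, (X b, Y c, Z false)) end.

Definition nondeg d := match d with
  | dX => X true = (X false).+1
  | dY => Y true = (Y false).+1
  | dZ => Z true = (Z false).+1 end.

Lemma aflag_nondeg f : aflag s f -> nondeg f.1.
Proof.
case: f => [[[|]|] [b c]]; rewrite /aflag /s /=.
- by case: hY => [->|//]; rewrite eqxx.
- by case: hZ => [->|//]; rewrite eqxx.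
- by case: hX => [->|//]; rewrite eqxx.
Qed.

Lemma blk_bit W b : blk W (W b).
Proof. by rewrite /blk; case: b; rewrite eqxx ?orbT. Qed.

Lemma aflag_real f : aflag s f -> bface g L (real_face f) /\
  in_block (real_face f).2 /\ in_block (succ3 (real_face f).1 (real_face f).2).
Proof.
move=> ff; have := aflag_nondeg ff; move: ff.
case: f => [[[|]|] [b c]]; rewrite /aflag /s /in_block /bface /= => + <-;
  by rewrite !blk_bit.
Qed.

Lemma bit_blk W n : blk W n -> exists b, n = W b.
Proof. by case/orP=> /eqP->; [exists false|exists true]. Qed.

Lemma blk_succ W n : W true = W false \/ W true = (W false).+1 ->
  blk W n -> blk W n.+1 -> n = W false /\ W true = (W false).+1.
Proof. by rewrite /blk => h; lia. Qed.

Lemma real_aflag m : m \in block_faces -> exists2 f, aflag s f & natc m = real_face f.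
Proof.
rewrite inE; case: (natc m) => d [[x y] z] /and3P[bm /and3P[/= bx by_ bz]].
rewrite /in_block; case: d bm => [[|]|] bm /= /and3P[bx' by' bz'].
- have [[a xa] [c zc]] := (bit_blk bx, bit_blk bz).
  have [yb Y1] := blk_succ hY by_ by'; exists (dY, (a, c)); last by rewrite /real_face /= xa zc yb.
  by move: bm; rewrite /bface /aflag /s /= xa zc yb Y1.
- have [[a xa] [c yc]] := (bit_blk bx, bit_blk by_).
  have [zb Z1] := blk_succ hZ bz bz'; exists (dZ, (a, c)); last by rewrite /real_face /= xa yc zb.
  by move: bm; rewrite /bface /aflag /s /= xa yc zb Z1.
have [[a ya] [c zc]] := (bit_blk by_, bit_blk bz).
have [xb X1] := blk_succ hX bx bx'; exists (dX, (a, c)); last by rewrite /real_face /= ya zc xb.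
by move: bm; rewrite /bface /aflag /s /= ya zc xb X1.
Qed.

Definition real_half (h : dir * bool) : dir * cell3 := match h.1 with
  | dX => (dX, (X h.2, Y false, Z false))
  | dY => (dY, (X false, Y h.2, Z false))
  | dZ => (dZ, (X false, Y false, Z h.2)) end.

Lemma real_half_mem f h : h \in halves f ->
  (forall d, d != f.1 -> d != h.1 -> nondeg d) -> real_half h \in face_edges (real_face f).
Proof.
case: f => [[[|]|] [b c]]; rewrite !inE => /orP[]/eqP-> nd.
- by have {nd} /= h1 := nd dX isT isT; case: b; rewrite /= ?inE /= ?h1 /= ?eqxx ?orbT.
- by have {nd} /= h1 := nd dZ isT isT; case: c; rewrite /= ?inE /= ?h1 /= ?eqxx ?orbT.
- by have {nd} /= h1 := nd dX isT isT; case: b; rewrite /= ?inE /= ?h1 /= ?eqxx ?orbT.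
- by have {nd} /= h1 := nd dY isT isT; case: c; rewrite /= ?inE /= ?h1 /= ?eqxx ?orbT.
- by have {nd} /= h1 := nd dY isT isT; case: b; rewrite /= ?inE /= ?h1 /= ?eqxx ?orbT.
- by have {nd} /= h1 := nd dZ isT isT; case: c; rewrite /= ?inE /= ?h1 /= ?eqxx ?orbT.
Qed.

(** A common half edge lies on both faces if the direction orthogonal to it and to the normal of
    each face is not degenerate. Otherwise both faces have the same normal and differ at most in the
    degenerate coordinate, so they coincide. *)
Lemma share_real f f' : aflag s f -> aflag s f' -> ashare f f' ->
  real_face f = real_face f' \/
  exists2 e, e \in face_edges (real_face f) & e \in face_edges (real_face f').
Proof.
move=> ff ff' /hasP[h hf hf']; have n1 := aflag_nondeg ff; have n2 := aflag_nondeg ff'.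
have [ddeg|] := boolP [forall d, (d != f.1) && (d != h.1) ==>
   match d with dX => X true == (X false).+1 | dY => Y true == (Y false).+1
   | dZ => Z true == (Z false).+1 end].
  have nd d : d != f.1 -> d != h.1 -> nondeg d.
    move=> d1 d2; move/forallP/(_ d): ddeg; rewrite d1 d2 /=.
    by case: (d) => [[|]|] /eqP.
  right; exists (real_half h); first exact: real_half_mem hf nd.
  apply: real_half_mem hf' _ => d d1 d2.
  have [df|] := eqVneq d f.1; first by rewrite df.
  by move=> df; apply: nd.
case/forallPn=> d; rewrite negb_imply => /andP[/andP[d1 d2] ddeg]; left.
have df' : f.1 = f'.1.
  have hdf : h.1 != f.1 by move: hf; case: (f) => [[[|]|] [b c]]; rewrite !inE => /orP[]/eqP->.
  have hdf' : h.1 != f'.1 by move: hf'; case: (f') => [[[|]|] [b c]]; rewrite !inE => /orP[]/eqP->.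
  have d3 : d != f'.1 by apply: contraNneq ddeg => dE; move: n2; rewrite -dE; case: (d) => [[|]|] /= ->.
  by move: d1 d2 d3 hdf hdf'; case: (d) => [[|]|]; case: (f.1) => [[|]|]; case: (f'.1) => [[|]|]; case: (h.1) => [[|]|].
case: f f' df' ff ff' hf hf' n1 n2 d1 => [d0 [b c]] [d0' [b' c']] /= dd; subst d0' => _ _ hf hf' _ _ d1.
rewrite /real_face /=.
have dX0 : d = dX -> X true = X false by move=> dE; move: ddeg; rewrite dE; case: hX => ->; rewrite ?eqxx.
have dY0 : d = dY -> Y true = Y false by move=> dE; move: ddeg; rewrite dE; case: hY => ->; rewrite ?eqxx.
have dZ0 : d = dZ -> Z true = Z false by move=> dE; move: ddeg; rewrite dE; case: hZ => ->; rewrite ?eqxx.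
have allX : d = dX -> forall u v, X u = X v by move=> /dX0 E [] [].
have allY : d = dY -> forall u v, Y u = Y v by move=> /dY0 E [] [].
have allZ : d = dZ -> forall u v, Z u = Z v by move=> /dZ0 E [] [].
clear dX0 dY0 dZ0 ddeg.
case: d0 hf hf' d1 => [[|]|]; rewrite !inE => /orP[]/eqP hE;
  rewrite hE !xpair_eqE /= ?andbF ?orbF /= in d2 * => /eqP ce d1; rewrite -ce.
all: case: d allX allY allZ d1 d2 => [[|]|] // aX aY aZ _ _.
- by rewrite (aX erefl b b').
- by rewrite (aZ erefl c c').
- by rewrite (aX erefl b b').
- by rewrite (aY erefl c c').
- by rewrite (aY erefl b b').
- by rewrite (aZ erefl c c').
Qed.

Lemma block_faces_conn : conn (cell_adj (@mesh_bd g L side)) block_faces.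
Proof.
apply: closed_conn => W WF /set0Pn[m0 m0W] clW.
apply/eqP; rewrite eqEsubset WF /=; apply/subsetP=> m mF.
have [f0 ff0 m0E] := real_aflag (subsetP WF _ m0W); have [f ff mE] := real_aflag mF.
pose Q f := ordc side (real_face f) \in W.
have realK f1 : aflag s f1 -> natc (ordc side (real_face f1)) = real_face f1.
  by move=> /aflag_real[bf _]; rewrite ordcK // (bface_low L_gt0 side_ge).
have step f1 f2 : aflag s f1 -> aflag s f2 -> ashare f1 f2 -> Q f2 -> Q f1.
  move=> fl1 fl2 sh Q2; have [E|[e e1 e2]] := share_real fl1 fl2 sh; first by rewrite /Q E.
  have [b1 [i1 i1']] := aflag_real fl1; have [b2 _] := aflag_real fl2.
  have [E|ne] := eqVneq (ordc side (real_face f2)) (ordc side (real_face f1)); first by rewrite /Q -E.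
  apply: (clW _ _ Q2); first by rewrite inE realK // b1 i1 i1'.
  have lo : low side e.2.
    exact: face_edges_low (bface_low L_gt0 side_ge b1) e1.
  rewrite /cell_adj ne /=; apply/hasP; exists (ordc side e).
    by apply: mem_mesh_bd; rewrite realK // ordcK.
  by apply: mem_mesh_bd; rewrite realK // ordcK.
have sE a b c : s a b c = tab (plan g (cb L (X false)) (cb L (Y false))) (plan g (cb L (X false)) (cb L (Y true)))
    (plan g (cb L (X true)) (cb L (Y false))) (plan g (cb L (X true)) (cb L (Y true))) a b &&
    (if c then cb L (Z true) == 1 else cb L (Z false) == 1).
  by rewrite /s /solid /=; case: a; case: b; case: c.
have flE f1 : aflag s f1 = aflag (fun a b c => tab (plan g (cb L (X false)) (cb L (Y false)))
    (plan g (cb L (X false)) (cb L (Y true))) (plan g (cb L (X true)) (cb L (Y false)))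
    (plan g (cb L (X true)) (cb L (Y true))) a b &&
    (if c then cb L (Z true) == 1 else cb L (Z false) == 1)) f1.
  exact: aflag_ext.
have diag1 : ~~ [&& plan g (cb L (X false)) (cb L (Y false)), plan g (cb L (X true)) (cb L (Y true)),
    ~~ plan g (cb L (X true)) (cb L (Y false)) & ~~ plan g (cb L (X false)) (cb L (Y true))].
  case: hX => ->; first by case: plan; case: plan.
  case: hY => ->; first by case: plan; case: plan.
  by have [] := plan_no_diagonal g L_gt0 (X false) (Y false).
have diag2 : ~~ [&& plan g (cb L (X true)) (cb L (Y false)), plan g (cb L (X false)) (cb L (Y true)),
    ~~ plan g (cb L (X false)) (cb L (Y false)) & ~~ plan g (cb L (X true)) (cb L (Y true))].
  case: hX => ->; first by case: plan; case: plan.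
  case: hY => ->; first by case: plan; case: plan.
  by have [] := plan_no_diagonal g L_gt0 (X false) (Y false).
have := @link_check _ _ _ _ (cb L (Z false) == 1) (cb L (Z true) == 1) diag1 diag2.
rewrite /link_connected => /allP lc.
have {lc}lc := lc f0; rewrite mem_filter mem_afaces andbT -flE in lc.
have := allP (lc ff0) f; rewrite mem_filter mem_afaces andbT -flE => /(_ ff) fcl.
have [||_] := aclosure_ind (Q := Q) _ _ fcl.
- by move=> f1 f2; rewrite -!flE; apply: step.
- by move=> f1; rewrite inE => /eqP->; rewrite -flE ff0; split=> //; rewrite /Q -m0E natcK.
by rewrite /Q -mE natcK.
Qed.

End Link.

(** * From topological embeddings to minors of the mesh *)

From mathcomp Require Import all_classical all_reals all_analysis.
From mathcomp Require Import ring lra.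
Import Order.TTheory GRing.Theory Num.Theory.
Import numFieldNormedType.Exports.

Section Coordinates.
Variable R : realType.

Lemma cont11 : continuous (fun q : space3 R => q.1.1).
Proof. by move=> q; apply: (@continuous_comp _ _ _ fst fst); apply: cvg_fst. Qed.

Lemma cont12 : continuous (fun q : space3 R => q.1.2).
Proof. by move=> q; apply: (@continuous_comp _ _ _ fst snd); [apply: cvg_fst|apply: cvg_snd]. Qed.

Lemma cont2 : continuous (fun q : space3 R => q.2).
Proof. by move=> q; apply: cvg_snd. Qed.

End Coordinates.

(** * The handlebody as a union of closed cubes *)

Section Geometry.
Local Open Scope ring_scope.
Variables (R : realType) (g L side : nat).
Hypotheses (L_gt0 : (0 < L)%N) (side_ge : ((2 * g + 3) * L <= side)%N).

Definition incube (n : nat) (t : R) := n%:R - 1 <= L%:R * t <= n%:R.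

Definition incube3 (p : cell3) (q : space3 R) :=
  [&& incube p.1.1 q.1.1, incube p.1.2 q.1.2 & incube p.2 q.2].

Definition cell_has (f : dir * cell3) (q : space3 R) :=
  [&& bface g L f, incube3 f.2 q & incube3 (succ3 f.1 f.2) q].

Definition cells_at (q : space3 R) :=
  [set m : dir * ('I_side.+1 * 'I_side.+1 * 'I_side.+1) | cell_has (natc m) q]%SET.

Let L0 : (0 : R) < L%:R. Proof. by rewrite ltr0n. Qed.

Lemma blockP (t : R) : 0 <= t -> exists W : bool -> nat,
  (W true = W false \/ W true = (W false).+1) /\ forall n, incube n t = blk W n.
Proof.
move=> t0; have Lt0 : 0 <= L%:R * t by rewrite mulr_ge0 // ltW.
have /andP[] := truncn_itv Lt0; set n := Num.truncn _ => h1 h2.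
have [E|ne] := eqVneq (L%:R * t) n%:R.
  exists (fun b => if b then n.+1 else n); split; [by right|].
  move=> k; rewrite /incube /blk E ler_nat lerBlDr -(natrD _ n 1) ler_nat; lia.
exists (fun=> n.+1); split; first by left.
move=> k; rewrite /incube /blk.
have lt : n%:R < L%:R * t by rewrite lt_neqAle eq_sym ne.
apply/andP/orP=> [[k1 k2]|].
  have : (n < k)%N by rewrite -(ltr_nat R) (lt_le_trans lt).
  have : (k < n.+2)%N.
    by rewrite -(ltr_nat R) -natr1; have := h2; rewrite -!natr1; lra.
  by clear; lia.
by case=> /eqP->; rewrite -natr1 addrK; move: h2; rewrite -natr1; lra.
Qed.

(** The closed slabs are locally finite, so a nearby point lies in no new one; positivity of [t]
    also keeps it nonnegative, as [blockP] demands. *)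
Lemma incube_near (t : R) : 0 < t ->
  \forall t' \near t, 0 <= t' /\ forall n, incube n t' -> incube n t.
Proof.
move=> t0; have Lt0 : 0 <= L%:R * t by rewrite mulr_ge0 // ltW.
have /andP[] := truncn_itv Lt0; set n := Num.truncn _ => h1 h2.
have upper : \forall t' \near t, t' < n.+1%:R / L%:R.
  by apply: lt_nbhsl; rewrite ltr_pdivlMr // mulrC.
have pos : \forall t' \near t, 0 < t' by apply: lt_nbhsr.
have [E|ne] := eqVneq (L%:R * t) n%:R.
  have lower : \forall t' \near t, (n%:R - 1) / L%:R < t'.
    by apply: lt_nbhsr; rewrite ltr_pdivrMr // mulrC E; lra.
  near=> t'.
  have u : L%:R * t' < n.+1%:R by rewrite mulrC -ltr_pdivlMr //; near: t'.
  have l : n%:R - 1 < L%:R * t' by rewrite mulrC -ltr_pdivrMr //; near: t'.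
  split=> [|k /andP[k1 k2]]; first by apply/ltW; near: t'.
  rewrite /incube E; apply/andP; split.
    have : (k < n.+2)%N by rewrite -(ltr_nat R) -!natr1 in u *; lra.
    by rewrite ltnS -(ler_nat R) -natr1; lra.
  rewrite ler_nat -ltnS -(ltr_nat R) -natr1; lra.
have lt : n%:R < L%:R * t by rewrite lt_neqAle eq_sym ne.
have lower : \forall t' \near t, n%:R / L%:R < t'.
  by apply: lt_nbhsr; rewrite ltr_pdivrMr // mulrC.
near=> t'.
have u : L%:R * t' < n.+1%:R by rewrite mulrC -ltr_pdivlMr //; near: t'.
have l : n%:R < L%:R * t' by rewrite mulrC -ltr_pdivrMr //; near: t'.
split=> [|k /andP[k1 k2]]; first by apply/ltW; near: t'.
have : (k < n.+2)%N by rewrite -(ltr_nat R) -!natr1 in u *; lra.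
have : (n < k)%N by rewrite -(ltr_nat R); lra.
move=> nk kn; have -> : k = n.+1 by move: nk kn; clear; lia.
by rewrite /incube -natr1 in h2 *; apply/andP; split; lra.
Unshelve. all: by end_near.
Qed.

Lemma cb_bounds n : (0 < n)%N -> (((cb L n).-1 * L < n) && (n <= cb L n * L))%N.
Proof.
by move=> n0; have [X [i [iL -> ->]]] := cb_blockE L_gt0 n0; rewrite mulSn /=; lia.
Qed.

Lemma incube_coarse n t : (0 < n)%N -> incube n t ->
  (cb L n)%:R - 1 <= t <= (cb L n)%:R.
Proof.
move=> n0 /andP[h1 h2]; have /andP[c1 c2] := cb_bounds n0.
have cb0 : (0 < cb L n)%N by case: (cb L n) c2 => //; lia.
apply/andP; split.
  rewrite -(ler_pM2l L0); apply: le_trans h1; rewrite lerBrDr.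
  have : ((cb L n).-1 * L + 1 <= n)%N by lia.
  have e : (cb L n)%:R = (cb L n).-1%:R + 1 :> R by rewrite natr1 prednK.
  by rewrite -(ler_nat R) natrD natrM e addrK mulrC.
rewrite -(ler_pM2l L0); apply: le_trans h2 _.
by rewrite -natrM ler_nat mulnC.
Qed.

Lemma solid_handlebody p q : solid g L p -> incube3 p q -> handlebody g q.
Proof.
move=> sp /and3P[hx hy hz]; have [px py pz] := solid_pos L_gt0 sp.
have := incube_coarse px hx; have := incube_coarse py hy; have := incube_coarse pz hz.
case/andP: sp => /and3P[/andP[x1 x2] /andP[y1 y2] xy] /eqP->.
move: (cb L p.1.1) (cb L p.1.2) x1 x2 y1 y2 xy => X Y x1 x2 y1 y2 xy.
move=> /andP[z3 z4] /andP[y3 y4] /andP[x3 x4].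
have le1 m (k : nat) : (k <= m)%N -> (k%:R : R) <= m%:R by rewrite ler_nat.
have gx : (X%:R : R) <= (2 * g + 1)%N%:R by rewrite addn1 le1.
have gx1 := le1 _ _ x1; have gy := le1 _ _ y2; have gy1 := le1 _ _ y1.
split; [lra|lra|lra|].
move=> i ig [/andP[h1 h2] /andP[h3 h4]].
have X2 : X = (2 * i + 2)%N.
  have : (2 * i + 1 < X)%N by rewrite -(ltr_nat R); lra.
  have : (X < (2 * i + 2).+1)%N by rewrite -(ltr_nat R) -natr1; lra.
  by clear; lia.
have Y2 : Y = 2%N.
  have : (1 < Y)%N by rewrite -(ltr_nat R); lra.
  have : (Y < 3)%N by rewrite -(ltr_nat R); lra.
  by clear; lia.
by move: xy; rewrite X2 Y2 eqxx orbF oddD oddM.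
Qed.

Lemma coarse_cube (n : nat) (t : R) N : (0 < N)%N -> 0 <= t <= N%:R ->
  exists n, [/\ (0 < n)%N, (cb L n <= N)%N & incube n t].
Proof.
move=> N0 /andP[t0 tN]; have [W [Wor WE]] := blockP t0.
have t1 := WE (W true); rewrite /blk eqxx orbT in t1.
have t2 := WE (W false); rewrite /blk eqxx in t2.
have cbN k : (0 < k)%N -> (k <= N * L)%N -> (cb L k <= N)%N.
  by move=> k0 kN; have /andP[c1 _] := cb_bounds k0; have := leq_trans c1 kN; rewrite ltn_mul2r; lia.
have tL : L%:R * t <= (N * L)%N%:R by rewrite natrM mulrC ler_wpM2r // ltW.
have [big|small] := ltnP (N * L) (W true); last first.
  have [W0|W0] := posnP (W true); last by exists (W true); split=> //; apply: cbN.
  have W1 : incube 1 t.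
    move: t1; rewrite W0 /incube => /andP[h1 h2]; have := mulr_ge0 (ltW L0) t0.
    by move=> h3; apply/andP; split; lra.
  by exists 1%N; split=> //; apply: cbN; rewrite // muln_gt0 N0.
exists (N * L)%N; split; rewrite ?muln_gt0 ?N0 ?cb_mul //.
move: t1 => /andP[h1 h2]; rewrite /incube tL andbT.
move: big; rewrite -(ler_nat R) -natr1; lra.
Qed.

(** The cube first chosen around [q] may lie in a hole. The open hole does not contain [q], so [q]
    is then on its wall, and the cube beyond that wall contains [q] too. *)
Lemma handlebody_solid q : handlebody g q -> exists2 p, solid g L p & incube3 p q.
Proof.
case=> hx hy hz hole.
have [|nx [x0 xN xq]] := @coarse_cube 0 q.1.1 (2 * g + 1) _ hx; first by rewrite addn1.
have [|ny [y0 yN yq]] := @coarse_cube 0 q.1.2 3 _ hy; first by [].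
have [|nz [z0 zN zq]] := @coarse_cube 0 q.2 1 _ hz; first by [].
have cpos n : (0 < n)%N -> (0 < cb L n)%N by move=> n0; have /andP[_] := cb_bounds n0; case: (cb L n) => //; rewrite mul0n leqNgt n0.
have cz : cb L nz == 1%N by move: (cpos _ z0) zN; clear; lia.
have sol a b : (0 < a)%N -> (0 < b)%N -> (cb L a <= 2 * g + 1)%N -> (cb L b <= 3)%N ->
    incube a q.1.1 -> incube b q.1.2 -> odd (cb L a) || (cb L b != 2) ->
    exists2 p, solid g L p & incube3 p q.
  move=> a0 b0 aN bN aq bq ab; exists (a, b, nz); last by rewrite /incube3 aq bq zq.
  by rewrite /solid /plan /= cz ab !cpos //= bN -addn1 aN.
have [good|] := boolP (odd (cb L nx) || (cb L ny != 2)); first exact: sol good.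
rewrite negb_or negbK => /andP[evx /eqP y2].
pose i := (cb L nx)./2.-1.
have xi : cb L nx = (2 * i + 2)%N.
  have := odd_double_half (cb L nx); rewrite (negPf evx) add0n /i -mul2n => E.
  by move: (cpos _ x0) E; clear; lia.
have ig : (i < g)%N by move: xN; rewrite xi; clear; lia.
have /andP[bx1 bx2] := cb_bounds x0; have /andP[by1 by2] := cb_bounds y0.
rewrite xi in bx1 bx2; rewrite y2 in by1 by2.
move: (xq) (yq) => /andP[xq1 xq2] /andP[yq1 yq2].
have nxr1 : (2 * i + 1)%N%:R * L%:R + 1 <= nx%:R :> R.
  by rewrite -natrM natr1 ler_nat; move: bx1; rewrite addn2 addn1.
have nxr2 : nx%:R <= (2 * i + 2)%N%:R * L%:R :> R by rewrite -natrM ler_nat.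
have nyr1 : L%:R + 1 <= ny%:R :> R by rewrite natr1 ler_nat; move: by1; rewrite mul1n.
have nyr2 : ny%:R <= 2%:R * L%:R :> R by rewrite -natrM ler_nat.
have [xl|xl] := leP q.1.1 (2 * i + 1)%N%:R.
  have Lx := ler_wpM2l (ltW L0) xl.
  apply: (sol ((2 * i + 1) * L)%N ny) => //; rewrite ?cb_mul ?muln_gt0 ?addn1 //.
  - by move: ig; clear; lia.
  - rewrite /incube natrM; apply/andP; split; rewrite mulrC in Lx *; lra.
  - by rewrite /= oddM.
have [xr|xr] := leP (2 * i + 2)%N%:R q.1.1.
  have Lx := ler_wpM2l (ltW L0) xr.
  have cE : cb L ((2 * i + 2) * L).+1 = (2 * i + 2).+1.
    by rewrite -[((2 * i + 2) * L).+1]addn1; apply: cb_block.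
  apply: (sol ((2 * i + 2) * L).+1 ny) => //; rewrite ?cE //.
  - by move: xN; rewrite xi; clear; lia.
  - rewrite /incube -natr1 natrM; apply/andP; split; rewrite mulrC in Lx *; lra.
  - by rewrite mul2n addn2 /= odd_double.
have [yl|yl] := leP q.1.2 1.
  have Ly := ler_wpM2l (ltW L0) yl; rewrite mulr1 in Ly.
  have cE : cb L L = 1%N by rewrite -{2}[L]mul1n cb_mul.
  apply: (sol nx L) => //; rewrite ?cE ?orbT //.
  by rewrite /incube; apply/andP; split; lra.
have [yr|yr] := leP 2 q.1.2.
  have Ly := ler_wpM2l (ltW L0) yr.
  have cE : cb L (2 * L).+1 = 3%N.
    by rewrite -[(2 * L).+1]addn1; apply: cb_block.
  apply: (sol nx (2 * L).+1) => //; rewrite ?cE ?orbT //.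
  by rewrite /incube -natr1 natrM; apply/andP; split; lra.
by case: (hole i ig); rewrite xl xr yl yr.
Qed.

Lemma handlebody_ge0 (q : space3 R) : handlebody g q -> [/\ 0 <= q.1.1, 0 <= q.1.2 & 0 <= q.2].
Proof. by case=> /andP[? _] /andP[? _] /andP[? _] _. Qed.

(** If no boundary face contained [q], all cubes around [q] would be solid, since one of them is.
    This forces positive coordinates, and these cubes then cover a neighbourhood of [q], which would
    be an interior point. *)
Lemma surface_cells (q : space3 R) : surface g q -> cells_at q != finset.set0 /\
  conn (cell_adj (@mesh_bd g L side)) (cells_at q).
Proof.
move=> [hq nint]; have [x0 y0 z0] := handlebody_ge0 hq.
have [X [hX XE]] := blockP x0; have [Y [hY YE]] := blockP y0; have [Z [hZ ZE]] := blockP z0.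
have in3 p : incube3 p q = in_block X Y Z p by rewrite /incube3 XE YE ZE.
have cE : cells_at q = block_faces g L side X Y Z.
  by apply/setP=> m; rewrite !inE /cell_has !in3.
rewrite cE; split; last exact: block_faces_conn.
apply/negP=> /eqP F0; case: nint.
have flat f : in_block X Y Z f.2 -> in_block X Y Z (succ3 f.1 f.2) -> 
    solid g L f.2 = solid g L (succ3 f.1 f.2).
  move=> f1 f2; apply/eqP; apply: contraT => bf.
  have lf := bface_low L_gt0 side_ge bf.
  have : ordc side f \in block_faces g L side X Y Z.
    by rewrite inE ordcK // f1 f2 /bface bf.
  by rewrite F0 inE.
have stepX a y z : blk Y y -> blk Z z -> solid g L (X a, y, z) = solid g L (X false, y, z).
  move=> hy hz; case: a => //; case: hX => [->//|Xt]; rewrite Xt.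
  have := flat (dX, (X false, y, z)); rewrite /in_block /= -Xt !blk_bit hy hz.
  by move=> h; rewrite h.
have stepY b x z : blk X x -> blk Z z -> solid g L (x, Y b, z) = solid g L (x, Y false, z).
  move=> hx hz; case: b => //; case: hY => [->//|Yt]; rewrite Yt.
  have := flat (dY, (x, Y false, z)); rewrite /in_block /= -Yt !blk_bit hx hz.
  by move=> h; rewrite h.
have stepZ c x y : blk X x -> blk Y y -> solid g L (x, y, Z c) = solid g L (x, y, Z false).
  move=> hx hy; case: c => //; case: hZ => [->//|Zt]; rewrite Zt.
  have := flat (dZ, (x, y, Z false)); rewrite /in_block /= -Zt !blk_bit hx hy.
  by move=> h; rewrite h.
have const0 p : in_block X Y Z p -> solid g L p = solid g L (X false, Y false, Z false).
  case: p => [[x y] z] /and3P[/= hx hy hz].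
  have [a xa] := bit_blk hx; have [b yb] := bit_blk hy; have [c zc] := bit_blk hz.
  by rewrite xa stepX // yb stepY ?blk_bit // zc stepZ ?blk_bit.
have const p p' : in_block X Y Z p -> in_block X Y Z p' -> solid g L p = solid g L p'.
  by move=> /const0-> /const0->.
have [p0 sp0 ip0] := handlebody_solid hq.
have all_solid p : incube3 p q -> solid g L p.
  by rewrite in3 => ip; rewrite (const p p0) // -in3.
have incube0 : incube 0 0 by rewrite /incube mulr0; apply/andP; split; lra.
have [/and3P[ix iy iz]] := ip0.
have pos (t : R) : 0 <= t -> ~~ incube 0 t -> 0 < t.
  by rewrite le_eqVlt => /orP[/eqP<-|//]; rewrite incube0.
have x1 : 0 < q.1.1.
  apply: pos => //; apply/negP=> i0; have := all_solid (0%N, p0.1.2, p0.2).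
  by rewrite /incube3 /= i0 iy iz => /(_ isT)/(solid_pos L_gt0)[].
have y1 : 0 < q.1.2.
  apply: pos => //; apply/negP=> i0; have := all_solid (p0.1.1, 0%N, p0.2).
  by rewrite /incube3 /= i0 ix iz => /(_ isT)/(solid_pos L_gt0)[].
have z1 : 0 < q.2.
  apply: pos => //; apply/negP=> i0; have := all_solid (p0.1.1, p0.1.2, 0%N).
  by rewrite /incube3 /= i0 ix iy => /(_ isT)/(solid_pos L_gt0)[].
have nx := cont11 (incube_near x1); have ny := cont12 (incube_near y1).
have nz := cont2 (incube_near z1).
rewrite /interior; near=> q'.
have [qx hx] : 0 <= q'.1.1 /\ forall n, incube n q'.1.1 -> incube n q.1.1 by near: q'; exact: nx.
have [qy hy] : 0 <= q'.1.2 /\ forall n, incube n q'.1.2 -> incube n q.1.2 by near: q'; exact: ny.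
have [qz hz] : 0 <= q'.2 /\ forall n, incube n q'.2 -> incube n q.2 by near: q'; exact: nz.
have [X' [_ XE']] := blockP qx; have [Y' [_ YE']] := blockP qy; have [Z' [_ ZE']] := blockP qz.
apply: (@solid_handlebody (X' true, Y' true, Z' true)); last first.
  by rewrite /incube3 /= XE' YE' ZE' !blk_bit.
by apply: all_solid; rewrite /incube3 /= hx ?hy ?hz ?XE' ?YE' ?ZE' ?blk_bit.
Unshelve. all: by end_near.
Qed.

End Geometry.

(** * The faces met by a piece of an arc *)

Section ArcCells.
Local Open Scope ring_scope.
Local Open Scope classical_set_scope.
Variables (R : realType) (g L side : nat).
Hypotheses (L_gt0 : (0 < L)%N) (side_ge : ((2 * g + 3) * L <= side)%N).
Notation space := (space3 R).

Lemma closed_incube n : closed [set t : R | incube L n t].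
Proof.
have -> : [set t : R | incube L n t] = (fun t => L%:R * t) @^-1` `[n%:R - 1, n%:R].
  by apply/seteqP; split=> t /=; rewrite in_itv.
apply: closed_comp => [t _|]; first exact: mulrl_continuous.
exact: itv_closed.
Qed.

Lemma closed_incube3 p : closed [set q : space | incube3 L p q].
Proof.
have -> : [set q : space | incube3 L p q] =
   ((fun q : space => q.1.1) @^-1` [set t | incube L p.1.1 t]) `&`
   (((fun q : space => q.1.2) @^-1` [set t | incube L p.1.2 t]) `&`
   ((fun q : space => q.2) @^-1` [set t | incube L p.2 t])).
  apply/seteqP; split=> q /=; first by case/and3P.
  by move=> [h1 [h2 h3]]; apply/and3P.
apply: closedI; last apply: closedI.
- by apply: closed_comp => [q _|]; [exact: cont11|exact: closed_incube].
- by apply: closed_comp => [q _|]; [exact: cont12|exact: closed_incube].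
- by apply: closed_comp => [q _|]; [exact: cont2|exact: closed_incube].
Qed.

Lemma closed_cell_has f : closed [set q : space | cell_has g L f q].
Proof.
have [bf|bf] := boolP (bface g L f); last first.
  rewrite (_ : mkset _ = set0); first exact: closed0.
  by apply/seteqP; split=> q //=; rewrite /cell_has (negPf bf).
rewrite (_ : mkset _ = [set q | incube3 L f.2 q] `&` [set q | incube3 L (succ3 f.1 f.2) q]).
  by apply: closedI; apply: closed_incube3.
by apply/seteqP; split=> q /=; rewrite /cell_has bf /=; [case/andP|case=> -> ->].
Qed.

Definition arc_cells (a : R -> space) (s1 s2 : R) :=
  [set m : dir * ('I_side.+1 * 'I_side.+1 * 'I_side.+1) |
    `[< exists2 t, s1 <= t <= s2 & cell_has g L (natc m) (a t) >]]%SET.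

(** Let [X] be closed under adjacency. The times spent in faces of [X] and those spent in other
    faces form closed sets covering the interval. They are disjoint, because the faces at one point
    are connected. Connectedness of the interval leaves only the first. *)
Lemma arc_cells_conn (a : R -> space) (s1 s2 : R) : {within `[0, 1], continuous a} ->
  a @` `[0, 1] `<=` surface g -> 0 <= s1 -> s2 <= 1 ->
  conn (cell_adj (@mesh_bd g L side)) (arc_cells a s1 s2).
Proof.
move=> ca aS s10 s21; apply: closed_conn => X XA /finset.set0Pn[m0 m0X] clX.
have in01 t : s1 <= t <= s2 -> `[0, 1] t.
  by move=> /andP[h1 h2]; rewrite /= in_itv /=; apply/andP; split; lra.
have surf t : s1 <= t <= s2 -> surface g (a t).
  by move=> ht; apply: aS; exists t => //; apply: in01.
have memA m t : s1 <= t <= s2 -> cell_has g L (natc m) (a t) -> m \in arc_cells a s1 s2.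
  by move=> ht mt; rewrite inE; apply/asboolP; exists t.
pose B (Y : {set dir * ('I_side.+1 * 'I_side.+1 * 'I_side.+1)}) :=
  [set t : R | s1 <= t <= s2 /\ exists2 m, m \in Y & cell_has g L (natc m) (a t)].
have closedB Y : closed (B Y).
  have -> : B Y = \bigcup_(m in [set m | m \in Y])
      ([set t : R | s1 <= t <= s2] `&` [set t | cell_has g L (natc m) (a t)]).
    apply/seteqP; split=> t /=; first by move=> [ht [m mY mt]]; exists m.
    by move=> [m /= mY [ht mt]]; split=> //; exists m.
  apply: closed_bigcup; first exact: finite_finset.
  move=> m _.
  have : closed ((a : subspace `[0, 1] -> space) @^-1` [set q | cell_has g L (natc m) q]).
    by have /continuous_closedP := ca; apply; apply: closed_cell_has.
  move=> /closed_subspaceP[V cV VE].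
  have -> : [set t : R | s1 <= t <= s2] `&` [set t | cell_has g L (natc m) (a t)] =
      `[s1, s2] `&` V.
    apply/seteqP; split=> t /=.
      move=> [ht mt]; rewrite in_itv /= ht; split=> //.
      have : ((a : subspace `[0, 1] -> space) @^-1` [set q | cell_has g L (natc m) q] `&` `[0, 1]) t.
        by split=> //=; apply: in01.
      by rewrite -VE => -[].
    rewrite in_itv /= => -[ht Vt]; split=> //.
    have : (V `&` `[0, 1]) t by split=> //=; apply: in01.
    by rewrite VE => -[].
  by apply: closedI => //; apply: itv_closed.
have full : B X = `[s1, s2].
  apply: segment_connected.
  - have := fintype.subsetP XA _ m0X; rewrite inE => /asboolP[t ht mt].
    by exists t; split=> //; exists m0.
  - exists (~` B (~: X)%SET); first by apply: closed_openC; apply: closedB.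
    apply/seteqP; split=> t /=.
      move=> [ht [m mX mt]]; rewrite in_itv /= ht; split=> // -[_ [m' m'X m't]].
      have [_ ct] := surface_cells L_gt0 side_ge (surf t ht).
      suff : m' \in X by move: m'X; rewrite inE => /negP.
      apply: (fintype.subsetP (conn_absorb ct (x := m) _ mX _)); rewrite ?inE //.
      by move=> y z yX _; rewrite inE => zt; apply: clX => //; apply: memA zt.
    rewrite in_itv /= => -[ht nB].
    have [c0 _] := surface_cells L_gt0 side_ge (surf t ht).
    have /finset.set0Pn[m] := c0; rewrite inE => mt.
    have [mX|mX] := boolP (m \in X); first by split=> //; exists m.
    by case: nB; split=> //; exists m; rewrite // inE.
  - exists (B X) => //; apply/seteqP; split=> t /=; last by case.
    by move=> [ht h]; split=> //; rewrite in_itv.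
apply/eqP; rewrite finset.eqEsubset XA /=; apply/fintype.subsetP=> m; rewrite inE => /asboolP[t ht mt].
have : B X t by rewrite full /= in_itv.
move=> [_ [m' m'X m't]].
have [_ ct] := surface_cells L_gt0 side_ge (surf t ht).
apply: (fintype.subsetP (conn_absorb ct (x := m') _ m'X _)); rewrite ?inE //.
by move=> y z yX _; rewrite inE => zt; apply: clX => //; apply: memA zt.
Qed.

End ArcCells.

(** * Choice of the mesh size by compactness *)

Section Separation.
Local Open Scope ring_scope.
Local Open Scope classical_set_scope.
Variable R : realType.
Notation space := (space3 R).

Lemma compact_disjoint_sep (K1 K2 : set space) : compact K1 -> compact K2 ->
  K1 `&` K2 = set0 -> exists2 d : R, 0 < d & forall q q', K1 q -> K2 q' -> ~ ball q' d q.
Proof.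
move=> cK1 cK2 dis.
have hs : hausdorff_space space by apply: norm_hausdorff.
have clK1 : closed K1 := compact_closed hs cK1.
have /compact_near_coveringP cov := cK2.
have sep : \forall d \near 0^'+, K2 `<=` (fun q' => forall q, K1 q -> ~ ball q' d q).
  apply: (cov R (0^'+) (fun d q' => forall q, K1 q -> ~ ball q' d q)) => q' K2q'.
  have nK1 : nbhs q' (~` K1).
    apply: open_nbhs_nbhs; split; first exact: closed_openC.
    by move=> K1q'; have : (K1 `&` K2) q' by []; rewrite dis.
  have /nbhs_ballP[e e0 eK] := nK1.
  exists (ball q' (e / 2), [set d : R | d < e / 2]) => /=.
    split; first by apply: nbhsx_ballx; rewrite divr_gt0.
    by apply: nbhs_right_lt; rewrite divr_gt0.
  move=> [x d] /= [bx de] q K1q bq.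
  apply: (eK q) => //.
  have -> : e = e / 2 + e / 2 by rewrite -splitr.
  apply: ball_triangle bx _; apply: le_ball bq; exact: ltW.
have [d [d0 hd]] := filter_ex (filterI (nbhs_right_gt (0 : R)) sep).
by exists d => // q q' K1q K2q'; apply: hd.
Qed.

(** Two disjoint compact sets have a positive distance d, and a face of a mesh with L > 1/d is too
    small to meet both. One L serves the finitely many pairs. *)
Lemma fine_mesh (g : nat) (I : finType) (K : I -> set space) :
  (forall i, compact (K i)) -> exists L : nat, (0 < L)%N /\
  forall i j f q q', K i q -> K j q' -> cell_has g L f q -> cell_has g L f q' ->
    exists q0, K i q0 /\ K j q0.
Proof.
move=> cK.
have /fin_all_exists[N NP] : forall ij : I * I, exists N, forall L : nat, (N < L)%N ->
    forall f q q', K ij.1 q -> K ij.2 q' -> cell_has g L f q -> cell_has g L f q' ->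
    exists q0, K ij.1 q0 /\ K ij.2 q0.
  move=> [i j] /=.
  have [[q0 [q1 q2]]|dis] := pselect (exists q0, K i q0 /\ K j q0); first by exists 0%N => *; exists q0.
  have [|d d0 sep] := compact_disjoint_sep (cK i) (cK j).
    by apply/seteqP; split=> // q [q1 q2]; apply: dis; exists q.
  exists (Num.truncn d^-1).+1 => L Ld f q q' Kq Kq' /and3P[_ hq _] /and3P[_ hq' _].
  exfalso; apply: (sep q q' Kq Kq').
  have L0 : (0 : R) < L%:R by rewrite ltr0n; apply: leq_ltn_trans Ld.
  have dL : 1 < L%:R * d.
    rewrite -ltr_pdivrMr // div1r; apply: lt_trans (truncnS_gt _) _.
    by rewrite ltr_nat.
  have close n (t t' : R) : incube L n t -> incube L n t' -> ball t' d t.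
    move=> /andP[h1 h2] /andP[h3 h4]; rewrite /ball /= -(ltr_pM2l L0).
    apply: le_lt_trans dL; rewrite -[X in X * _](gtr0_norm L0) -normrM ler_norml.
    by rewrite mulrBr; apply/andP; split; lra.
  case/and3P: hq => q1 q2 q3; case/and3P: hq' => q1' q2' q3'.
  by split; [split; [apply: close q1 q1'|apply: close q2 q2']|apply: close q3 q3'].
exists (\max_ij N ij).+1; split=> // i j; apply: (NP (i, j)).
by rewrite ltnS; apply: (leq_bigmax (i, j)).
Qed.

End Separation.

(** * A minor model from vertex stars and linking sets *)

Section LinkModel.
Variables (M I G : finType) (e : rel M) (eG : rel G) (ends : I -> G * G).
Variables (B : G -> {set M}) (D : I -> {set M}).
Hypotheses (e_sym : symmetric e)
  (B0 : forall v, B v != finset.set0) (Bc : forall v, conn e (B v))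
  (Bd : forall u v x, x \in B u -> x \in B v -> u = v)
  (Dc : forall i, conn e (D i))
  (Dl : forall i, exists2 x, x \in D i & x \in B (ends i).1)
  (Dr : forall i, exists2 x, x \in D i & x \in B (ends i).2)
  (Dd : forall i j x, x \in D i -> x \in D j -> i = j)
  (DB : forall i w x, x \in D i -> x \in B w -> w = (ends i).1 \/ w = (ends i).2)
  (ends_neq : forall i, (ends i).1 != (ends i).2)
  (ends_adj : forall u v, eG u v -> exists i, ends i = (u, v) \/ ends i = (v, u)).

Let S i := D i :\: B (ends i).2.

Let C i := [set y | [exists x, [&& x \in D i, x \in B (ends i).1 & y \in component e (S i) x]]]%SET.

Let U v := (B v :|: \bigcup_(i | (ends i).1 == v) C i)%SET.

Let CP i y : y \in C i -> exists x, [/\ x \in D i, x \in B (ends i).1 & y \in component e (S i) x].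
Proof. by rewrite inE => /existsP[x /and3P[]]; exists x. Qed.

Let CS i y : y \in C i -> y \in D i /\ y \notin B (ends i).2.
Proof. by case/CP=> x [_ _ /(fintype.subsetP (comp_sub _ _ _))]; rewrite inE => /andP[]. Qed.

Let UP v y : y \in U v -> y \in B v \/ exists2 i, (ends i).1 = v & y \in C i.
Proof.
rewrite inE => /orP[|/finset.bigcupP[i /eqP iv yi]]; first by left.
by right; exists i.
Qed.

Let BU v y : y \in B v -> y \in U v. Proof. by rewrite inE => ->. Qed.

Let CU i y : y \in C i -> y \in U (ends i).1.
Proof. by move=> yi; rewrite inE; apply/orP; right; apply/finset.bigcupP; exists i. Qed.

Let compC i x y : x \in D i -> x \in B (ends i).1 -> y \in component e (S i) x -> y \in C i.
Proof. by move=> xD xB yx; rewrite inE; apply/existsP; exists x; rewrite xD xB. Qed.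

Let startS i x : x \in D i -> x \in B (ends i).1 -> x \in S i.
Proof.
move=> xD xB; rewrite inE xD andbT; apply/negP=> xB'.
by have := ends_neq i; rewrite (Bd xB xB') eqxx.
Qed.

(* The part D i of an arc runs from B (ends i).1 to B (ends i).2; the first end
   takes over the pieces of D i that it reaches before the second end. *)
Lemma link_model : exists W : G -> {set M}, minor_model eG e W.
Proof.
exists U; split=> [v|v|u v uv|u v].
- by have /finset.set0Pn[x xB] := B0 v; apply/finset.set0Pn; exists x; apply: BU.
- apply: closed_conn => X XU /finset.set0Pn[z zX] clX.
  have back i x y : (ends i).1 = v -> x \in D i -> x \in B v -> y \in component e (S i) x ->
      forall y', y' \in component e (S i) x -> y \in X -> y' \in X.
    move=> iv xD xB yx y' yx' yX; rewrite -iv in xB.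
    apply: (fintype.subsetP (conn_absorb (comp_conn e_sym (A := S i) (x := x)) yx yX _) _ yx').
    move=> s t sX sx tx st; apply: clX sX _ st; rewrite -iv; apply: CU; exact: compC tx.
  have [x xB xX] : exists2 x, x \in B v & x \in X.
    have [zB|[i iv zi]] := UP (fintype.subsetP XU _ zX); first by exists z.
    have [x [xD xB zx]] := CP zi; rewrite iv in xB; exists x => //.
    by apply: (back i x z iv xD xB zx) => //; apply/comp_refl/startS; rewrite ?iv.
  have BX : B v \subset X.
    by apply: (conn_absorb (@Bc v) xB xX) => s t sX _ tB; apply: clX => //; apply: BU.
  apply/eqP; rewrite finset.eqEsubset XU /=; apply/fintype.subsetP=> y.
  case/UP=> [yB|[i iv yi]]; first exact: (fintype.subsetP BX).
  have [x' [xD xB' yx]] := CP yi; rewrite iv in xB'.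
  have xx : x' \in component e (S i) x' by apply/comp_refl/startS; rewrite ?iv.
  exact: (back i x' x' iv xD xB' xx y yx (fintype.subsetP BX _ xB')).
- apply/pred0P=> x /=; apply/negP=> /andP[/UP xu /UP xv]; move/eqP: uv; case.
  case: xu xv => [xu|[i <- xi]] [xv|[j <- xj]].
  + exact: Bd xu xv.
  + have [xD xB] := CS xj; have [//|uE] := DB xD xu.
    by rewrite -uE xu in xB.
  + have [xD xB] := CS xi; have [//|vE] := DB xD xv.
    by rewrite -vE xv in xB.
  + have [xD _] := CS xi; have [xD' _] := CS xj.
    by rewrite (Dd xD xD').
have main i : exists x y, [/\ x \in U (ends i).1, y \in U (ends i).2 & e x y].
  have [x xD xB] := Dl i; have [y yD yB] := Dr i.
  have [/existsP[z /andP[zx /existsP[w /and3P[wD wB zw]]]]|noE] := boolP [exists z,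
      (z \in component e (S i) x) && [exists w, [&& w \in D i, w \in B (ends i).2 & e z w]]].
    by exists z, w; split=> //; [apply/CU; apply: compC zx|apply: BU].
  have SD : component e (S i) x \subset D i.
    by apply: fintype.subset_trans (comp_sub _ _ _) _; apply: finset.subsetDl.
  have sE : component e (S i) x = D i.
    apply: (conn_closed (@Dc i) SD).
      by apply/finset.set0Pn; exists x; apply/comp_refl/startS.
    move=> z w zx wD zw; apply: (comp_closed zx _ zw); rewrite inE wD andbT.
    apply/negP=> wB; move/negP: noE; apply; apply/existsP; exists z; rewrite zx /=.
    by apply/existsP; exists w; rewrite wD wB zw.
  have := yD; rewrite -sE => /(fintype.subsetP (comp_sub _ _ _)).
  by rewrite inE yB.
move=> /ends_adj[i [iE|iE]]; have [x [y [xu yv xy]]] := main i; rewrite iE in xu yv.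
  by exists x, y.
by exists y, x; rewrite e_sym.
Qed.

End LinkModel.

(** * The minor of the mesh given by an embedding *)

Section Embedded.
Local Open Scope ring_scope.
Local Open Scope classical_set_scope.
Variables (R : realType) (g : nat) (G : sgraph).
Notation space := (space3 R).
Variables (p : G -> space) (a : {set G} -> R -> space).
Hypothesis emb : embedding (surface g) p a.
Notation edge := {e : {set G} | e \in edges G}.

Lemma edge_ends : exists ends : edge -> G * G, forall e : edge,
  [/\ a (val e) 0 = p (ends e).1, a (val e) 1 = p (ends e).2,
      val e = [set (ends e).1; (ends e).2]%SET & (ends e).1 != (ends e).2].
Proof.
apply: (@fin_all_exists _ (fun _ => (G * G)%type) (fun e q =>
  [/\ a (val e) 0 = p q.1, a (val e) 1 = p q.2, val e = [set q.1; q.2]%SET & q.1 != q.2])).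
move=> [e eE] /=; have [_ arcs _ _] := emb; have [_ inj _ ends] := arcs e eE.
have end_of t : (t = 0 \/ t = 1) -> exists2 v, v \in e & a e t = p v.
  move=> t01; have : (a e @` [set 0; 1]) (a e t) by exists t.
  by rewrite ends => -[v ve <-]; exists v.
have [u ue au] := end_of 0 (or_introl erefl); have [v ve av] := end_of 1 (or_intror erefl).
have uv : u != v.
  apply/eqP => uv; have : a e 0 = a e 1 by rewrite au av uv.
  move/inj; rewrite !in_itv /= !lexx !ler01 => /(_ isT isT)/eqP.
  by rewrite eq_sym oner_eq0.
exists (u, v); split=> //=; apply/eqP; rewrite eq_sym finset.eqEcard.
apply/andP; split; first by apply/fintype.subsetP=> w; rewrite !inE => /orP[]/eqP->.
rewrite finset.cards2 uv; have /imsetP[[x y] _ ->] := eE.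
by rewrite finset.cards2; case: (_ != _).
Qed.

(** Each arc is cut into thirds. The outer thirds join the stars [B v] of their end vertices, and
    the middle third is the link [D e]. Stars of distinct vertices are disjoint, as are distinct
    links, and a link meets only the stars of its own ends. On a fine mesh these properties pass to
    the sets of faces, as [link_model] requires. *)
Lemma embedded_minor : exists L : nat, (0 < L)%N /\
  exists U, minor_model (@adj G) (cell_adj (@mesh_bd g L ((2 * g + 3) * L))) U.
Proof.
have lt12 : (3^-1 : R) < 2 / 3 by lra.
have r1 : 0 <= (3^-1 : R) <= 1 by lra.
have r2 : 0 <= (2 / 3 : R) <= 1 by lra.
have r01 : (0 : R) <= 0 / 3 by lra.
have r33 : (3 / 3 : R) = 1 by lra.
have [[p_inj pS] arcs a_p a_a] := emb.
have [ends endsP] := edge_ends.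
pose o0 : 'I_3 := @Ordinal 3 0 isT; pose o1 : 'I_3 := @Ordinal 3 1 isT.
pose o2 : 'I_3 := @Ordinal 3 2 isT.
pose third (i : 'I_3) : set R := `[i%:R / 3, i.+1%:R / 3].
pose K (x : G + edge * 'I_3) : set space := match x with
  | inl v => [set p v] | inr (e, i) => a (val e) @` third i end.
have third_le (i : 'I_3) : 0 <= i%:R / 3 :> R /\ i.+1%:R / 3 <= 1 :> R.
  by rewrite divr_ge0 ?ler0n // ler_pdivrMr // mul1r ler_nat.
have third01 (i : 'I_3) t : third i t -> 0 <= t <= 1.
  rewrite /third /= in_itv /= => /andP[h1 h2]; have [h3 h4] := third_le i.
  by rewrite (le_trans h3 h1) (le_trans h2 h4).
have cK x : compact (K x).
  case: x => [v|[e i]] /=; first exact: compact_set1.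
  apply: continuous_compact; last exact: segment_compact.
  have sub : third i `<=` `[0, 1] by move=> t /third01 ht; rewrite /= in_itv.
  by apply: continuous_subspaceW sub _; have [] := arcs _ (valP e).
have [L [L0 fine]] := fine_mesh g cK.
exists L; split=> //; set side := ((2 * g + 3) * L)%N.
have side_ge : ((2 * g + 3) * L <= side)%N by [].
pose cell := (dir * ('I_side.+1 * 'I_side.+1 * 'I_side.+1))%type.
pose Cp (x : G + edge * 'I_3) : {set cell} := match x with
  | inl v => cells_at g L side (p v)
  | inr (e, i) => arc_cells g L side (a (val e)) (i%:R / 3) (i.+1%:R / 3) end.
have arcS (e : edge) : a (val e) @` `[0, 1] `<=` surface g by have [] := arcs _ (valP e).
have CpK x m : m \in Cp x -> exists2 q, K x q & cell_has g L (natc m) q.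
  case: x => [v|[e i]] /=; rewrite inE; first by exists (p v).
  by move=> /asboolP[t ht mt]; exists (a (val e) t) => //; exists t; rewrite // /third /= in_itv.
have Cp_arc (e : edge) (i : 'I_3) t m : i%:R / 3 <= t <= i.+1%:R / 3 ->
    cell_has g L (natc m) (a (val e) t) -> m \in Cp (inr (e, i)).
  by move=> ht mt; rewrite inE; apply/asboolP; exists t.
have Cp_conn x : conn (cell_adj (@mesh_bd g L side)) (Cp x).
  case: x => [v|[e i]] /=; first by have [_] := surface_cells L0 side_ge (pS v).
  have [h3 h4] := third_le i; have [ca _ _ _] := arcs _ (valP e).
  by apply: arc_cells_conn => //; apply: (arcS e).
pose at_v v (x : G + edge * 'I_3) := match x with
  | inl w => w == v
  | inr (e, i) => ((i == o0) && ((ends e).1 == v)) || ((i == o2) && ((ends e).2 == v)) end.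
pose B v := (\bigcup_(x | at_v v x) Cp x)%SET.
pose D e := Cp (inr (e, o1)).
(* The topological star of [v] before meshing; injectivity of the embedding makes the stars
   disjoint. *)
pose nearv v q := q = p v \/ exists (e : edge) t, [/\ 0 < t < 1, q = a (val e) t &
  (t <= 3^-1 /\ (ends e).1 = v) \/ (2 / 3 <= t /\ (ends e).2 = v)].
have at_near v x q : at_v v x -> K x q -> nearv v q.
  case: x => [w|[e i]] /=; first by move=> /eqP-> ->; left.
  have [ae0 ae1 _ _] := endsP e.
  case/orP=> /andP[/eqP-> /eqP ev] [t + <-]; rewrite /third /= in_itv /= => /andP[t1 t2].
    rewrite mul0r in t1; rewrite div1r in t2.
    have [t0|tn0] := eqVneq t 0; first by left; rewrite t0 ae0 ev.
    right; exists e, t; split=> //; last by left.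
    by rewrite lt_neqAle eq_sym tn0 t1 /=; lra.
  have [t0|tn0] := eqVneq t 1; first by left; rewrite t0 ae1 ev.
  right; exists e, t; split=> //; last by right.
  by rewrite [t < 1]lt_neqAle tn0 /=; apply/andP; split; lra.
have mid e q : K (inr (e, o1)) q -> exists t, [/\ 0 < t < 1, q = a (val e) t & 3^-1 <= t <= 2 / 3].
  move=> /= [t + <-]; rewrite /third /= in_itv /= div1r => /andP[t1 t2].
  by exists t; split=> //; apply/andP; split; lra.
have a_eq (e f : edge) s t : 0 < s < 1 -> 0 < t < 1 -> a (val e) s = a (val f) t -> e = f /\ s = t.
  move=> s01 t01 E; have ef : e = f.
    apply/eqP; apply: contraT => ef; have := a_a (val e) (val f) s t (valP e) (valP f) ef.
    by rewrite !in_itv /= s01 t01 E eqxx => /(_ isT isT).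
  subst f; split=> //; have [_ inj _ _] := arcs _ (valP e); apply: inj => //;
    by rewrite in_itv /=; lra.
have a_pv (e : edge) v t : 0 < t < 1 -> a (val e) t <> p v.
  move=> t01 E; have := a_p (val e) v t (valP e); rewrite in_itv /= t01 E eqxx.
  by move=> /(_ isT).
have near_inj u v q : nearv u q -> nearv v q -> u = v.
  case=> [->|[e [s [s01 -> hs]]]] [E|[f [t [t01 E ht]]]].
  - exact: p_inj.
  - by case: (a_pv f u t t01).
  - by case: (a_pv e v s s01).
  have [ef st] := a_eq _ _ _ _ s01 t01 E; subst f t.
  by case: hs ht => -[h1 <-] [] [h2 <-] //; exfalso;
    by [have := le_trans h2 h1; rewrite leNgt lt12|have := le_trans h1 h2; rewrite leNgt lt12].
have Bnear v m : m \in B v -> exists x, m \in Cp x /\ at_v v x.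
  by case/finset.bigcupP=> x xv mx; exists x.
have meet x y m : m \in Cp x -> m \in Cp y -> exists q, K x q /\ K y q.
  by move=> /CpK[q Kq mq] /CpK[q' Kq' mq']; apply: fine Kq Kq' mq mq'.
apply: (@link_model _ _ _ (cell_adj (@mesh_bd g L side)) (@adj G) ends B D).
- exact: cell_adj_sym.
- move=> v; have [/finset.set0Pn[m mv] _] := surface_cells L0 side_ge (pS v).
  by apply/finset.set0Pn; exists m; apply/finset.bigcupP; exists (inl v) => /=.
- move=> v; have [/finset.set0Pn[m0 m0v] _] := surface_cells L0 side_ge (pS v).
  have m0x x : at_v v x -> m0 \in Cp x.
    move: m0v; rewrite inE; case: x => [w|[e i]] /= m0v; first by move=> /eqP->; rewrite inE.
    have [ae0 ae1 _ _] := endsP e.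
    case/orP=> /andP[/eqP-> /eqP ev].
      by apply: (Cp_arc e o0 0); rewrite ?ae0 ?ev // mul0r lexx divr_ge0.
    by apply: (Cp_arc e o2 1); rewrite ?ae1 ?ev // divff // lexx ler_pdivrMr // mul1r ler_nat.
  apply: closed_conn => X XB /finset.set0Pn[z zX] clX.
  have spread x y : at_v v x -> y \in Cp x -> y \in X -> Cp x \subset X.
    move=> xv yx yX; apply: (conn_absorb (@Cp_conn x) yx yX) => s t sX _ tx.
    by apply: clX => //; apply/finset.bigcupP; exists x.
  have /finset.bigcupP[x xv zx] := fintype.subsetP XB _ zX.
  have m0X := fintype.subsetP (spread x z xv zx zX) _ (m0x x xv).
  apply/eqP; rewrite finset.eqEsubset XB /=; apply/finset.bigcupsP=> y yv.
  exact: spread yv (m0x y yv) m0X.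
- move=> u v m /Bnear[x [mx xu]] /Bnear[y [my yv]].
  have [q [Kx Ky]] := meet _ _ _ mx my.
  exact: near_inj (at_near _ _ _ xu Kx) (at_near _ _ _ yv Ky).
- by move=> e; apply: Cp_conn.
- move=> e; have [|/finset.set0Pn[m mt] _] := surface_cells L0 side_ge (q := a (val e) 3^-1).
    by apply: (arcS e); exists 3^-1 => //; rewrite /= in_itv.
  rewrite inE in mt; exists m; first by apply: Cp_arc mt; rewrite div1r lexx ltW.
  apply/finset.bigcupP; exists (inr (e, o0)); first by rewrite /= !eqxx.
  by apply: Cp_arc mt; rewrite div1r mul0r lexx andbT; case/andP: r1.
- move=> e; have [|/finset.set0Pn[m mt] _] := surface_cells L0 side_ge (q := a (val e) (2 / 3)).
    by apply: (arcS e); exists (2 / 3) => //; rewrite /= in_itv.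
  rewrite inE in mt; exists m; first by apply: Cp_arc mt; rewrite div1r lexx ltW.
  apply/finset.bigcupP; exists (inr (e, o2)); first by rewrite /= !eqxx.
  by apply: Cp_arc mt; rewrite r33 lexx; case/andP: r2.
- move=> e f m me mf; have [q [/mid[s [s01 -> _]] /mid[t [t01 E _]]]] := meet _ _ _ me mf.
  by have [] := a_eq _ _ _ _ s01 t01 E.
- move=> e w m me /Bnear[x [mx xw]]; have [q [/mid[s [s01 qs _]] Kx]] := meet _ _ _ me mx.
  have [qw|[f [t [t01 qt ht]]]] := at_near _ _ _ xw Kx.
    by case: (a_pv e w s s01); rewrite -qs.
  have [ef _] := a_eq _ _ _ _ s01 t01 (etrans (esym qs) qt); subst f.
  by case: ht => -[_ <-]; [left|right].
- by move=> e; have [] := endsP e.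
move=> u v uv.
have eE : [set u; v]%SET \in edges G by apply/imsetP; exists (u, v).
pose e0 : edge := exist _ [set u; v]%SET eE.
exists e0; have [_ _ /= sE ne] := endsP e0.
move: sE ne; case: (ends e0) => x y /= /setP sE ne.
have := sE x; have := sE y; rewrite !inE !eqxx orbT /=.
move=> /orP[]/eqP ye /orP[]/eqP xe; rewrite xe ye in ne *.
- by rewrite eqxx in ne.
- by right.
- by left.
- by rewrite eqxx in ne.
Qed.

End Embedded.

(** * The size bound *)

Lemma ex_sqrt (m : nat) : 0 < m -> exists K, [/\ 0 < K, m <= K * K & K * K <= 4 * m].
Proof.
move=> m0; have ex : exists K, m <= K * K by exists m; rewrite leq_pmulr.
case: (ex_minnP ex) => -[|[|K]] mK minK; first by rewrite muln0 leqNgt m0 in mK.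
  by exists 1; split=> //; rewrite muln1 muln_gt0.
exists K.+2; split=> //.
have : K.+1 * K.+1 < m by rewrite ltnNge; apply/negP=> /minK; rewrite ltnn.
by clear; nia.
Qed.

Lemma card_oedges (G : finType) (eG : rel G) : #|oedges eG| <= #|G| * #|G|.
Proof. by rewrite -card_prod max_card. Qed.

Lemma card_oedges_complete h : h * h - h <= 2 * #|oedges (fun i j : 'I_h => i != j)|.
Proof.
set O := oedges _; pose sw (q : 'I_h * 'I_h) := (q.2, q.1).
have sub : ~: [set (i, i) | i : 'I_h]%SET \subset O :|: sw @: O.
  apply/fintype.subsetP=> -[i j]; rewrite !inE /= => nij.
  have ij : i != j by apply: contra nij => /eqP->; apply: imset_f.
  have [lt|lt|/ord_inj/enum_rank_inj/eqP] := ltngtP (enum_rank i) (enum_rank j).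
  - by rewrite ij.
  - by apply/orP; right; apply/imsetP; exists (j, i); rewrite // inE /= eq_sym ij lt.
  - by rewrite (negPf ij).
have := subset_leq_card sub; have := cardsC [set (i, i) | i : 'I_h]%SET.
rewrite card_imset; last by move=> i j [].
rewrite card_prod !card_ord; have := leq_cardsU O (sw @: O); have := leq_imset_card sw O.
by clear; lia.
Qed.

(** A complete graph on 30 s vertices has 450 s^2 - 15 s edges, more than the 3 (30 s + 72 s^2) = 90
    s + 216 s^2 allowed by [mesh_minor_bound]. *)
Lemma no_large_clique (g L side : nat) (H : finType) (eH : rel H) W s
    (U : 'I_(30 * s) -> {set H}) : 0 < L -> (2 * g + 3) * L <= side -> g.+1 <= s * s ->
  minor_model eH (cell_adj (@mesh_bd g L side)) W ->
  ~ minor_model (fun i j => i != j) eH U.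
Proof.
move=> L0 sL gs mW mU.
have irr : irreflexive (fun i j : 'I_(30 * s) => i != j) by move=> i; rewrite eqxx.
have := mesh_minor_bound L0 sL irr (minor_model_trans (@cell_adj_sym _ _ _) mU mW).
rewrite card_ord => bound; have := card_oedges_complete (30 * s).
have s0 : 0 < s by case: s gs {U mU irr bound}.
by move: bound gs s0; move: #|_|; clear; nia.
Qed.

(** [kappa] is 32 * 30 * s * K with K^2 at most 4 * 30 * s, and k (4 k + 1) <= 5 k^2; this explains
    all factors except 40 * 2. There 40 comes from [minorfree_rep] and 2 from rounding the number of
    vertices up to a power of 2. *)
Definition size_const : nat := 40 * 2 * (20 * (32 * 32) * (30 * 30 * 30)).

Lemma kappa_bound s K : 0 < s -> 0 < K -> K * K <= 4 * (30 * s) ->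
  40 * (kappa (30 * s) K 4 * (4 * kappa (30 * s) K 4 + 1)) * 2 <= size_const * (s * s * s).
Proof.
move=> s0 K0 K4; rewrite /kappa /size_const.
set k := 8 * (4 * (30 * s * K)).
have k1 : 0 < k by rewrite /k !muln_gt0 s0 K0.
have kk : k * k <= 32 * 32 * (30 * 30) * (s * s) * (4 * (30 * s)).
  have -> : k * k = 32 * 32 * (30 * 30) * (s * s) * (K * K) by rewrite /k; lia.
  by rewrite leq_mul2l K4 orbT.
have : k * (4 * k + 1) <= 5 * (k * k) by move: k1; clearbody k; clear; nia.
by move: kk; move: (k * (4 * k + 1)) (k * k); clear; lia.
Qed.

Lemma embedded_rep (R : realType) (g : nat) (G : sgraph) : 2 <= #|G| ->
  embeddable G (surface (R := R) g) ->
  exists (B : G -> {fset voxel}) (s N a : nat),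
    [/\ voxel_representation B,
        rep_size B <= 33 * N + size_const * (s * s * s) * (N * a),
        [/\ 0 < s, s * s <= 4 * g.+1 & N <= 439 * (s * #|G|)] & 2 ^ a <= #|G| ^ 5].
Proof.
move=> n2 [p [arc emb]]; have [L [L0 [U mU]]] := embedded_minor emb.
set side := (2 * g + 3) * L in U mU; have sL : (2 * g + 3) * L <= side by [].
have mbound := mesh_minor_bound L0 sL (@adj_irrefl G) mU.
have m2 := @card_oedges G (@adj G).
have [H [eH [f [unf cH]]]] := degree_reduction (@cell_adj_sym _ _ _) (@cell_adj_irr _ _ _)
  (@adj_sym G) (@adj_irrefl G) (@mesh_degree g L side L0) mU.
have [[symH irrH degH] f_surj f_conn f_adj [W mW]] := unf.
pose Hs := SGraph symH irrH.
have cGH : #|G| <= #|H|.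
  have /fin_all_exists[r rP] := f_surj.
  by apply: (leq_card r); apply: can_inj rP.
have [s [s0 gs s4]] := ex_sqrt (ltn0Sn g).
have s30 : 0 < 30 * s by rewrite muln_gt0.
have [K [K0 hK K4]] := ex_sqrt s30.
have H1 : 1 < #|H| by apply: leq_trans cGH.
have /andP[a1 a2] := up_log_bounds (isT : 1 < 2) H1; set a := up_log 2 #|H| in a1 a2.
have a3 : 2 ^ a <= 2 * #|H|.
  case: (a) a1 => [|b]; first by rewrite expn0; move: H1; clear; lia.
  by rewrite expnS /= => /ltnW b1; rewrite leq_mul2l.
have [B [repB szB]] := @minorfree_rep Hs (30 * s) K 4 a K0 hK a2 degH
  (fun U' => no_large_clique L0 sL gs mW).
have [B' [repB' szB']] := @quotient_rep G Hs f B repB f_surj f_conn f_adj.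
exists B', s, #|H|, a; split=> //.
(* With degree 4 the linear terms add up to 1 + 8 * 4 = 33. *)
- apply: leq_trans szB' (leq_trans szB _).
  have kb := kappa_bound s0 K0 K4.
  move: kb; set k := 40 * _; set Y := size_const * _ => kb.
  have : k * (a * 2 ^ a) <= Y * (#|H| * a).
    apply: leq_trans (leq_mul (leqnn k) (leq_mul (leqnn a) a3)) _.
    apply: leq_trans (leq_mul kb (leqnn (#|H| * a))).
    by clear kb; move: #|H| k (a); clear; lia.
  change #|Hs| with #|H|; move: (k * _) (Y * _) => u v; move: #|H|; clear; lia.
- split=> //; apply: leq_trans cH _.
  move: m2 mbound gs s0; rewrite -/(oedges _); move: #|oedges _| #|G| n2 => m n n2 m2 mb gs s0.
  (* If s <= n, then n + 6 (n + 72 (g + 1)) is at most (7 + 432) s n, which gives 439. If n < s, the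
     trivial bound n + 2 n^2 on the size of [H] is better. *)
  have [sn|ns] := leqP s n.
    have : s * s <= s * n by rewrite leq_mul2l sn orbT.
    have : n <= s * n by rewrite leq_pmull.
    by move: mb gs; clear; lia.
  have : n * n <= s * n by rewrite leq_mul2r ltnW ?orbT.
  have : n <= n * n by rewrite leq_pmulr // ltnW.
  by move: m2; clear; lia.
(* However large g is, [H] has at most n + 2 n^2 vertices, so a = O(log n); the exponent 5 comes
   from 8 n^2 <= n^5. *)
apply: leq_trans a3 _; apply: (@leq_trans (2 * (#|G| + 2 * (#|G| * #|G|)))).
  by rewrite leq_mul2l /=; apply: leq_trans cH _; rewrite leq_add2l leq_mul2l.
move: #|G| n2 => n n2; rewrite !expnS expn0 muln1.
apply: (@leq_trans (8 * (n * n))); first by move: n2; clear; nia.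
have -> : n * (n * (n * (n * n))) = (n * (n * n)) * (n * n) by rewrite -!mulnA.
rewrite leq_mul2r; apply/orP; right; exact: (leq_mul n2 (leq_mul n2 n2)).
Qed.

Local Open Scope ring_scope.

Theorem theorem13 (R : realType) :
  exists C : R, 0 < C /\
    forall (n g : nat) (G : sgraph),
      (2 <= n)%N -> #|G| = n -> has_genus R G g ->
      exists B : G -> {fset voxel},
        voxel_representation B /\
        (rep_size B)%:R <= C * (g.+1)%:R ^+ 2 * n%:R * ln (n%:R : R) ^+ 2.
Proof.
have l2 : 0 < ln (2 : R) by apply: ln_gt0; rewrite ltr1n.
(* From here on the value of the constant is irrelevant; generalising it keeps this large numeral
   from being evaluated. *)
move: size_const embedded_rep => c embedded_rep.
exists ((33 + 5 * c)%:R * (439 * 16)%:R / ln (2 : R) ^+ 2); split.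
  apply: divr_gt0; last by rewrite exprn_gt0.
  by apply: mulr_gt0; rewrite ltr0n ?muln_gt0 ?addn_gt0.
move=> n g G n2 cG [emb _]; rewrite -cG in n2 *.
have [B [s [N [a [repB sz [s0 s4 N4] a5]]]]] := embedded_rep R g G n2 emb.
exists B; split=> //; set x := ln #|G|%:R; set l := ln 2 in l2 *.
have n0 : (0 < #|G|)%N by apply: leq_trans n2.
have lx : l <= x by rewrite ler_ln ?posrE ?ltr0n ?ler_nat.
have ax : a%:R * l <= 5 * x.
  rewrite mulr_natl -lnXn ?ltr0n // [5 * x]mulr_natl -lnXn ?ltr0n //.
  by rewrite ler_ln ?posrE ?exprn_gt0 ?ltr0n // -!natrX ler_nat.
(* [r] is the binary logarithm of n. It is at least 1, so 1 and r are both bounded by r^2. *)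
pose r := x / l; have r1 : 1 <= r by rewrite /r ler_pdivlMr // mul1r.
have ar : a%:R <= 5 * r by rewrite /r mulrA ler_pdivlMr.
pose M := (s * s * s * N)%N.
have NM : (N <= M)%N by rewrite /M leq_pmull // !muln_gt0 s0.
have MG : (M <= 439 * 16 * g.+1 ^ 2 * #|G|)%N.
  have -> : (439 * 16 * g.+1 ^ 2 * #|G| = 4 * g.+1 * (4 * g.+1) * (439 * #|G|))%N.
    by move: #|G| g.+1; clear; move=> u v; lia.
  apply: leq_trans (leq_mul (leq_mul s4 s4) (leqnn _)).
  apply: leq_trans (leq_mul (leqnn (s * s * s)%N) N4) _.
  by rewrite !mulnA; move: #|G|; clear; move=> u; lia.
have szr : (rep_size B)%:R <= (33 + 5 * c)%:R * M%:R * r ^+ 2.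
  have sz' : (rep_size B <= 33 * M + c * (M * a))%N.
    apply: leq_trans sz _; rewrite leq_add ?leq_mul2l ?NM ?orbT //.
    by rewrite /M !mulnA.
  have rr : r <= r ^+ 2 by rewrite expr2 ler_peMr // (le_trans _ r1).
  have : (rep_size B)%:R <= 33 * M%:R + c%:R * (M%:R * a%:R) :> R.
    by rewrite -!natrM -natrD ler_nat.
  move/le_trans; apply.
  have h1 : M%:R <= M%:R * r ^+ 2 by rewrite ler_peMr ?ler0n // (le_trans r1 rr).
  have h2 : c%:R * M%:R * a%:R <= c%:R * M%:R * (5 * r ^+ 2).
    by rewrite ler_wpM2l ?mulr_ge0 ?ler0n // (le_trans ar) // ler_wpM2l // ler0n.
  rewrite (natrD _ 33) (natrM _ 5); move: h1 h2; move: (r ^+ 2) M%:R a%:R c%:R => *; lra.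
apply: le_trans szr _.
have -> : (33 + 5 * c)%:R * (439 * 16)%:R / l ^+ 2 * g.+1%:R ^+ 2 * #|G|%:R * x ^+ 2 =
          (33 + 5 * c)%:R * (439 * 16 * g.+1 ^ 2 * #|G|)%:R * r ^+ 2 :> R.
  by rewrite /r expr_div_n -[(g.+1 ^ 2)%N]/(g.+1 * g.+1)%N !natrM; ring.
by rewrite ler_wpM2r ?exprn_ge0 ?(le_trans _ r1) // ler_wpM2l ?ler0n // ler_nat.
Qed.
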